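(* Let $(M^{16},g)$ be an oriented Riemannian manifold endowed with a $\mathrm{Spin}(9)$-structure. The $\mathrm{Spin}(9)$-structure is of vectorial type if and only if it is locally conformally parallel.
   Context: $\mathrm{Spin}(9)\subset \mathrm{SO}(16)$ is embedded by its $16$-dimensional real spin representation. A $\mathrm{Spin}(9)$-structure on an oriented Riemannian manifold $(M^{16},g)$ is a reduction $\mathcal R$ of the orthonormal frame bundle from $\mathrm{SO}(16)$ to $\mathrm{Spin}(9)$; equivalently, a rank $9$ vector subbundle $V\subset\mathrm{End}(TM)$ locally spanned by $\mathcal I_1,\dots,\mathcal I_9$ with $\mathcal I_\alpha^2=\mathrm{Id}$, $\mathcal I_\alpha^*=\mathcal I_\alpha$, $\mathcal I_\alpha\mathcal I_\beta=-\mathcal I_\beta\mathcal I_\alpha$ for $\alpha\ne\beta$. Vectorial type: write $\mathfrak{so}(16)=\mathfrak{spin}(9)\oplus\mathfrak m$, with $\mathfrak m$ the orthogonal complement. Restricting the Levi-Civita connection form to $\mathcal R$ and splitting it accordingly gives $\nabla=\nabla^*\oplus\theta$, where $\nabla^*$ is a connection in $\mathcal R$ and $\theta$ is a $1$-form on $M$ with values in (the bundle associated with) $\mathfrak m$. As a $\mathrm{Spin}(9)$-representation $\mathfrak m\cong\Lambda^3(V)$, so $\theta$ is a section of $\Lambda^1(M)\otimes\Lambda^3(V)$. Under $\mathrm{Spin}(9)$ this space decomposes into four irreducible components, $\Lambda^1(M)\otimes\Lambda^3(V)=P_0\oplus P_1\oplus P_2\oplus P_3$, where $P_0$ is the component isomorphic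 to $\Lambda^1(M)$. The $\mathrm{Spin}(9)$-structure is of vectorial type if $\theta$ takes values in $P_0$. Locally conformally parallel: there are open sets $U$ covering $M$ with $g|_U=e^{f_U}g'_U$, where $f_U$ is smooth on $U$ and $g'_U$ is a metric on $U$ with holonomy contained in $\mathrm{Spin}(9)$, the bundle $V|_U$ being preserved by the Levi-Civita connection of $g'_U$. *)

(* Defs.v *)
From HB Require Import structures.
From mathcomp Require Import all_boot all_order all_algebra.
From mathcomp Require Import all_classical all_reals all_analysis.
Set Implicit Arguments.
Unset Strict Implicit.
Unset Printing Implicit Defensive.
Import Order.TTheory GRing.Theory Num.Theory.
Import numFieldNormedType.Exports.
Local Open Scope classical_set_scope.
Local Open Scope ring_scope.

(** Smooth maps on (open) subsets of R^n; points and tangent vectors of R^n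
    are column vectors. *)
Section Smooth.
Context {R : realType} {n : nat}.
Local Notation E := 'cV[R]_n.

Definition basis_vec (a : 'I_n) : E := delta_mx a 0.

Fixpoint Ck (k : nat) (D : set E) (f : E -> R) : Prop :=
  (forall x, D x -> {for x, continuous f}) /\
  (if k is k'.+1 then
     forall a : 'I_n, (forall x, D x -> derivable f x (basis_vec a)) /\
                      Ck k' D ('D_(basis_vec a) f)
   else True).

Definition smooth (D : set E) (f : E -> R) := forall k, Ck k D f.

Definition smooth_mx p q (D : set E) (F : E -> 'M[R]_(p, q)) :=
  forall a b, smooth D (fun x => F x a b).

(** Entrywise directional derivative of a matrix-valued map. *)
Definition deriv_mx p q (F : E -> 'M[R]_(p, q)) (x v : E) : 'M[R]_(p, q) :=
  \matrix_(a, b) 'D_v (fun y => F y a b) x.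

Definition jac (f : E -> E) (x : E) : 'M[R]_n :=
  \matrix_(a, b) 'D_(basis_vec b) (fun y => f y a 0) x.

Definition smooth_curve p q (D : set R) (c : R -> 'M[R]_(p, q)) :=
  forall k a b t, D t -> derivable (derive1n k (fun s => c s a b)) t 1.

Definition deriv_curve p q (c : R -> 'M[R]_(p, q)) (t : R) : 'M[R]_(p, q) :=
  \matrix_(a, b) derive1 (fun s => c s a b) t.

End Smooth.

(** A smooth manifold of dimension [n], given by a smooth atlas.  [chart i] is
    only meaningful on [dom i], and [param i] on the open set
    [chart i @` dom i], where it is the inverse of [chart i]. *)
Record manifold (R : realType) (n : nat) := Manifold {
  carrier :> topologicalType;
  carrier_hausdorff : hausdorff_space carrier;
  carrier_second_countable : @second_countable carrier;
  chart_index : Type;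
  dom : chart_index -> set carrier;
  chart : chart_index -> carrier -> 'cV[R]_n;
  param : chart_index -> 'cV[R]_n -> carrier;
  dom_open : forall i, open (dom i);
  dom_cover : \bigcup_(i in setT) dom i = setT;
  img_open : forall i, open (chart i @` dom i);
  chartK : forall i p, dom i p -> param i (chart i p) = p;
  chart_continuous : forall i p, dom i p -> {for p, continuous (chart i)};
  param_continuous : forall i x, (chart i @` dom i) x ->
    {for x, continuous (param i)};
  transition_smooth : forall i j,
    smooth_mx (chart i @` (dom i `&` dom j)) (chart j \o param i)
}.

Section Riemannian.
Context {R : realType} {n : nat} (M : manifold R n).
Local Notation E := 'cV[R]_n.

Definition cdom (i : chart_index M) (U : set M) : set E :=
  chart i @` (dom i `&` U).

Definition transition (i j : chart_index M) : E -> E := chart j \o param i.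

Definition tjac (i j : chart_index M) (x : E) : 'M[R]_n := jac (transition i j) x.

Definition oriented_atlas := forall (i j : chart_index M) x,
  cdom i (dom j) x -> 0 < \det (tjac i j x).

(** Tensor fields are families, indexed by the charts, of their components in
    the coordinates of these charts. *)
Definition riemannian_metric (U : set M) (g : chart_index M -> E -> 'M[R]_n) :=
  [/\ forall i, smooth_mx (cdom i U) (g i),
      forall i x, cdom i U x -> (g i x)^T = g i x,
      forall i x (v : E), cdom i U x -> v != 0 ->
        0 < (v^T *m g i x *m v) 0 0
    & forall i j x, cdom i (dom j `&` U) x ->
        g i x = (tjac i j x)^T *m g j (transition i j x) *m tjac i j x].

(** Christoffel symbol Γ^k_{ab} of the Levi-Civita connection of the metric
    with components [g]. *)
Definition christoffel (g : E -> 'M[R]_n) (x : E) (k a b : 'I_n) : R :=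
  2^-1 * \sum_l invmx (g x) k l *
    ('D_(basis_vec a) (fun y => g y b l) x
     + 'D_(basis_vec b) (fun y => g y a l) x
     - 'D_(basis_vec l) (fun y => g y a b) x).

(** The endomorphism Γ(v), so that ∇_v Y = D_v Y + Γ(v) Y. *)
Definition levi_civita (g : E -> 'M[R]_n) (x v : E) : 'M[R]_n :=
  \matrix_(k, b) \sum_a v a 0 * christoffel g x k a b.

(** [ptransport U g i x j y P]: in the coordinates of the charts [i] and [j],
    [P] is the parallel transport T_x M -> T_y M of the Levi-Civita connection
    of [g] along a piecewise smooth path of [U], cut into pieces that lie in a
    single chart. *)
Inductive ptransport (U : set M) (g : chart_index M -> E -> 'M[R]_n) :
  chart_index M -> E -> chart_index M -> E -> 'M[R]_n -> Prop :=
| ptransport_chart i j x of cdom i (dom j `&` U) x :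
    ptransport U g i x j (transition i j x) (tjac i j x)
| ptransport_path i (D : set R) (c : R -> E) (P : R -> 'M[R]_n)
    of open D & `[0, 1]%classic `<=` D & (forall t, D t -> cdom i U (c t))
    & smooth_curve D c & smooth_curve D P & P 0 = 1%:M
    & (forall t, D t -> deriv_curve P t =
         - (levi_civita (g i) (c t) (deriv_curve c t) *m P t)) :
    ptransport U g i (c 0) i (c 1) (P 1)
| ptransport_comp i j k x y z P P'
    of ptransport U g i x j y P & ptransport U g j y k z P' :
    ptransport U g i x k z (P' *m P).

Definition holonomy U g i x : set 'M[R]_n :=
  [set A | ptransport U g i x i x A].

(** Reduction to [G] of the bundle of oriented orthonormal frames of [g].
    [Q i x] is the set of the frames at [x] that belong to the reduction; the
    columns of a matrix [F] in [Q i x] are the vectors of the frame. *)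
Definition reduction (G : set 'M[R]_n) (g : chart_index M -> E -> 'M[R]_n)
    (Q : chart_index M -> E -> set 'M[R]_n) :=
  [/\ forall i x F, cdom i setT x -> Q i x F ->
        F^T *m g i x *m F = 1%:M /\ 0 < \det F,
      forall i x F F', cdom i setT x -> Q i x F ->
        (Q i x F' <-> exists2 A, G A & F' = F *m A),
      forall i j x F, cdom i (dom j) x ->
        (Q i x F <-> Q j (transition i j x) (tjac i j x *m F))
    & forall i x, cdom i setT x -> exists (W : set E) (F : E -> 'M[R]_n),
        [/\ open W, W x, W `<=` cdom i setT, smooth_mx W F
          & forall y, W y -> Q i y (F y)]].

End Riemannian.

Section Spin9.
Context {R : realType}.
Implicit Type J : 'I_9 -> 'M[R]_16.

(** Nine anticommuting symmetric involutions of R^16; they make R^16 a module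
    over the Clifford algebra of R^9, whose restriction to Spin(9) is the
    spin representation. *)
Definition clifford_system J :=
  [/\ forall a, J a *m J a = 1%:M,
      forall a, (J a)^T = J a
    & forall a b, a != b -> J a *m J b = - (J b *m J a)].

Definition clifford_mul J (v : 'cV[R]_9) : 'M[R]_16 := \sum_a v a 0 *: J a.

(** Image in SO(16) of Spin(9), the group of the products of an even number
    of unit vectors in the Clifford algebra. *)
Definition Spin9 J : set 'M[R]_16 := [set A | exists s : seq 'cV[R]_9,
  [/\ ~~ odd (size s), forall v, v \in s -> v^T *m v = 1%:M
    & A = \big[mulmx/1%:M]_(v <- s) clifford_mul J v]].

Definition spin9_lie J : set 'M[R]_16 := [set A | exists c : 'M[R]_9,
  A = \sum_(a < 9) \sum_(b < 9 | (a < b)%N) c a b *: (J a *m J b)].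

(** Orthogonal complement of spin(9) in so(16). *)
Definition m_compl J : set 'M[R]_16 := [set B | B^T = - B /\
  forall A, spin9_lie J A -> \tr (A^T *m B) = 0].

(** Embeddings w |-> (v |-> T w v) of the Spin(9)-module R^16 into
    Hom(R^16, m) = Λ^1 ⊗ m.  R^16 is identified with its dual Λ^1 by the
    metric, and [A^T] is the inverse of [A] in SO(16). *)
Definition spin9_embedding J (T : 'cV[R]_16 -> 'cV[R]_16 -> 'M[R]_16) :=
  [/\ (forall v, linear (T^~ v)) /\ (forall w, linear (T w)),
      forall w v, m_compl J (T w v),
      forall A w v, Spin9 J A -> T (A *m w) (A *m v) = A *m T w v *m A^T
    & forall w, (forall v, T w v = 0) -> w = 0].

(** The irreducible component of Λ^1 ⊗ m that is isomorphic to Λ^1, i.e. the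
    image of such an embedding. *)
Definition P0 J : set ('cV[R]_16 -> 'M[R]_16) := [set xi |
  exists2 T, spin9_embedding J T & exists w, forall v, xi v = T w v].

Context (M : manifold R 16).
Local Notation E := 'cV[R]_16.
Implicit Types (g : chart_index M -> E -> 'M[R]_16) (Q : chart_index M -> E -> set 'M[R]_16).

(** Levi-Civita connection form of [g], in the moving frame [F]. *)
Definition connection_form (g : E -> 'M[R]_16) (F : E -> 'M[R]_16) (x v : E) :
    'M[R]_16 :=
  invmx (F x) *m (deriv_mx F x v + levi_civita g x v *m F x).

(** In every local section [F] of the reduction, the m-part [theta] of the
    Levi-Civita connection form lies in P0; [u] stands for the components in
    the frame [F] of a tangent vector. *)
Definition vectorial_type J g Q :=
  forall i (W : set E) (F : E -> 'M[R]_16),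
    open W -> W `<=` cdom i setT -> smooth_mx W F ->
    (forall y, W y -> Q i y (F y)) ->
  forall x, W x -> exists theta : E -> 'M[R]_16,
    [/\ forall u, m_compl J (theta u),
        forall u, spin9_lie J (connection_form (g i) F x (F x *m u) - theta u)
      & P0 J theta].

(** Fibre at [x] of the rank 9 subbundle V of End(TM). *)
Definition V_bundle J Q (i : chart_index M) (x : E) : set 'M[R]_16 := [set A |
  exists F v, Q i x F /\ A = F *m clifford_mul J v *m invmx F].

Definition preserves_V J Q (U : set M) g :=
  forall i (W : set E) (A : E -> 'M[R]_16),
    open W -> W `<=` cdom i U -> smooth_mx W A ->
    (forall y, W y -> V_bundle J Q i y (A y)) ->
  forall x v, W x -> V_bundle J Q i x
    (deriv_mx A x v + levi_civita (g i) x v *m A x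
                    - A x *m levi_civita (g i) x v).

(** [F Spin(9) F^-1] is the copy of Spin(9) in GL(T_x M) defined by the
    structure; rescaling the frame [F] does not change it. *)
Definition holonomy_in_Spin9 J Q (U : set M) g :=
  forall i x F A, cdom i U x -> Q i x F -> holonomy U g i x A ->
  Spin9 J (invmx F *m A *m F).

Definition locally_conformally_parallel J g Q :=
  exists C : set (set M), \bigcup_(U in C) U = setT /\
  forall U, C U -> open U /\
  exists (f : M -> R) (g' : chart_index M -> E -> 'M[R]_16),
    [/\ forall i, smooth (cdom i U) (f \o param i),
        riemannian_metric U g',
        forall i x, cdom i U x -> g i x = expR (f (param i x)) *: g' i x,
        holonomy_in_Spin9 J Q U g'
      & preserves_V J Q U g'].

End Spin9.

(* Main.v *)
From HB Require Import structures.
Require Import Defs.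
From mathcomp Require Import all_boot all_order all_algebra.
From mathcomp Require Import all_classical all_reals all_analysis.
From mathcomp Require Import ring lra zify.
Set Implicit Arguments.
Unset Strict Implicit.
Unset Printing Implicit Defensive.
Import Order.TTheory GRing.Theory Num.Theory.
Import numFieldNormedType.Exports.
Local Open Scope ring_scope.

(** By Schur's lemma the copy of Λ^1 in Λ^1 ⊗ m is spanned by the m-parts of the
    maps u |-> u ∧ w, so a structure is of vectorial type iff in each adapted
    frame the Levi-Civita form is u |-> u ∧ w modulo spin(9).  A conformal change
    g = e^f g' alters the Levi-Civita form exactly by such a term and by a multiple
    of the identity, with w dual to df / 2; this gives one implication.  For the
    converse, w is dual to half of a 1-form η, and the Weyl connection of (g, η) has
    connection form in spin(9) ⊕ R.  Its curvature is a torsion-free curvature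
    tensor with values in spin(9) ⊕ R; contracting the Bianchi identity with 1 and
    with the J_a shows that its trace part, a multiple of dη, is zero.  By the
    Poincaré lemma η = df locally, and e^-f g is the required metric: its connection
    form lies in spin(9) up to a multiple of the identity, hence it preserves V,
    and parallel transport, being the solution of a linear differential equation
    in spin(9), stays in Spin(9), the group of the orthogonal matrices that
    normalise the span of the J_a. *)

(** * The Clifford algebra of R^9 and Spin(9) *)

(** Traces replace a decomposition of Λ^1 ⊗ Λ^3. The products of at most four of the nine generators
    are 2^8 = 16^2 matrices, orthogonal for the trace form; degrees 0, 1 and 4 are symmetric,
    degrees 2 and 3 skew. So degree 2 is spin(9), degree 3 is m ≅ Λ^3(V), and a skew matrix lies in
    spin(9) once its traces against the [J a * J b * J c] vanish. The algebra spin(9) ⊕ R appears as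
    the set of matrices whose commutators preserve the span of the [J a]: a linear condition without
    coefficients, which passes to brackets and to derivatives. The delicate point is dη = 0. If ψ is
    the trace part of the curvature and ρ_ab its component along J_a J_b, contraction with 1 only
    gives Σ [ρ_ab, J_a J_b] = 14 ψ. The contractions with J_c, multiplied by J_c on the left or on
    the right and summed over c, involve the averages Σ_c J_c X J_c of X = ψ, ρ_ab and J_a J_b.
    Averaging is equivariant under spin(9), so ρ can be eliminated; what remains is 88 ψ + 16 Σ_c
    J_c ψ J_c = 0, and the operator applied to ψ is injective. *)

Section CliffordAlgebra.
Context {R : realType} (J : 'I_9 -> 'M[R]_16) (hJ : clifford_system J).
Implicit Types (s t : seq 'I_9) (S T : {set 'I_9}) (X Y : 'M[R]_16).

Lemma cliffordJJ a : J a * J a = 1. Proof. by case: hJ => h _ _; exact: h. Qed.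

Lemma cliffordT a : (J a)^T = J a. Proof. by case: hJ => _ h _; exact: h. Qed.

Lemma cliffordC a b : a != b -> J a * J b = - (J b * J a).
Proof. by case: hJ => _ _; apply. Qed.

Lemma mxtr_mulC X Y : \tr (X * Y) = \tr (Y * X).
Proof. exact: mxtrace_mulC. Qed.

Lemma trmx_mulr X Y : (X * Y)^T = Y^T * X^T.
Proof. exact: trmx_mul. Qed.

Definition clifford_prod s : 'M[R]_16 := \prod_(a <- s) J a.

Lemma clifford_prod_comm s b : uniq s ->
  clifford_prod s * J b =
    (-1) ^+ (size s + (b \in s)) *: (J b * clifford_prod s).
Proof.
elim: s => [|a s IH] /=; first by rewrite /clifford_prod big_nil mul1r mulr1 scale1r.
case/andP => as_ us; rewrite /clifford_prod big_cons -/(clifford_prod s) -mulrA IH //.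
rewrite in_cons; case: (eqVneq b a) => [->|ba] /=.
  by rewrite (negbTE as_) addn0 addn1 -scalerAr mulrA !exprS mulrA mulrNN !mul1r.
by rewrite -scalerAr !mulrA (cliffordC ba) addSn exprS mulN1r scaleNr mulNr scalerN opprK.
Qed.

Lemma clifford_prod_tr_mul s : (clifford_prod s)^T * clifford_prod s = 1.
Proof.
elim: s => [|a s IH]; first by rewrite /clifford_prod big_nil trmx1 mul1r.
rewrite /clifford_prod big_cons -/(clifford_prod s) trmx_mulr cliffordT.
by rewrite -mulrA (mulrA (J a)) cliffordJJ mul1r.
Qed.

Lemma mulmx_tr_sym X : X^T * X = 1 -> X * X^T = 1.
Proof. exact: mulmx1C. Qed.

(** Conjugation by the involution [J b] preserves the trace and reverses the sign of [X]. *)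
Lemma mxtr_anticomm b X : X * J b = - (J b * X) -> \tr X = 0.
Proof.
move=> h; have : \tr X = - \tr X.
  rewrite -{1}[X]mulr1 -(cliffordJJ b) mulrA h mulNr raddfN /= mxtr_mulC.
  by rewrite mulrA cliffordJJ mul1r.
lra.
Qed.

Lemma clifford_prod_tr_comm s b : uniq s ->
  (clifford_prod s)^T * J b =
    (-1) ^+ (size s + (b \in s)) *: (J b * (clifford_prod s)^T).
Proof.
move=> us; rewrite -{1}(cliffordT b) -trmx_mulr.
have -> : J b * clifford_prod s = (-1) ^+ (size s + (b \in s)) *: (clifford_prod s * J b).
  by rewrite clifford_prod_comm // scalerA -expr2 sqrr_sign scale1r.
by rewrite linearZ /= trmx_mulr cliffordT.
Qed.

Lemma mxtr_clifford_prod s X b (e : nat) : uniq s ->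
  X * J b = (-1) ^+ e *: (J b * X) -> odd (size s + (b \in s) + e) ->
  \tr ((clifford_prod s)^T * X) = 0.
Proof.
move=> us hX ho; apply: (@mxtr_anticomm b).
rewrite -mulrA hX -scalerAr [in LHS]mulrA clifford_prod_tr_comm //.
by rewrite -scalerAl scalerA -exprD addnC -signr_odd ho expr1 scaleN1r mulrA.
Qed.

(** Two products have the same commutation sign with every generator only if their index sets are
    equal or complementary; complementary sets would have nine elements in all, more than 4 + 4. *)
Lemma subset9_sign S T : (#|S| <= 4)%N -> (#|T| <= 4)%N -> S != T ->
  exists b, odd (#|S| + (b \in S) + (#|T| + (b \in T))).
Proof.
move=> hS hT nST.
case: (boolP [exists b, odd (#|S| + (b \in S) + (#|T| + (b \in T)))]) => [/existsP //|].
rewrite negb_exists => /forallP h; exfalso.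
have h' b : (b \in S) (+) (b \in T) = odd (#|S| + #|T|).
  have := h b; rewrite !oddD !oddb.
  by case: (odd #|S|); case: (odd #|T|); case: (b \in S); case: (b \in T).
case: (boolP (odd (#|S| + #|T|))) => ho.
  have e : T = ~: S.
    apply/setP => b; rewrite inE; have := h' b; rewrite ho.
    by case: (b \in S); case: (b \in T).
  have := cardsC S; rewrite -e card_ord => e9.
  by have := leq_add hS hT; rewrite e9.
case/negP: nST; apply/eqP/setP => b; have := h' b; rewrite (negbTE ho).
by case: (b \in S); case: (b \in T).
Qed.

(** Complementation exchanges the subsets with at most four elements and those with at least five,
    so the former are half of the 2^9 subsets. *)
Lemma card_small_subsets9 : #|[set S : {set 'I_9} | (#|S| <= 4)%N]%SET| = 256.
Proof.
set A := [set S : {set 'I_9} | (#|S| <= 4)%N]%SET.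
have e : ~: A = (@finset.setC 'I_9) @: A.
  apply/setP => S; rewrite !inE; apply/idP/imsetP => [h|[T]].
    exists (~: S)%SET; last by rewrite finset.setCK.
    by have := cardsC S; move: h; rewrite inE card_ord; lia.
  by rewrite inE => hT ->; have := cardsC T; rewrite card_ord; lia.
have := cardsC A; rewrite e card_imset; last exact: (can_inj finset.setCK).
rewrite -cardsT -powersetT card_powerset cardsT card_ord addnn => /(congr1 half).
by rewrite doubleK => ->.
Qed.

(** The equality of the dimensions is a hypothesis because the number of small subsets equals 16 *
    16 by a proof, not by conversion. *)
Lemma mulmx_tr_scalar m n (e : m = n) (c : R) (A : 'M[R]_(m, n)) :
  c != 0 -> A *m A^T = c%:M -> A^T *m A = c%:M.
Proof.
subst n => c0 h; have : (c^-1 *: A^T) *m A = 1%:M.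
  by apply: mulmx1C; rewrite -scalemxAr h scale_scalar_mx mulVf.
move=> /(congr1 ( *:%R c)); rewrite -scalemxAl scalerA divff // scale1r => ->.
by rewrite scale_scalar_mx mulr1.
Qed.

Lemma mxtr_tr_mul X Y : \tr (X^T * Y) = \sum_i \sum_j X i j * Y i j.
Proof.
rewrite exchange_big /mxtrace; apply: eq_bigr => j _.
by rewrite mxE; apply: eq_bigr => i _; rewrite mxE.
Qed.

(* The 256 products of at most four generators are orthogonal for the trace form,
   hence a basis of the 256-dimensional matrix algebra. *)
Lemma clifford_prod_expand X :
  16 *: X = \sum_(S : {set 'I_9} | (#|S| <= 4)%N)
    \tr ((clifford_prod (enum S))^T * X) *: clifford_prod (enum S).
Proof.
pose A := [set S : {set 'I_9} | (#|S| <= 4)%N]%SET.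
pose P (i : 'I_#|A|) := clifford_prod (enum (enum_val i)).
pose B : 'M[R]_(#|A|, 16 * 16) := \matrix_(i, k) mxvec (P i) 0 k.
have sum_mxvec (f : 'I_(16 * 16) -> R) : \sum_k f k = \sum_i \sum_j f (mxvec_index i j).
  rewrite pair_bigA (reindex (uncurry (@mxvec_index 16 16))) /=; first by apply: eq_bigr => -[].
  exact: (subon_bij _ (curry_mxvec_bij 16 16)).
have hB : B *m B^T = 16%:M.
  apply/matrixP => i k; rewrite mxE sum_mxvec.
  under eq_bigr do under eq_bigr do rewrite !mxE !mxvecE.
  rewrite -mxtr_tr_mul !mxE; case: (eqVneq i k) => [<-|ik].
    by rewrite clifford_prod_tr_mul mxtrace1.
  have := enum_valP i; have := enum_valP k; rewrite !inE => hk hi.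
  have nik : enum_val i != enum_val k by rewrite (inj_eq enum_val_inj).
  have [b hb] := subset9_sign hi hk nik.
  have := clifford_prod_comm b (enum_uniq (enum_val k)).
  move=> /(@mxtr_clifford_prod _ _ b); apply; first exact: enum_uniq.
  by rewrite -!cardE !mem_enum.
(* [B] is square, so orthogonality of its rows gives orthogonality of its columns, which is the
   completeness relation behind the expansion. *)
have hB' : B^T *m B = 16%:M.
  by apply: mulmx_tr_scalar => //; rewrite ?card_small_subsets9 // pnatr_eq0.
have e : 16 *: X = \sum_(i < #|A|) \tr ((P i)^T * X) *: P i.
  apply: (can_inj (@mxvecK _ 16 16)); rewrite linearZ /= -mul_mx_scalar -hB' mulmxA.
  apply/rowP => k; rewrite mxE linear_sum summxE; apply: eq_bigr => i _.
  rewrite linearZ !mxE; congr (_ * _).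
  rewrite sum_mxvec mxtr_tr_mul; apply: eq_bigr => a _; apply: eq_bigr => b _.
  by rewrite !mxE !mxvecE mulrC.
rewrite e /P.
have := big_enum_val (op := +%R) (idx := 0) (A := mem A)
  (fun S => \tr ((clifford_prod (enum S))^T * X) *: clifford_prod (enum S)).
by move=> /= <-; apply: eq_bigl => S; rewrite inE.
Qed.

Lemma mx16_eq0 X : 16 *: X = 0 -> X = 0.
Proof. by move=> /eqP; rewrite scaler_eq0 pnatr_eq0 => /eqP. Qed.

Lemma clifford_expand_eq0 X :
  (forall S, (#|S| <= 4)%N -> \tr ((clifford_prod (enum S))^T * X) = 0) -> X = 0.
Proof.
move=> h; apply: mx16_eq0; rewrite clifford_prod_expand big1 // => S hS.
by rewrite h // scale0r.
Qed.

(** Each nonempty product of at most four generators anticommutes with some generator, so its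
    coefficient in the expansion of [X] vanishes. *)
Lemma clifford_commutant X : (forall a, X * J a = J a * X) -> X = (\tr X / 16) *: 1.
Proof.
move=> h; suff e : 16 *: X = \tr X *: 1.
  by rewrite mulrC -scalerA -e scalerA mulVf ?scale1r // pnatr_eq0.
rewrite clifford_prod_expand (bigD1 finset.set0) ?cards0 //= big1 => [|S /andP[hS nS]].
  by rewrite addr0 enum_set0 /clifford_prod big_nil trmx1 mul1r.
have [|b hb] := subset9_sign hS _ nS; first by rewrite cards0.
rewrite (@mxtr_clifford_prod _ X b 0) ?scale0r ?enum_uniq ?h ?expr0 ?scale1r //.
by move: hb; rewrite cards0 inE -cardE mem_enum !addn0.
Qed.

Definition clifford_vol : 'M[R]_16 := clifford_prod (enum 'I_9).

Lemma clifford_vol_comm a : clifford_vol * J a = J a * clifford_vol.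
Proof.
by rewrite clifford_prod_comm ?enum_uniq // -cardE card_ord mem_enum -signr_odd /= scale1r.
Qed.

Lemma scalar_sqr1 X (c : R) : X = c *: 1 -> X * X^T = 1 -> X = 1 \/ X = - 1.
Proof.
move=> -> /matrixP/(_ 0 0); rewrite -scalerAl mul1r linearZ /= trmx1 scalerA !mxE mulr1.
rewrite mulr1n => /eqP; rewrite -expr2 sqrf_eq1 => /orP[] /eqP->; [left|right].
  by rewrite scale1r.
by rewrite scaleN1r.
Qed.

(** Nine is odd, so the volume element commutes with all generators and is a scalar; orthogonality
    leaves 1 and -1. Both signs occur, since [J] and [- J] are both Clifford systems. *)
Lemma clifford_volE : clifford_vol = 1 \/ clifford_vol = - 1.
Proof.
apply: scalar_sqr1 (clifford_commutant clifford_vol_comm) _.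
exact/mulmx_tr_sym/clifford_prod_tr_mul.
Qed.

Lemma clifford_prod_rem s a : uniq s -> a \in s ->
  exists b : bool, clifford_prod s = (-1) ^+ b *: (J a * clifford_prod (rem a s)).
Proof.
elim: s => // c s IH /andP[cs us]; rewrite in_cons [rem _ _]/=.
case: (eqVneq a c) => [->|ac] /=.
  by move=> _; exists false; rewrite scale1r /clifford_prod big_cons.
move=> as_; have [b e] := IH us as_; exists (~~ b).
rewrite /clifford_prod !big_cons -!/(clifford_prod _) e -scalerAr !mulrA (cliffordC ac).
by rewrite mulNr scalerN -scaleNr; case: (b); rewrite ?opprK.
Qed.

(** The volume element being 1 or -1, each generator is up to sign the product of the eight others;
    commuting with even products is thus commuting with everything. This is the irreducibility of
    R^16 under Spin(9), with real scalars as commutant. *)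
Lemma clifford_even_commutant X :
  (forall a b, a != b -> X * (J a * J b) = J a * J b * X) -> X = (\tr X / 16) *: 1.
Proof.
move=> h; apply: clifford_commutant => a.
have [e|[c e]] : clifford_vol = 0 \/ exists c : bool,
    J a = (-1) ^+ c *: clifford_prod (rem a (enum 'I_9)).
- have [b] := clifford_prod_rem (enum_uniq 'I_9) (mem_enum 'I_9 a).
  rewrite -/clifford_vol => e; right.
  have e' : J a * clifford_vol = (-1) ^+ b *: clifford_prod (rem a (enum 'I_9)).
    by rewrite e -scalerAr mulrA cliffordJJ mul1r.
  case: clifford_volE e' => ->; rewrite ?mulr1 ?mulrN1 => e'; first by exists b.
  by exists (~~ b); rewrite -[J a]opprK e' -scaleNr; case: (b); rewrite ?opprK.
- by case: clifford_volE => e1; move: e; rewrite e1 => /eqP; rewrite ?oppr_eq0 oner_eq0.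
suff H s : uniq s -> ~~ odd (size s) -> X * clifford_prod s = clifford_prod s * X.
  rewrite e -scalerAl -scalerAr H ?rem_uniq ?enum_uniq //.
  by rewrite size_rem ?mem_enum // -cardE card_ord.
move: (leqnn (size s)); move: {2}(size s) => n; elim: n s => [|n IH] [|b [|d s]] //=.
- by rewrite /clifford_prod big_nil mulr1 mul1r.
- by rewrite /clifford_prod big_nil mulr1 mul1r.
rewrite negbK ltnS => hs /and3P[]; rewrite in_cons negb_or => /andP[bd _] _ us os.
rewrite /clifford_prod !big_cons -/(clifford_prod s) [J b * _]mulrA mulrA h // -mulrA.
by rewrite IH ?mulrA // ltnW.
Qed.

Definition ad X Y : 'M[R]_16 := X * Y - Y * X.

Lemma ad_linearr X : linear (ad X).
Proof. by move=> k Y Z; rewrite /ad mulrDr mulrDl -scalerAr -scalerAl scalerBr addrACA opprD. Qed.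

HB.instance Definition _ X := GRing.isLinear.Build R _ _ _ (ad X) (ad_linearr X).

Lemma ad_sumr (I : Type) (r : seq I) (P : pred I) X (F : I -> 'M[R]_16) :
  ad X (\sum_(i <- r | P i) F i) = \sum_(i <- r | P i) ad X (F i).
Proof. exact: linear_sum. Qed.

Lemma adC X Y : ad X Y = - ad Y X. Proof. by rewrite /ad opprB. Qed.

Lemma ad_suml (I : Type) (r : seq I) (P : pred I) X (F : I -> 'M[R]_16) :
  ad (\sum_(i <- r | P i) F i) X = \sum_(i <- r | P i) ad (F i) X.
Proof. by rewrite adC ad_sumr -sumrN; apply: eq_bigr => i _; rewrite -adC. Qed.

Lemma adZr k X Y : ad X (k *: Y) = k *: ad X Y. Proof. exact: linearZ. Qed.

Lemma adZl k X Y : ad (k *: X) Y = k *: ad X Y.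
Proof. by rewrite adC adZr -scalerN -adC. Qed.

Lemma adDl X Y Z : ad (X + Y) Z = ad X Z + ad Y Z.
Proof. by rewrite adC (linearD (ad Z)) opprD -!adC. Qed.

Lemma ad1 X : ad 1 X = 0. Proof. by rewrite /ad mul1r mulr1 subrr. Qed.

Lemma jacobi X Y Z : ad (ad X Y) Z = ad X (ad Y Z) - ad Y (ad X Z).
Proof.
rewrite /ad !mulrBr !mulrBl !mulrA.
move: (X * Y * Z) (Y * X * Z) (Z * X * Y) (Z * Y * X) (X * Z * Y) (Y * Z * X).
by move=> a b c d e f; apply/matrixP => i j; rewrite !mxE; ring.
Qed.

Lemma mxtr_cliffordC X a b : \tr (J a * ad X (J b)) = - \tr (J b * ad X (J a)).
Proof.
rewrite /ad !mulrBr !(raddfB (@mxtrace R 16)) opprB; congr (_ - _).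
  rewrite (mulrA (J a)); exact: mxtr_mulC.
rewrite (mulrA (J b) X); exact: mxtr_mulC.
Qed.

Lemma mxtr_clifford2 a b : \tr (J a * J b) = 16 * (a == b)%:R.
Proof.
case: (eqVneq a b) => [<-|ab]; first by rewrite cliffordJJ mxtrace1 mulr1.
have := cliffordC ab => /(congr1 (@mxtrace _ _)); rewrite raddfN /= (mxtr_mulC (J b)).
by rewrite mulr0; lra.
Qed.

Definition clifford_proj X : 'M[R]_16 := \sum_a (\tr (J a * X) / 16) *: J a.

Lemma clifford_proj_linear : linear clifford_proj.
Proof.
move=> k X Y; rewrite /clifford_proj scaler_sumr -big_split /=; apply: eq_bigr => a _.
by rewrite mulrDr -scalerAr mxtraceD mxtraceZ mulrDl scalerDl -mulrA scalerA.
Qed.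

HB.instance Definition _ := GRing.isLinear.Build R _ _ _ clifford_proj clifford_proj_linear.

Lemma clifford_projD X Y : clifford_proj (X + Y) = clifford_proj X + clifford_proj Y.
Proof. exact: linearD. Qed.

Lemma clifford_projZ k X : clifford_proj (k *: X) = k *: clifford_proj X.
Proof. exact: linearZ. Qed.

(** Membership in the span of the [J a], written as a fixed-point equation for a constant linear map
    so that it can be differentiated. *)
Definition in_clifford X := clifford_proj X = X.

Lemma mxtr_clifford_sum a (c : 'I_9 -> R) : \tr (J a * \sum_b c b *: J b) = 16 * c a.
Proof.
rewrite mulr_sumr raddf_sum /= (bigD1 a) //= big1 => [|b ba].
  by rewrite -scalerAr mxtraceZ mxtr_clifford2 eqxx addr0 mulr1 mulrC.
by rewrite -scalerAr mxtraceZ mxtr_clifford2 eq_sym (negbTE ba) !mulr0.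
Qed.

Lemma in_clifford_sum (c : 'I_9 -> R) : in_clifford (\sum_b c b *: J b).
Proof.
apply: eq_bigr => a _; by rewrite mxtr_clifford_sum mulrC mulKf.
Qed.

Lemma in_clifford_mul v : in_clifford (clifford_mul J v).
Proof. exact: in_clifford_sum. Qed.

Lemma in_cliffordP X : in_clifford X <-> exists v, X = clifford_mul J v.
Proof.
split=> [<-|[v ->]]; last exact: in_clifford_mul.
exists (\col_a (\tr (J a * X) / 16)); apply: eq_bigr => a _; by rewrite mxE.
Qed.

Lemma in_cliffordE X : in_clifford X -> X = \sum_a (\tr (J a * X) / 16) *: J a.
Proof. by move=> {1}<-. Qed.

Lemma in_clifford0 : in_clifford 0. Proof. exact: linear0. Qed.

Lemma in_cliffordD X Y : in_clifford X -> in_clifford Y -> in_clifford (X + Y).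
Proof. by move=> hX hY; rewrite /in_clifford clifford_projD hX hY. Qed.

Lemma in_cliffordZ k X : in_clifford X -> in_clifford (k *: X).
Proof. by move=> hX; rewrite /in_clifford clifford_projZ hX. Qed.

Lemma in_cliffordN X : in_clifford X -> in_clifford (- X).
Proof. by rewrite -scaleN1r; exact: in_cliffordZ. Qed.

Lemma in_clifford_bigsum (I : Type) (r : seq I) (P : pred I) (F : I -> 'M[R]_16) :
  (forall i, P i -> in_clifford (F i)) -> in_clifford (\sum_(i <- r | P i) F i).
Proof. by move=> h; apply: big_ind => //; [exact: in_clifford0|exact: in_cliffordD]. Qed.

Lemma in_clifford_gen a : in_clifford (J a).
Proof.
rewrite (_ : J a = \sum_b (b == a)%:R *: J b); first exact: in_clifford_sum.
rewrite (bigD1 a) //= big1 => [|b /negbTE->]; first by rewrite eqxx scale1r addr0.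
by rewrite scale0r.
Qed.

Lemma in_cliffordT X : in_clifford X -> X^T = X.
Proof.
move=> /in_cliffordE e; rewrite e linear_sum; apply: eq_bigr => a _.
by rewrite linearZ /= cliffordT.
Qed.

Lemma trmx_bigsum (I : Type) (r : seq I) (P : pred I) (F : I -> 'M[R]_16) :
  (\sum_(i <- r | P i) F i)^T = \sum_(i <- r | P i) (F i)^T.
Proof. exact: linear_sum. Qed.

(** The normaliser of the span of the generators in gl(16), that is spin(9) ⊕ R. *)
Definition clifford_normalizing X := forall a, in_clifford (ad X (J a)).

Lemma ad_in_clifford X Y : clifford_normalizing X -> in_clifford Y -> in_clifford (ad X Y).
Proof.
move=> hX /in_cliffordE->; rewrite ad_sumr; apply: in_clifford_bigsum => a _.
by rewrite adZr; apply: in_cliffordZ.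
Qed.

Lemma normalizing0 : clifford_normalizing 0.
Proof. by move=> a; rewrite adC (linear0 (ad (J a))) oppr0; exact: in_clifford0. Qed.

Lemma normalizingD X Y : clifford_normalizing X -> clifford_normalizing Y ->
  clifford_normalizing (X + Y).
Proof. by move=> hX hY a; rewrite adDl; exact: in_cliffordD. Qed.

Lemma normalizingZ k X : clifford_normalizing X -> clifford_normalizing (k *: X).
Proof. by move=> hX a; rewrite adZl; exact: in_cliffordZ. Qed.

Lemma normalizingN X : clifford_normalizing X -> clifford_normalizing (- X).
Proof. by rewrite -scaleN1r; exact: normalizingZ. Qed.

Lemma normalizing1 : clifford_normalizing 1.
Proof. by move=> a; rewrite ad1; exact: in_clifford0. Qed.

Lemma normalizing_sum (I : Type) (r : seq I) (P : pred I) (F : I -> 'M[R]_16) :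
  (forall i, P i -> clifford_normalizing (F i)) ->
  clifford_normalizing (\sum_(i <- r | P i) F i).
Proof. by move=> h; apply: big_ind => //; [exact: normalizing0|exact: normalizingD]. Qed.

Lemma normalizing_ad X Y : clifford_normalizing X -> clifford_normalizing Y ->
  clifford_normalizing (ad X Y).
Proof.
move=> hX hY a; rewrite jacobi; apply: in_cliffordD; last apply: in_cliffordN.
  exact/ad_in_clifford/hY.
exact/ad_in_clifford/hX.
Qed.

Lemma ad_clifford2 a b c : ad (J a * J b) (J c) =
  (2 * (b == c)%:R) *: J a - (2 * (a == c)%:R) *: J b.
Proof.
case: (eqVneq a b) => [<-|ab]; first by rewrite cliffordJJ ad1 subrr.
rewrite /ad; case: (eqVneq b c) => [bc|bc]; case: (eqVneq a c) => [ac|ac].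
- by move: ab; rewrite bc ac eqxx.
- rewrite -bc -mulrA cliffordJJ mulr1 mulrA (cliffordC (a := b)) 1?eq_sym //.
  by rewrite mulNr -mulrA cliffordJJ !mulr1 opprK mulr0 scale0r subr0 scaler_nat mulr2n.
- rewrite -ac mulrA cliffordJJ mul1r -mulrA (cliffordC (a := b)) 1?eq_sym //.
  rewrite mulrN mulrA cliffordJJ mul1r !mulr1 mulr0 scale0r sub0r scaler_nat mulr2n.
  by rewrite opprD.
- rewrite !mulr0 !scale0r subr0 -mulrA (cliffordC bc) mulrN [J a * (_ * _)]mulrA (cliffordC ac).
  by rewrite mulNr opprK mulrA subrr.
Qed.

Lemma normalizing_clifford2 a b : clifford_normalizing (J a * J b).
Proof.
move=> c; rewrite ad_clifford2; apply: in_cliffordD; last apply: in_cliffordN.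
  exact/in_cliffordZ/in_clifford_gen.
exact/in_cliffordZ/in_clifford_gen.
Qed.

(** For antisymmetric ρ the commutator of Σ ρ_ab J_a J_b, summed over ordered pairs, with J_c is 4
    Σ_a ρ_ac J_a. With tr (J_a J_a) = 16 this makes 64. *)
Definition spin9_coef X a b : R := \tr (J a * ad X (J b)) / 64.

Lemma spin9_coefC X a b : spin9_coef X a b = - spin9_coef X b a.
Proof. by rewrite /spin9_coef mxtr_cliffordC mulNr. Qed.

(** Both sides have the same commutators with the generators, so they differ by a scalar, and the
    double sum is traceless. *)
Lemma normalizingE X : clifford_normalizing X ->
  X = (\tr X / 16) *: 1 + \sum_a \sum_b spin9_coef X a b *: (J a * J b).
Proof.
move=> hX; set C := \sum_a _.
have hC c : ad C (J c) = ad X (J c).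
  have -> : ad C (J c) = \sum_a (4 * spin9_coef X a c) *: J a.
    have hab : ad C (J c) = \sum_a \sum_b ((2 * (b == c)%:R * spin9_coef X a b) *: J a -
                                  (2 * (a == c)%:R * spin9_coef X a b) *: J b).
      rewrite /C ad_suml; apply: eq_bigr => a _; rewrite ad_suml; apply: eq_bigr => b _.
      by rewrite adZl ad_clifford2 scalerBr !scalerA ![spin9_coef _ _ _ * _]mulrC.
    rewrite hab; under eq_bigr do rewrite sumrB; rewrite sumrB.
    rewrite [X in _ - X](bigD1 c) //= [X in _ - (_ + X)]big1 => [|a /negbTE->]; last first.
      by rewrite big1 // => b _; rewrite mulr0 mul0r scale0r.
    rewrite addr0 -sumrB; apply: eq_bigr => a _.
    rewrite (bigD1 c) //= big1 => [|b /negbTE->]; last by rewrite mulr0 mul0r scale0r.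
    rewrite !eqxx addr0 -scalerBl [spin9_coef X c a]spin9_coefC /=; congr (_ *: _); lra.
  rewrite [RHS](in_cliffordE (hX c)); apply: eq_bigr => a _; congr (_ *: _).
  by rewrite /spin9_coef; lra.
have trC : \tr C = 0.
  have e : C = - C^T.
    rewrite /C trmx_bigsum -sumrN; under [RHS]eq_bigr do rewrite trmx_bigsum -sumrN.
    rewrite [RHS]exchange_big; apply: eq_bigr => a _; apply: eq_bigr => b _.
    by rewrite linearZ /= trmx_mulr !cliffordT spin9_coefC scaleNr.
  have := congr1 (@mxtrace _ _) e; rewrite raddfN /= mxtrace_tr; lra.
have /clifford_commutant e : forall a, (X - C) * J a = J a * (X - C).
  by move=> a; apply/eqP; rewrite -subr_eq0 -/(ad _ _) -scaleN1r addrC adDl adZl hC scaleN1r addNr.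
by rewrite -{1}[X](subrK C) e raddfB /= trC subr0.
Qed.

Lemma sum_symm_lt (V : lmodType R) n (f : 'I_n -> 'I_n -> V) :
  (forall a b, f a b = f b a) -> (forall a, f a a = 0) ->
  \sum_a \sum_b f a b = 2 *: \sum_(a < n) \sum_(b < n | (a < b)%N) f a b.
Proof.
move=> fC f0; rewrite scaler_nat mulr2n [X in _ + X](exchange_big_dep xpredT) //= -big_split /=.
apply: eq_bigr => a _; rewrite (bigID (fun b : 'I_n => (a < b)%N)) /=; congr (_ + _).
rewrite (bigD1 a) ?ltnn //= f0 add0r; apply: eq_big => [b|b _]; last exact: fC.
by rewrite -leqNgt ltn_neqAle andbC.
Qed.

(** Skewness removes the scalar part of [normalizingE]. From here on spin(9) is handled through this
    criterion instead of coefficients. *)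
Lemma spin9_lieP X : spin9_lie J X <-> X^T = - X /\ clifford_normalizing X.
Proof.
split=> [[c ->]|[aX nX]].
  split; last first.
    apply: normalizing_sum => a _; apply: normalizing_sum => b _; apply: normalizingZ.
    exact: normalizing_clifford2.
  rewrite trmx_bigsum -sumrN; apply: eq_bigr => a _.
  rewrite trmx_bigsum -sumrN; apply: eq_bigr => b ab.
  have nab : a != b by rewrite neq_ltn ab.
  by rewrite linearZ /= mulmxE trmx_mulr !cliffordT -scalerN (cliffordC nab) opprK.
have tX : \tr X = 0 by have := congr1 (@mxtrace _ _) aX; rewrite mxtrace_tr raddfN /=; lra.
have e0 a : spin9_coef X a a = 0 by have := spin9_coefC X a a; lra.
exists (\matrix_(a, b) (2 * spin9_coef X a b)); rewrite [LHS]normalizingE // tX mul0r scale0r add0r.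
rewrite sum_symm_lt; last 2 first.
- move=> a b; case: (eqVneq a b) => [->//|ab].
  by rewrite spin9_coefC (cliffordC ab) scalerN scaleNr opprK.
- by move=> a; rewrite e0 scale0r.
rewrite scaler_sumr; apply: eq_bigr => a _; rewrite scaler_sumr; apply: eq_bigr => b _.
by rewrite mxE scalerA.
Qed.

Lemma clifford_prodT s : uniq s -> (clifford_prod s)^T = (-1) ^+ 'C(size s, 2) *: clifford_prod s.
Proof.
elim: s => [|a s IH] /=; first by rewrite /clifford_prod big_nil trmx1 scale1r.
case/andP => as_ us; rewrite /clifford_prod big_cons -/(clifford_prod s) trmx_mulr cliffordT IH //.
rewrite -scalerAl clifford_prod_comm // (negbTE as_) addn0 scalerA -exprD.
by rewrite binS bin1.
Qed.

Lemma mxtr_sym_skew X Y : X^T = X -> Y^T = - Y -> \tr (X^T * Y) = 0.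
Proof.
move=> hX hY; have : \tr (X^T * Y) = - \tr (X^T * Y).
  by rewrite -{1}mxtrace_tr trmx_mulr trmxK hY mulNr raddfN /= mxtr_mulC hX.
lra.
Qed.

(** Skewness removes the components of degrees 0, 1 and 4, the hypothesis those of degree 3; only
    degree 2 is left. *)
Lemma skew_normalizing X : X^T = - X ->
  (forall a b c, uniq [:: a; b; c] -> \tr ((J a * J b * J c)^T * X) = 0) ->
  clifford_normalizing X.
Proof.
move=> aX h; have -> : X = 16^-1 *: (16 *: X) by rewrite scalerA mulVf ?scale1r // pnatr_eq0.
apply: normalizingZ; rewrite clifford_prod_expand; apply: normalizing_sum => S.
have := enum_uniq S; rewrite cardE; case: (enum S) => [|a [|b [|c [|d [|? ?]]]]] // us _.
- by rewrite mxtr_sym_skew ?scale0r ?clifford_prodT ?expr0 ?scale1r //; exact: normalizing0.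
- by rewrite mxtr_sym_skew ?scale0r ?clifford_prodT ?expr0 ?scale1r //; exact: normalizing0.
- rewrite /clifford_prod !big_cons big_nil mulr1; apply: normalizingZ; exact: normalizing_clifford2.
- by rewrite {1}/clifford_prod !big_cons big_nil mulr1 mulrA h // scale0r; exact: normalizing0.
- rewrite mxtr_sym_skew ?scale0r ?clifford_prodT //; first exact: normalizing0.
  by rewrite -signr_odd scale1r.
Qed.
End CliffordAlgebra.

(** * Spin(9) as the orthogonal normaliser of the span of the generators *)

Section Spin9Group.
Context {R : realType} (J : 'I_9 -> 'M[R]_16) (hJ : clifford_system J).
Implicit Types (X Y A B : 'M[R]_16) (v w : 'cV[R]_9) (s : seq 'cV[R]_9).

Local Notation cm := (clifford_mul J).

Definition dotv v w : R := \sum_a v a 0 * w a 0.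

Lemma dotvC v w : dotv v w = dotv w v.
Proof. by apply: eq_bigr => a _; rewrite mulrC. Qed.

Lemma dotvDl v v' w : dotv (v + v') w = dotv v w + dotv v' w.
Proof. by rewrite -big_split; apply: eq_bigr => a _; rewrite mxE mulrDl. Qed.

Lemma dotvZl k v w : dotv (k *: v) w = k * dotv v w.
Proof. by rewrite mulr_sumr; apply: eq_bigr => a _; rewrite mxE mulrA. Qed.

Lemma dotvBl v v' w : dotv (v - v') w = dotv v w - dotv v' w.
Proof. by rewrite -scaleN1r dotvDl dotvZl mulN1r. Qed.

Lemma dotvBr v w w' : dotv v (w - w') = dotv v w - dotv v w'.
Proof. by rewrite dotvC dotvBl !(dotvC v). Qed.

Lemma dotv_delta v a : dotv v (delta_mx a 0) = v a 0.
Proof.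
rewrite /dotv (bigD1 a) //= big1 => [|b /negbTE ba]; rewrite mxE ?eqxx ?mulr1 ?addr0 //.
by rewrite ba mulr0.
Qed.

Lemma dotv_ge0 v : 0 <= dotv v v.
Proof. by apply: sumr_ge0 => a _; rewrite -expr2 sqr_ge0. Qed.

Lemma dotv_eq0 v : dotv v v = 0 -> v = 0.
Proof.
move=> h; apply/colP => a; rewrite mxE.
have : v a 0 * v a 0 = 0 := psumr_eq0P (fun a _ => sqr_ge0 (v a 0)) h erefl.
by move/eqP; rewrite mulf_eq0 orbb => /eqP.
Qed.

Lemma unit_dotv v : v^T *m v = 1%:M <-> dotv v v = 1.
Proof.
have e : (v^T *m v) 0 0 = dotv v v.
  by rewrite mxE; apply: eq_bigr => a _; rewrite mxE.
split=> [h|h]; first by rewrite -e h mxE.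
by apply/matrixP => i k; rewrite !ord1 e h !mxE.
Qed.

Lemma clifford_mulD v w : cm (v + w) = cm v + cm w.
Proof. by rewrite -big_split; apply: eq_bigr => a _; rewrite mxE scalerDl. Qed.

Lemma clifford_mulZ k v : cm (k *: v) = k *: cm v.
Proof. by rewrite scaler_sumr; apply: eq_bigr => a _; rewrite mxE scalerA. Qed.

Lemma clifford_mulN v : cm (- v) = - cm v.
Proof. by rewrite -scaleN1r clifford_mulZ scaleN1r. Qed.

Lemma clifford_mul_delta a : cm (delta_mx a 0) = J a.
Proof.
rewrite /clifford_mul (bigD1 a) //= big1 => [|b /negbTE ba]; rewrite mxE ?eqxx ?scale1r ?addr0 //.
by rewrite ba scale0r.
Qed.

Lemma clifford_mulT v : (cm v)^T = cm v.
Proof. exact/(in_cliffordT hJ)/(in_clifford_mul hJ). Qed.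

Lemma clifford_relation v w : cm v * cm w + cm w * cm v = (2 * dotv v w) *: 1.
Proof.
rewrite /clifford_mul !mulr_suml; under eq_bigr do rewrite mulr_sumr.
under [X in _ + X]eq_bigr do rewrite mulr_sumr; rewrite [X in _ + X]exchange_big -big_split /=.
rewrite /dotv mulr_sumr scaler_suml; apply: eq_bigr => a _; rewrite -big_split (bigD1 a) //= big1.
  rewrite addr0 -!scalerAl -!scalerAr !(cliffordJJ hJ) !scalerA -scalerDl; congr (_ *: _).
  by change (v a 0 * w a 0 + w a 0 * v a 0 = v a 0 * 2 * w a 0); ring.
move=> b ba; rewrite -!scalerAl -!scalerAr !scalerA (cliffordC hJ ba) scalerN.
by rewrite (mulrC (w b 0)) subrr.
Qed.

Lemma clifford_sqr v : cm v * cm v = dotv v v *: 1.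
Proof.
by have := clifford_relation v v; rewrite -mulr2n -scaler_nat -scalerA => /scalerI ->.
Qed.

(** This is minus the reflection in the hyperplane orthogonal to [v]; hence the signs (-1)^(size s)
    that accompany words. *)
Lemma clifford_reflection v w : dotv v v = 1 ->
  cm v * cm w * cm v = (2 * dotv v w) *: cm v - cm w.
Proof.
move=> v1; have /eqP := clifford_relation v w; rewrite -subr_eq0 -addrA addr_eq0 => /eqP->.
by rewrite opprB mulrBl -scalerAl mul1r -mulrA clifford_sqr v1 scale1r mulr1.
Qed.

Definition clifford_word s : 'M[R]_16 := \prod_(v <- s) cm v.

Lemma Spin9E A : Spin9 J A <-> exists s, [/\ ~~ odd (size s),
  forall v, v \in s -> dotv v v = 1 & A = clifford_word s].
Proof.
by split=> -[s [hs hu e]]; exists s; split=> // v /hu /unit_dotv.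
Qed.

Lemma clifford_word_orthogonal s : (forall v, v \in s -> dotv v v = 1) ->
  (clifford_word s)^T * clifford_word s = 1.
Proof.
elim: s => [|v s IH] hs; first by rewrite /clifford_word big_nil trmx1 mul1r.
rewrite /clifford_word big_cons -/(clifford_word s) trmx_mulr clifford_mulT.
rewrite -mulrA (mulrA (cm v)) clifford_sqr hs ?mem_head // scale1r mul1r IH // => w ws.
by rewrite hs // in_cons ws orbT.
Qed.

Lemma clifford_word_conj s X : (forall v, v \in s -> dotv v v = 1) -> in_clifford J X ->
  in_clifford J (clifford_word s * X * (clifford_word s)^T).
Proof.
elim: s => [|v s IH] hs hX; first by rewrite /clifford_word big_nil trmx1 mul1r mulr1.
rewrite /clifford_word big_cons -/(clifford_word s) trmx_mulr clifford_mulT.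
have /IH /(_ hX) : forall w, w \in s -> dotv w w = 1 by move=> w ws; rewrite hs // in_cons ws orbT.
move/(in_cliffordP hJ) => [w e].
have -> : cm v * clifford_word s * X * ((clifford_word s)^T * cm v) = cm v * cm w * cm v.
  by rewrite -e !mulrA.
rewrite clifford_reflection ?hs ?mem_head //; apply: in_cliffordD => //; last apply: in_cliffordN => //.
  by apply: in_cliffordZ => //; exact: in_clifford_mul.
exact: in_clifford_mul.
Qed.

Lemma clifford_word_rev s : (clifford_word s)^T = clifford_word (rev s).
Proof.
elim: s => [|v s IH]; first by rewrite /clifford_word big_nil trmx1.
rewrite rev_cons -cats1 /clifford_word big_cons big_cat big_seq1 -!/(clifford_word _).
by rewrite trmx_mulr clifford_mulT IH.
Qed.

Lemma conj_clifford_prod B (t : seq 'I_9) : B^T * B = 1 -> B * B^T = 1 ->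
  B * clifford_prod J t * B^T = \prod_(a <- t) (B * J a * B^T).
Proof.
move=> hB hB'; elim: t => [|a t IH]; first by rewrite /clifford_prod !big_nil mulr1.
rewrite /clifford_prod !big_cons -/(clifford_prod J t) -IH !mulrA.
by rewrite -(mulrA _ B^T B) hB mulr1.
Qed.

Lemma conj_mul_orthogonal B : B^T * B = 1 ->
  forall X Y, B * X * B^T * (B * Y * B^T) = B * (X * Y) * B^T.
Proof. by move=> hB X Y; rewrite !mulrA -(mulrA _ B^T) hB mulr1. Qed.

Lemma conj_mul_tr A B X : A * B * X * (A * B)^T = A * (B * X * B^T) * A^T.
Proof. by rewrite trmx_mulr !mulrA. Qed.

(* Cartan-Dieudonne: unit vectors are chosen one at a time, the reflection in y - e_k
   moving the image y of e_k back to e_k while fixing the previous basis vectors. *)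
Lemma cartan_dieudonne A (k : nat) : A^T * A = 1 -> (forall a, in_clifford J (A * J a * A^T)) ->
  (k <= 9)%N -> exists s, (forall v, v \in s -> dotv v v = 1) /\
   forall a : 'I_9, (a < k)%N ->
     clifford_word s * A * J a * (clifford_word s * A)^T = (-1) ^+ size s *: J a.
Proof.
move=> hA cA; elim: k => [|k IH] hk; first by exists [::].
have [s [us hs]] := IH (ltnW hk); pose B := clifford_word s * A.
have hB : B^T * B = 1.
  by rewrite /B trmx_mulr -mulrA (mulrA _ _ A) clifford_word_orthogonal // mul1r.
have q := conj_mul_orthogonal hB.
pose a0 := Ordinal hk.
have : in_clifford J ((-1) ^+ size s *: (B * J a0 * B^T)).
  apply: in_cliffordZ => //.
  by rewrite /B conj_mul_tr; exact: clifford_word_conj.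
move=> /(in_cliffordP hJ)[y ey].
have y1 : dotv y y = 1.
  have : cm y * cm y = 1.
    rewrite -ey -scalerAl -scalerAr scalerA -expr2 sqrr_sign scale1r.
    by rewrite q (cliffordJJ hJ) mulr1; exact: mulmx_tr_sym.
  rewrite clifford_sqr => /matrixP/(_ 0 0); by rewrite !mxE eqxx /= mulr1.
(* Conjugation preserves anticommutation, so [y] is orthogonal to the basis vectors already fixed
   and the next reflection leaves them alone. *)
have ya (a : 'I_9) : (a < k)%N -> y a 0 = 0.
  move=> ak; have na : a != a0 by rewrite neq_ltn ak.
  have e1 : cm y * J a = - (J a * cm y).
    have -> : J a = (-1) ^+ size s *: (B * J a * B^T).
      by rewrite hs // scalerA -expr2 sqrr_sign scale1r.
    rewrite -ey -!scalerAl -!scalerAr !scalerA -expr2 sqrr_sign !scale1r.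
    by rewrite !q (cliffordC hJ na) mulrN mulNr opprK.
  have := clifford_relation y (delta_mx a 0).
  rewrite clifford_mul_delta e1 addNr dotv_delta => /esym/matrixP/(_ 0 0).
  by rewrite !mxE mulr1n mulr1 => /eqP; rewrite mulf_eq0 pnatr_eq0 /= => /eqP.
have e0 : B * J a0 * B^T = (-1) ^+ size s *: cm y.
  by rewrite -ey scalerA -expr2 sqrr_sign scale1r.
case: (eqVneq y (delta_mx a0 0)) => [ey0|ny].
  exists s; split=> // a; rewrite ltnS leq_eqVlt => /orP[/eqP ak|/hs //].
  by rewrite (_ : a = a0); [rewrite -/B e0 ey0 clifford_mul_delta|exact: val_inj].
pose z := y - delta_mx a0 0.
have zz : dotv z z = 2 - 2 * y a0 0.
  rewrite /z dotvBl !dotvBr (dotvC _ y) !dotv_delta y1 mxE !eqxx /=; ring.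
have zz0 : 0 < dotv z z.
  rewrite lt_def dotv_ge0 andbT; apply/eqP => /dotv_eq0/eqP; rewrite subr_eq0; exact/negP.
pose v := (Num.sqrt (dotv z z))^-1 *: z.
(* The normalising square root enters twice and cancels, so the reflection is expressed by the
   unnormalised [z]. *)
have vw w : (2 * dotv v w) *: cm v = (2 * dotv z w / dotv z z) *: cm z.
  rewrite dotvZl clifford_mulZ scalerA; congr (_ *: _).
  rewrite -{3}(sqr_sqrtr (ltW zz0)); field.
  by rewrite gt_eqF // sqrtr_gt0.
have v1 : dotv v v = 1.
  rewrite dotvZl dotvC dotvZl -{3}(sqr_sqrtr (ltW zz0)); field.
  by rewrite gt_eqF // sqrtr_gt0.
exists (v :: s); split=> [w|a ak1]; first by rewrite in_cons => /orP[/eqP->//|/us].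
rewrite /clifford_word big_cons -/(clifford_word s) -(mulrA (cm v)) -/B conj_mul_tr clifford_mulT.
rewrite [size _]/= exprS mulN1r scaleNr.
case: (ltnP a k) => ak.
  rewrite hs // -scalerAr -scalerAl -clifford_mul_delta clifford_reflection // vw.
  rewrite dotv_delta !mxE (ya _ ak) (_ : a == a0 = false); last first.
    by apply/negbTE; rewrite neq_ltn ak.
  by rewrite /= subrr mulr0 mul0r scale0r sub0r scalerN.
have -> : a = a0 by apply: val_inj => /=; apply/eqP; rewrite eqn_leq ak -ltnS ak1.
rewrite e0 -scalerAr -scalerAl clifford_reflection // vw.
have -> : 2 * dotv z y / dotv z z = 1.
  rewrite (_ : 2 * dotv z y = dotv z z) ?divff ?gt_eqF // zz.
  by rewrite /z dotvBl (dotvC _ y) dotv_delta y1; ring.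
rewrite scale1r -scalerN; congr (_ *: _).
by rewrite /z clifford_mulD clifford_mulN clifford_mul_delta addrC addKr.
Qed.

(** After multiplication by a suitable word, [A] acts on the generators by a common sign. The volume
    element excludes the sign -1, and then the product commutes with all generators, hence is 1 or
    -1. *)
Lemma Spin9P A : Spin9 J A <-> A^T * A = 1 /\ forall a, in_clifford J (A * J a * A^T).
Proof.
split=> [/Spin9E[s [_ us ->]]|[hA cA]].
  split=> [|a]; first exact: clifford_word_orthogonal.
  apply: clifford_word_conj => //; exact: in_clifford_gen.
have [s [us hs]] := cartan_dieudonne hA cA (leqnn 9); pose B := clifford_word s * A.
have hB : B^T * B = 1.
  by rewrite /B trmx_mulr -mulrA (mulrA _ _ A) clifford_word_orthogonal // mul1r.
have hB' : B * B^T = 1 by exact: mulmx_tr_sym.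
(* An odd word would send every generator to its opposite, hence the product of all nine to its
   opposite; but that product is a scalar and is fixed by conjugation. *)
have es : ~~ odd (size s).
  apply/negP => os; have h a : B * J a * B^T = - J a.
    by rewrite hs // -signr_odd os scaleN1r.
  have e : B * clifford_vol J * B^T = clifford_vol J.
    by case: (clifford_volE hJ) => ->; rewrite ?mulr1 ?mulrN1 ?mulNr hB'.
  move: e; rewrite conj_clifford_prod // (eq_bigr (fun a => - J a)) //.
  have -> : \prod_(a <- enum 'I_9) - J a = - clifford_vol J.
    rewrite /clifford_vol /clifford_prod.
    have pN (t : seq 'I_9) : \prod_(a <- t) - J a = (-1) ^+ size t *: \prod_(a <- t) J a.
      elim: t => [|a t IH]; first by rewrite !big_nil scale1r.
      by rewrite !big_cons IH exprS mulN1r scaleNr -scalerAr mulNr scalerN.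
    by rewrite pN -cardE card_ord -signr_odd scaleN1r.
  case: (clifford_volE hJ) => -> /eqP; rewrite ?opprK -subr_eq0 ?opprK -?opprD ?oppr_eq0.
    by rewrite -[1 + 1]/(2%:R) -scaler_nat scaler_eq0 pnatr_eq0 oner_eq0.
  by rewrite -[1 + 1]/(2%:R) -scaler_nat scaler_eq0 pnatr_eq0 oner_eq0.
have cB a : B * J a = J a * B.
  have := hs a (ltn_ord a); rewrite -signr_odd (negbTE es) scale1r -/B => {2}<-.
  by rewrite -mulrA hB mulr1.
have eA : A = clifford_word (rev s) * B.
  by rewrite /B -clifford_word_rev mulrA clifford_word_orthogonal // mul1r.
apply/Spin9E; case: (scalar_sqr1 (clifford_commutant hJ cB) hB') => e.
  exists (rev s); split=> [|v|]; rewrite ?size_rev ?mem_rev //; first exact: us.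
  by rewrite eA e mulr1.
(* The factor -1 is itself an even word, the product of e_0 and -e_0. *)
exists (rev s ++ [:: delta_mx 0 0; - delta_mx 0 0]); split.
- by rewrite size_cat size_rev addn2 /= negbK.
- move=> v; rewrite mem_cat mem_rev !inE => /or3P[/us //|/eqP->|/eqP->].
    by rewrite dotv_delta mxE.
  by rewrite -scaleN1r dotvZl dotvC dotvZl dotv_delta mxE /= mulr1 mulrNN mulr1.
- rewrite eA e /clifford_word big_cat /= !big_cons big_nil mulr1; congr (_ * _).
  by rewrite clifford_mulN clifford_mul_delta mulrN (cliffordJJ hJ).
Qed.

End Spin9Group.

(** * The vectorial component of Λ^1 ⊗ m *)

Section VectorialComponent.
Context {R : realType} (J : 'I_9 -> 'M[R]_16) (hJ : clifford_system J).
Implicit Types (X Y A B : 'M[R]_16) (w v : 'cV[R]_16).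

Definition wedge v w : 'M[R]_16 := v *m w^T - w *m v^T.

Lemma wedgeT v w : (wedge v w)^T = - wedge v w.
Proof. by rewrite /wedge linearB /= !trmx_mul !trmxK opprB. Qed.

Lemma wedge_linearl w : linear (wedge^~ w).
Proof.
move=> k v v'; rewrite /wedge linearP /= mulmxDl mulmxDr -scalemxAl -scalemxAr.
by rewrite scalerBr opprD addrACA.
Qed.

Lemma wedge_linearr v : linear (wedge v).
Proof.
move=> k w w'; rewrite /wedge linearP /= mulmxDl mulmxDr -scalemxAl -scalemxAr.
by rewrite scalerBr opprD addrACA.
Qed.

Lemma wedgeZr v k w : wedge v (k *: w) = k *: wedge v w.
Proof. by rewrite -[k *: w]addr0 wedge_linearr /wedge trmx0 mulmx0 mul0mx subrr addr0. Qed.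

Lemma wedge_conj A v w : wedge (A *m v) (A *m w) = A *m wedge v w *m A^T.
Proof. by rewrite /wedge !trmx_mul mulmxBr mulmxBl !mulmxA. Qed.

Lemma mxtr_outer X v w : \tr (X *m (v *m w^T)) = (w^T *m (X *m v)) 0 0.
Proof. by rewrite mulmxA mxtrace_mulC /mxtrace big_ord1. Qed.

Lemma scalar_bilinT X v w : (w^T *m (X *m v)) 0 0 = (v^T *m (X^T *m w)) 0 0.
Proof.
have -> : (w^T *m (X *m v)) 0 0 = (w^T *m (X *m v))^T 0 0 by rewrite [RHS]mxE.
by rewrite !trmx_mul trmxK mulmxA.
Qed.

(** For an orthogonal [X] in m and [v = X *m w] the right side is twice the squared norm of [w];
    this is how [w] is recovered from a wedge known only modulo spin(9). *)
Lemma mxtr_wedge X v w : X^T = - X ->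
  \tr (X^T *m wedge v w) = 2 * (v^T *m (X *m w)) 0 0.
Proof.
move=> hX; rewrite /wedge mulmxBr raddfB /= !mxtr_outer scalar_bilinT trmxK.
rewrite hX mulNmx mulmxN.
have -> : (- (v^T *m (X *m w))) 0 0 = - (v^T *m (X *m w)) 0 0 by rewrite mxE.
by ring.
Qed.

Definition spin9_proj X : 'M[R]_16 :=
  \sum_(a < 9) \sum_(b < 9 | (a < b)%N) (\tr ((J a * J b)^T * X) / 16) *: (J a * J b).

Definition m_proj X : 'M[R]_16 := X - spin9_proj X.

Lemma spin9_proj_lie X : spin9_lie J (spin9_proj X).
Proof.
exists (\matrix_(a, b) (\tr ((J a * J b)^T * X) / 16)).
by apply: eq_bigr => a _; apply: eq_bigr => b _; rewrite mxE.
Qed.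

Lemma spin9_proj_linear : linear spin9_proj.
Proof.
move=> k X Y; rewrite /spin9_proj scaler_sumr -big_split; apply: eq_bigr => a _ /=.
rewrite scaler_sumr -big_split; apply: eq_bigr => b _ /=.
by rewrite mulrDr -scalerAr mxtraceD mxtraceZ mulrDl scalerDl -mulrA scalerA.
Qed.

Lemma m_proj_linear : linear m_proj.
Proof. by move=> k X Y; rewrite /m_proj spin9_proj_linear scalerBr opprD addrACA. Qed.

Lemma mxtr_clifford22 (a b c d : 'I_9) : (a < b)%N -> (c < d)%N ->
  \tr ((J a * J b)^T * (J c * J d)) = 16 * ((a == c) && (b == d))%:R.
Proof.
move=> ab cd.
have E x y : J x * J y = clifford_prod J [:: x; y].
  by rewrite /clifford_prod !big_cons big_nil mulr1.
have U (x y : 'I_9) : (x < y)%N -> uniq [:: x; y].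
  by move=> xy; rewrite /= inE andbT neq_ltn xy.
case: (boolP ((a == c) && (b == d))) => [/andP[/eqP<- /eqP<-]|h].
  by rewrite E (clifford_prod_tr_mul hJ) mxtrace1 mulr1.
have [e he] : exists e, odd ((e \in [:: a; b]) + (e \in [:: c; d])).
  have [ha|ha] := boolP (a \in [:: c; d]).
    have [hb|hb] := boolP (b \in [:: c; d]).
      exfalso; move: ha hb h; rewrite !inE => /orP[] /eqP ea /orP[] /eqP eb.
      - by move: ab; rewrite ea eb ltnn.
      - by rewrite ea eb !eqxx.
      - by move: ab; rewrite ea eb ltnNge (ltnW cd).
      - by move: ab; rewrite ea eb ltnn.
    by exists b; rewrite (negbTE hb) !inE eqxx orbT.
  by exists a; rewrite (negbTE ha) !inE eqxx.
rewrite !E mulr0; apply: (@mxtr_clifford_prod _ _ hJ _ _ e (2 + (e \in [:: c; d]))).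
- exact: U.
- by rewrite (clifford_prod_comm hJ) // U.
- by move: he; case: (e \in [:: a; b]); case: (e \in [:: c; d]).
Qed.

Lemma mxtr_spin9_proj (a b : 'I_9) X : (a < b)%N ->
  \tr ((J a * J b)^T * spin9_proj X) = \tr ((J a * J b)^T * X).
Proof.
move=> ab; rewrite /spin9_proj mulr_sumr raddf_sum (bigD1 a) //= [X in _ + X]big1 => [|a' na]; last first.
  rewrite mulr_sumr raddf_sum big1 //= => b' ab'; rewrite -scalerAr mxtraceZ mxtr_clifford22 //.
  by rewrite [a == _]eq_sym (negbTE na) /= !mulr0.
rewrite mulr_sumr raddf_sum (bigD1 b) //= big1 => [|b' /andP[ab' nb]]; last first.
  by rewrite -scalerAr mxtraceZ mxtr_clifford22 // [b == _]eq_sym (negbTE nb) andbF /= !mulr0.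
by rewrite -scalerAr mxtraceZ mxtr_clifford22 // !eqxx !addr0 /= mulr1 mulfVK.
Qed.

Lemma m_compl_proj X : X^T = - X -> m_compl J (m_proj X).
Proof.
move=> aX; split.
  have /(spin9_lieP hJ) [h _] := spin9_proj_lie X.
  by rewrite /m_proj linearB /= h aX opprB opprK addrC.
move=> _ [c ->]; rewrite trmx_bigsum mulmx_suml raddf_sum big1 //= => a _.
rewrite trmx_bigsum mulmx_suml raddf_sum big1 //= => b ab.
rewrite linearZ /= -scalemxAl mxtraceZ mulmxE /m_proj mulrBr raddfB /=.
by rewrite mxtr_spin9_proj // subrr mulr0.
Qed.

Lemma spin9_lie_m_compl0 X : spin9_lie J X -> m_compl J X -> X = 0.
Proof.
move=> hX [_ /(_ _ hX)]; rewrite mulmxE mxtr_tr_mul => h.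
have h1 i : \sum_j X i j * X i j = 0.
  by apply: (psumr_eq0P _ h) => // k _; apply: sumr_ge0 => l _; rewrite -expr2 sqr_ge0.
apply/matrixP => i j; rewrite mxE.
have : X i j * X i j = 0 by apply: (psumr_eq0P _ (h1 i)) => // k _; rewrite -expr2 sqr_ge0.
by move/eqP; rewrite mulf_eq0 orbb => /eqP.
Qed.

Lemma spin9_lie_linear k X Y : spin9_lie J X -> spin9_lie J Y -> spin9_lie J (k *: X + Y).
Proof.
move=> /(spin9_lieP hJ)[aX nX] /(spin9_lieP hJ)[aY nY]; apply/(spin9_lieP hJ); split.
  by rewrite linearP /= aX aY scalerN opprD.
by apply: normalizingD => //; exact: normalizingZ.
Qed.

Lemma m_compl_linear k X Y : m_compl J X -> m_compl J Y -> m_compl J (k *: X + Y).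
Proof.
move=> [aX oX] [aY oY]; split; first by rewrite linearP /= aX aY scalerN opprD.
by move=> A hA; rewrite mulmxDr -scalemxAr mxtraceD mxtraceZ oX // oY // mulr0 addr0.
Qed.

Lemma Spin9_orth A : Spin9 J A -> A^T * A = 1 /\ A * A^T = 1.
Proof. by move=> /(Spin9P hJ)[h _]; split=> //; exact: mulmx_tr_sym. Qed.

Lemma Spin9T A : Spin9 J A -> Spin9 J A^T.
Proof.
move=> /(Spin9E J)[s [es us ->]]; rewrite clifford_word_rev //; apply/Spin9E.
by exists (rev s); split; rewrite ?size_rev // => v; rewrite mem_rev; exact: us.
Qed.

Lemma Spin9_conj_in A X : Spin9 J A -> in_clifford J X -> in_clifford J (A * X * A^T).
Proof.
move=> /(Spin9P hJ)[_ h] /(in_cliffordE) ->.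
rewrite mulr_sumr mulr_suml; apply: in_clifford_bigsum => // a _.
by rewrite -scalerAr -scalerAl; apply: in_cliffordZ.
Qed.

Lemma ad_conj A X Y : A^T * A = 1 -> ad (A * X * A^T) (A * Y * A^T) = A * ad X Y * A^T.
Proof. by move=> hA; rewrite /ad !(conj_mul_orthogonal hA) -mulrBl -mulrBr. Qed.

Lemma Spin9_conj_lie A X : Spin9 J A -> spin9_lie J X -> spin9_lie J (A * X * A^T).
Proof.
move=> hA /(spin9_lieP hJ)[aX nX]; apply/(spin9_lieP hJ); split.
  by rewrite !trmx_mulr trmxK aX mulNr mulrN mulrA.
have [h1 h2] := Spin9_orth hA.
move=> a; have -> : J a = A * (A^T * J a * A) * A^T.
  by rewrite !mulrA h2 mul1r -mulrA h2 mulr1.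
rewrite ad_conj //; apply: Spin9_conj_in => //; apply: ad_in_clifford => //.
by rewrite -{2}[A]trmxK; apply: Spin9_conj_in (Spin9T hA) _; exact: in_clifford_gen.
Qed.

Lemma Spin9_conj_m A X : Spin9 J A -> m_compl J X -> m_compl J (A * X * A^T).
Proof.
move=> hA [aX oX]; split; first by rewrite !trmx_mulr trmxK aX mulNr mulrN mulrA.
move=> Y hY; have := oX _ (Spin9_conj_lie (Spin9T hA) hY).
by rewrite !mulmxE !trmx_mulr !trmxK -!mulrA mxtr_mulC !mulrA.
Qed.

Lemma m_proj_unique X Y : X^T = - X -> m_compl J Y -> spin9_lie J (X - Y) -> m_proj X = Y.
Proof.
move=> aX hY hXY; apply/eqP; rewrite -subr_eq0; apply/eqP/spin9_lie_m_compl0.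
  rewrite (_ : m_proj X - Y = (-1) *: spin9_proj X + (X - Y)).
    exact: spin9_lie_linear (spin9_proj_lie X) hXY.
  by rewrite /m_proj scaleN1r addrA addrC [RHS]addrC (addrC X).
rewrite (_ : m_proj X - Y = (-1) *: Y + m_proj X); last by rewrite scaleN1r addrC.
exact: m_compl_linear hY (m_compl_proj aX).
Qed.

Definition vectorial_map w v : 'M[R]_16 := m_proj (wedge v w).

Lemma avoid9 (l : seq 'I_9) : (size l < 9)%N -> exists z, z \notin l.
Proof.
case: (pickP (fun z => z \notin l)) => [z|h hl]; first by exists z.
have : (size (enum 'I_9) <= size l)%N.
  by apply: uniq_leq_size (enum_uniq _) _ => z _; exact: negbFE (h z).
by rewrite -cardE card_ord leqNgt hl.
Qed.

Lemma clifford3E a b c : J a * J b * J c = clifford_prod J [:: a; b; c].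
Proof. by rewrite /clifford_prod !big_cons big_nil mulr1 mulrA. Qed.

Lemma clifford3T a b c : uniq [:: a; b; c] -> (J a * J b * J c)^T = - (J a * J b * J c).
Proof. by move=> u; rewrite clifford3E clifford_prodT // -signr_odd scaleN1r. Qed.

Lemma clifford3_orth a b c : (J a * J b * J c)^T * (J a * J b * J c) = 1.
Proof. by rewrite clifford3E clifford_prod_tr_mul. Qed.

(** A generator outside all the indices commutes with a product of degree two and anticommutes with
    one of degree three, so the two are orthogonal. *)
Lemma clifford3_m a b c : uniq [:: a; b; c] -> m_compl J (J a * J b * J c).
Proof.
move=> u; split; first exact: clifford3T.
move=> _ [C ->]; rewrite trmx_bigsum mulmx_suml raddf_sum big1 //= => x _.
rewrite trmx_bigsum mulmx_suml raddf_sum big1 //= => y xy.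
rewrite linearZ /= -scalemxAl mxtraceZ mulmxE.
have E2 : J x * J y = clifford_prod J [:: x; y].
  by rewrite /clifford_prod !big_cons big_nil mulr1.
have U : uniq [:: x; y] by rewrite /= inE andbT neq_ltn xy.
have [e he] : exists e, ~~ odd ((e \in [:: a; b; c]) + (e \in [:: x; y])).
  have [//|z] := @avoid9 [:: a; b; c; x; y].
  rewrite !inE !negb_or => /and5P[za zb zc zx zy]; exists z.
  by rewrite !inE (negbTE za) (negbTE zb) (negbTE zc) (negbTE zx) (negbTE zy).
rewrite clifford3E E2 (@mxtr_clifford_prod _ _ hJ _ _ e (3 + (e \in [:: a; b; c]))) ?mulr0 //.
- by rewrite (clifford_prod_comm hJ).
- by move: he; case: (e \in [:: a; b; c]); case: (e \in [:: x; y]).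
Qed.

Lemma bilin_orth X w : X^T * X = 1 -> ((X *m w)^T *m (X *m w)) 0 0 = (w^T *m w) 0 0.
Proof. by move=> hX; rewrite trmx_mul -mulmxA (mulmxA X^T) mulmxE hX mul1mx. Qed.

Lemma sqnorm_eq0 n (w : 'cV[R]_n) : (w^T *m w) 0 0 = 0 -> w = 0.
Proof.
rewrite mxE => h; apply/colP => i; rewrite mxE.
have : w^T 0 i * w i 0 = 0.
  by apply: (psumr_eq0P _ h) => // k _; rewrite mxE -expr2 sqr_ge0.
by rewrite mxE => /eqP; rewrite mulf_eq0 orbb => /eqP.
Qed.

Lemma uniq012 : uniq [:: 0; 1; 2 : 'I_9]. Proof. by []. Qed.

Lemma vectorial_map_embedding : spin9_embedding J vectorial_map.
Proof.
split.
- split=> [v k w w'|w k v v']; rewrite /vectorial_map.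
    by rewrite wedge_linearr m_proj_linear.
  by rewrite (wedge_linearl w k v v') m_proj_linear.
- by move=> w v; apply: m_compl_proj; exact: wedgeT.
- move=> A w v hA; have [h1 h2] := Spin9_orth hA.
  rewrite /vectorial_map wedge_conj; apply: m_proj_unique.
  + by rewrite !trmx_mul trmxK wedgeT mulNmx mulmxN mulmxA.
  + by apply: Spin9_conj_m => //; apply: m_compl_proj; exact: wedgeT.
  + rewrite -mulmxBl -mulmxBr !mulmxE; apply: Spin9_conj_lie => //.
    by rewrite /m_proj opprB addrC subrK; exact: spin9_proj_lie.
(* Injectivity: if every [wedge v w] lies in spin(9), pairing with the orthogonal element [X] of m
   at [v = X *m w] gives twice the squared norm of [w], which must vanish. *)
- move=> w h; set X := J 0 * J 1 * J 2.
  have hs v : spin9_lie J (wedge v w).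
    have := h v; rewrite /vectorial_map /m_proj => /eqP; rewrite subr_eq0 => /eqP->.
    exact: spin9_proj_lie.
  have [aX oX] := clifford3_m uniq012.
  have := oX _ (hs (X *m w)).
  rewrite -mxtrace_tr trmx_mul trmxK mxtr_wedge // bilin_orth; last exact: clifford3_orth.
  by move/eqP; rewrite mulf_eq0 pnatr_eq0 /= => /eqP/sqnorm_eq0.
Qed.

End VectorialComponent.

Lemma col_sum_delta (K : pzRingType) n (v : 'cV[K]_n) : v = \sum_i v i 0 *: delta_mx i 0.
Proof.
apply/colP => i; rewrite summxE (bigD1 i) //= big1 => [|j ji]; rewrite !mxE ?eqxx ?mulr1 ?addr0 //.
by rewrite [i == j]eq_sym (negbTE ji) mulr0.
Qed.

Lemma linear_cV (K : pzRingType) (V : lmodType K) n (f : 'cV[K]_n -> V) : linear f ->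
  forall v, f v = \sum_i v i 0 *: f (delta_mx i 0).
Proof.
move=> hf v; have f0 : f 0 = 0.
  by have := hf (-1) 0 0; rewrite scaler0 addr0 scaleN1r addNr.
have fD : {morph f : x y / x + y} by move=> x y; have := hf 1 x y; rewrite !scale1r.
rewrite {1}[v]col_sum_delta (big_morph f fD f0); apply: eq_bigr => i _.
by have := hf (v i 0) (delta_mx i 0) 0; rewrite f0 !addr0.
Qed.

Lemma mxtr_mulr_sum (K : pzRingType) n (I : Type) (r : seq I) (P : pred I)
    (X : 'M[K]_n) (F : I -> 'M[K]_n) :
  \tr (X * \sum_(i <- r | P i) F i) = \sum_(i <- r | P i) \tr (X * F i).
Proof. by rewrite mulr_sumr raddf_sum. Qed.

(** * Schur's lemma for embeddings of the spin module into Λ^1 ⊗ m *)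

Section VectorialUniqueness.
Context {R : realType} (J : 'I_9 -> 'M[R]_16) (hJ : clifford_system J).
Context (T : 'cV[R]_16 -> 'cV[R]_16 -> 'M[R]_16) (hT : spin9_embedding J T).
Implicit Types (X Y A B : 'M[R]_16) (w v : 'cV[R]_16).

(** The endomorphism of R^16 representing the bilinear form (v, w) -> <X, T w v>. For the m-parts of
    the wedges and [X] in m it would be 2 X. *)
Definition coef_form X : 'M[R]_16 :=
  \matrix_(i, j) \tr (X^T * T (delta_mx j 0) (delta_mx i 0)).

Lemma coef_formE X w v : (v^T *m (coef_form X *m w)) 0 0 = \tr (X^T * T w v).
Proof.
have [[l1 l2] _ _ _] := hT.
rewrite (linear_cV (l2 w)) mxtr_mulr_sum mxE; apply: eq_bigr => i _ /=.
rewrite (linear_cV (l1 (delta_mx i 0))) -scalerAr mxtraceZ mxtr_mulr_sum !mxE.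
congr (_ * _); apply: eq_bigr => j _.
by rewrite mxE -scalerAr mxtraceZ mulrC.
Qed.

Lemma bilin_form_eq X Y :
  (forall w v, (v^T *m (X *m w)) 0 0 = (v^T *m (Y *m w)) 0 0) -> X = Y.
Proof.
move=> h; apply/matrixP => i j; have := h (delta_mx j 0) (delta_mx i 0).
by rewrite -!colE !trmx_delta -!rowE !mxE.
Qed.

Lemma coef_formZ k X : coef_form (k *: X) = k *: coef_form X.
Proof. by apply/matrixP => i j; rewrite !mxE linearZ /= -scalerAl mxtraceZ. Qed.

Lemma coef_form_conj A X : Spin9 J A -> coef_form (A^T * X * A) = A^T * coef_form X * A.
Proof.
move=> hA; apply: bilin_form_eq => w v; have [_ _ hE _] := hT.
rewrite coef_formE; have := coef_formE X (A *m w) (A *m v); rewrite hE // => e.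
have -> : v^T *m (A^T * coef_form X * A *m w) = (A *m v)^T *m (coef_form X *m (A *m w)).
  by rewrite trmx_mul -!mulmxE !mulmxA.
by rewrite e !trmx_mulr trmxK !mulmxE -!mulrA [LHS]mxtr_mulC !mulrA.
Qed.

Definition coef_scal X : R := \tr (X^T * coef_form X) / 16.

Lemma coef_scal_conj A X : Spin9 J A -> coef_scal (A^T * X * A) = coef_scal X.
Proof.
move=> hA; rewrite /coef_scal coef_form_conj //; have [_ h] := Spin9_orth hJ hA.
rewrite !trmx_mulr trmxK; congr (_ / 16); rewrite -!mulrA mxtr_mulC !mulrA.
by rewrite -(mulrA _ A) h mulr1 -(mulrA _ A) h mulr1.
Qed.

Lemma coef_scalN X : coef_scal (- X) = coef_scal X.
Proof. by rewrite /coef_scal -scaleN1r coef_formZ !scaleN1r linearN /= mulrNN. Qed.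

Lemma Spin9_clifford2 (u v : 'cV[R]_9) : dotv u u = 1 -> dotv v v = 1 ->
  Spin9 J (clifford_mul J u * clifford_mul J v).
Proof.
move=> hu hv; apply/Spin9E; exists [:: u; v]; split=> // [x|].
  by rewrite !inE => /orP[]/eqP->.
by rewrite /clifford_word !big_cons big_nil mulr1.
Qed.

Lemma dotv_basis (a : 'I_9) : dotv (delta_mx a 0 : 'cV[R]_9) (delta_mx a 0) = 1.
Proof. by rewrite dotv_delta mxE !eqxx. Qed.

Lemma Spin9_gen2 a b : Spin9 J (J a * J b).
Proof. by rewrite -!(clifford_mul_delta J); apply: Spin9_clifford2; exact: dotv_basis. Qed.

(** Conjugation by [A] multiplies both [X] and, by equivariance, [coef_form X] by the same sign,
    which disappears in the product. *)
Lemma coef_form_comm A X (k : bool) : Spin9 J A -> X * A = (-1) ^+ k *: (A * X) ->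
  X^T * coef_form X * A = A * (X^T * coef_form X).
Proof.
move=> hA hk; have [h1 h2] := Spin9_orth hJ hA.
have e1 : A^T * X * A = (-1) ^+ k *: X by rewrite -mulrA hk -scalerAr mulrA h1 mul1r.
have e2 := coef_form_conj X hA; rewrite e1 coef_formZ in e2.
have e3 : A^T * X^T * A = (-1) ^+ k *: X^T.
  by have := congr1 trmx e1; rewrite !trmx_mulr trmxK mulrA linearZ.
have e4 : X^T * coef_form X = A^T * X^T * A * (A^T * coef_form X * A).
  by rewrite e3 -e2 -scalerAl -scalerAr scalerA -expr2 sqrr_sign scale1r.
rewrite [in RHS]e4 !mulrA h2 mul1r.
by rewrite -(mulrA _ A) h2 mulr1.
Qed.

(** Every [J d * J e] commutes with X = J_a J_b J_c up to sign, so [X^T * coef_form X] lies in the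
    commutant of the even products and is a scalar. *)
Lemma coef_form_scalar a b c : uniq [:: a; b; c] ->
  coef_form (J a * J b * J c) = coef_scal (J a * J b * J c) *: (J a * J b * J c).
Proof.
move=> u; set X := J a * J b * J c.
have hX : X^T * X = 1 by exact: clifford3_orth.
have hX' := mulmx_tr_sym hX.
suff /(clifford_even_commutant hJ) e : forall d e, d != e ->
    X^T * coef_form X * (J d * J e) = J d * J e * (X^T * coef_form X).
  rewrite -[LHS]mul1r -hX' -mulrA e -scalerAr mulr1 //.
move=> d e de; pose A := J d * J e.
have [k hk] : exists k : bool, X * A = (-1) ^+ k *: (A * X).
  exists (odd (3 + (d \in [:: a; b; c]) + (3 + (e \in [:: a; b; c])))).
  rewrite /X (clifford3E J a b c) /A mulrA (clifford_prod_comm hJ) // -scalerAl.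
  rewrite -(mulrA _ (clifford_prod J _)) (clifford_prod_comm hJ) //.
  by rewrite -scalerAr scalerA -exprD signr_odd mulrA.
apply: coef_form_comm hk; exact: Spin9_gen2.
Qed.

Lemma coef_scal_swap12 a b c : a != b -> coef_scal (J a * J b * J c) = coef_scal (J b * J a * J c).
Proof. by move=> ab; rewrite (cliffordC hJ ab) mulNr coef_scalN. Qed.

Lemma coef_scal_swap23 a b c : b != c -> coef_scal (J a * J b * J c) = coef_scal (J a * J c * J b).
Proof. by move=> bc; rewrite -!mulrA (cliffordC hJ bc) mulrN coef_scalN. Qed.

(* Conjugation by the rotation J_v J_e with v = (e_c - e_d) / sqrt 2 exchanges
   the basis vectors c and d and fixes a and b. *)
Lemma coef_scal_exchange a b c d : uniq [:: a; b; c] -> d \notin [:: a; b; c] ->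
  coef_scal (J a * J b * J c) = coef_scal (J a * J b * J d).
Proof.
move=> u hd; have [//|e he] := @avoid9 [:: a; b; c; d].
pose z : 'cV[R]_9 := delta_mx c 0 - delta_mx d 0.
pose v := (Num.sqrt 2)^-1 *: z.
have cd : (c == d) = false by move: hd; rewrite !inE !negb_or => /and3P[_ _]; rewrite eq_sym => /negbTE.
have zx x : dotv z (delta_mx x 0) = (c == x)%:R - (d == x)%:R.
  by rewrite dotv_delta !mxE !andbT ![x == _]eq_sym.
have s2 : Num.sqrt 2 * Num.sqrt 2 = 2 :> R by rewrite -expr2 sqr_sqrtr.
have s20 : Num.sqrt 2 != 0 :> R by rewrite gt_eqF // sqrtr_gt0.
have v1 : dotv v v = 1.
  rewrite /v dotvZl dotvC dotvZl {2}/z dotvBr !zx !eqxx [d == c]eq_sym cd /=.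
  rewrite mulrA -invfM s2; lra.
pose A := clifford_mul J v * J e.
have hA : Spin9 J A.
  by rewrite /A -(clifford_mul_delta J e); apply: Spin9_clifford2 => //; exact: dotv_basis.
have [h1 h2] := Spin9_orth hJ hA.
have hx x : x != e -> A^T * J x * A = J x - ((c == x)%:R - (d == x)%:R) *: (J c - J d).
  move=> xe; rewrite /A trmx_mulr (clifford_mulT hJ) (cliffordT hJ).
  have -> : J e * clifford_mul J v * J x * (clifford_mul J v * J e) =
     J e * (clifford_mul J v * clifford_mul J (delta_mx x 0) * clifford_mul J v) * J e.
    by rewrite clifford_mul_delta !mulrA.
  rewrite (clifford_reflection hJ) // /v dotvZl zx clifford_mulZ scalerA clifford_mul_delta.
  have -> : 2 * ((Num.sqrt 2)^-1 * ((c == x)%:R - (d == x)%:R)) / Num.sqrt 2 =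
      (c == x)%:R - (d == x)%:R :> R.
    by rewrite -{1}s2; field.
  rewrite /z clifford_mulD clifford_mulN !clifford_mul_delta.
  have q y : y != e -> J e * J y * J e = - J y.
    by move=> ye; rewrite -mulrA (cliffordC hJ ye) mulrN mulrA (cliffordJJ hJ) mul1r.
  rewrite mulrBr -scalerAr mulrBr mulrBl -scalerAl mulrBl !q //; first last.
  - by move: he; rewrite !inE !negb_or => /and4P[_ _ ? _]; rewrite eq_sym.
  - by move: he; rewrite !inE !negb_or => /and4P[_ _ _ ?]; rewrite eq_sym.
  by apply/matrixP => i j; rewrite !mxE; ring.
move: (u) (hd) (he); rewrite /= !inE !negb_or => /and3P[/andP[ab ac] bc _] /and3P[da db dc].
case/and4P=> ea eb ec ed.
have -> : J a * J b * J d = A^T * (J a * J b * J c) * A.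
  have m X Y : A^T * (X * Y) * A = A^T * X * A * (A^T * Y * A).
    by have := @conj_mul_orthogonal R A^T; rewrite trmxK => ->.
  rewrite !m !hx 1?eq_sym // !(eq_sym c) !(eq_sym d).
  rewrite (negbTE ac) (negbTE bc) eqxx [a == d]eq_sym (negbTE da) [b == d]eq_sym (negbTE db).
  by rewrite cd subrr !scale0r !subr0 /= scale1r opprB addrC subrK.
by rewrite coef_scal_conj.
Qed.

(** Both triples are moved, one index at a time, to a common triple of indices outside them; nine
    indices leave room for three fresh ones. *)
Lemma coef_scal_const a b c : uniq [:: a; b; c] ->
  coef_scal (J a * J b * J c) = coef_scal (J 0 * J 1 * J 2).
Proof.
move=> u; have [//|x hx] := @avoid9 [:: a; b; c; 0; 1; 2].
have [//|y hy] := @avoid9 [:: x; a; b; c; 0; 1; 2].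
have [//|z hz] := @avoid9 [:: y; x; a; b; c; 0; 1; 2].
suff H p q r : uniq [:: p; q; r] -> x \notin [:: p; q; r] -> y \notin [:: x; p; q; r] ->
    z \notin [:: y; x; p; q; r] ->
    coef_scal (J p * J q * J r) = coef_scal (J z * J y * J x).
  have F (l l' : seq 'I_9) t : {subset l <= l'} -> t \notin l' -> t \notin l.
    by move=> s; apply: contra (s t).
  rewrite !H //; first [apply: F hx | apply: F hy | apply: F hz] => t; rewrite !inE;
  by do ![case: (t == _) => //=].
rewrite /= !inE !negb_or => /and3P[/andP[pq pr] qr _] /and3P[xp xq xr].
move=> /and4P[yx yp yq yr] /and5P[zy zx zp zq zr].
have flip (t t' : 'I_9) : t != t' -> (t' == t) = false by rewrite eq_sym => /negbTE.
pose N := (negbTE pq, negbTE pr, negbTE qr, negbTE xp, negbTE xq, negbTE xr, negbTE yx,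
  negbTE yp, negbTE yq, negbTE yr, negbTE zy, negbTE zx, negbTE zp, negbTE zq, negbTE zr).
pose N' := (flip _ _ pq, flip _ _ pr, flip _ _ qr, flip _ _ xp, flip _ _ xq, flip _ _ xr,
  flip _ _ yx, flip _ _ yp, flip _ _ yq, flip _ _ yr, flip _ _ zy, flip _ _ zx, flip _ _ zp).
rewrite (@coef_scal_exchange _ _ _ x); try by rewrite /= !inE ?N ?N'.
rewrite coef_scal_swap23 ?N ?N' // (@coef_scal_exchange _ _ _ y); try by rewrite /= !inE ?N ?N'.
rewrite coef_scal_swap12 ?N ?N' // coef_scal_swap23 ?N ?N' //.
rewrite (@coef_scal_exchange _ _ _ z); try by rewrite /= !inE ?N ?N'.
by rewrite coef_scal_swap23 ?N ?N' // coef_scal_swap12 ?N ?N' // coef_scal_swap23 ?N ?N'.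
Qed.

Lemma embedding_unique : exists mu, forall w v, spin9_lie J (T w v - mu *: wedge v w).
Proof.
(* The factor 1/2 compensates the 2 of [mxtr_wedge]. With this constant the difference is orthogonal
   to every product of three distinct generators, hence in spin(9). *)
exists (coef_scal (J 0 * J 1 * J 2) / 2) => w v; set mu := _ / 2.
have [_ hm _ _] := hT; have [aT _] := hm w v.
have aX : (T w v - mu *: wedge v w)^T = - (T w v - mu *: wedge v w).
  by rewrite linearB linearZ /= aT wedgeT scalerN opprB opprK addrC.
apply/(spin9_lieP hJ); split=> //; apply: (skew_normalizing hJ aX) => a b c u.
rewrite mulrBr raddfB /= -coef_formE coef_form_scalar // -scalerAr mxtraceZ.
rewrite -mulmxE mxtr_wedge; last exact: clifford3T.
rewrite coef_scal_const // -scalemxAl -scalemxAr mxE /mu.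
by field.
Qed.

End VectorialUniqueness.

(** * The trace of a conformal curvature tensor *)

Section Bianchi.
Context {R : realType} (J : 'I_9 -> 'M[R]_16) (hJ : clifford_system J).
Implicit Types (X Y M : 'M[R]_16).

Definition clifford_avg X : 'M[R]_16 := \sum_c J c * X * J c.

Lemma sum_delta_scale (V : lmodType R) n (k : R) (b : 'I_n) (F : 'I_n -> V) :
  \sum_c (k * (b == c)%:R) *: F c = k *: F b.
Proof.
rewrite (bigD1 b) //= big1 => [|c]; first by rewrite eqxx mulr1 addr0.
by rewrite eq_sym => /negbTE->; rewrite mulr0 scale0r.
Qed.

Lemma sum_ad_clifford2 a b (F : 'M[R]_16 -> 'I_9 -> 'M[R]_16) :
  (forall c, linear (F^~ c)) ->
  \sum_c F (ad (J a * J b) (J c)) c = 2 *: F (J a) b - 2 *: F (J b) a.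
Proof.
move=> hF; rewrite -2!(sum_delta_scale 2) -sumrB; apply: eq_bigr => c _.
rewrite (ad_clifford2 hJ) -scaleNr -[- _ *: J b]addr0 addrC.
have F0 : F 0 c = 0 by have := hF c (-1) 0 0; rewrite scaler0 addr0 scaleN1r addNr.
by rewrite addrC hF hF F0 addr0 scaleNr.
Qed.

(** For distinct indices seven generators commute with J_a J_b and two anticommute, so the value is
    5 J_a J_b; for equal indices it is 9. The formula covers both cases. *)
Lemma clifford_avg_clifford2 a b :
  clifford_avg (J a * J b) = 7 *: (J a * J b) + 2 *: (J b * J a).
Proof.
have e c : J c * (J a * J b) * J c = J a * J b - ad (J a * J b) (J c) * J c.
  rewrite /ad mulrBl -(mulrA _ (J c) (J c)) (cliffordJJ hJ) mulr1.
  by rewrite opprB addrC subrK.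
rewrite /clifford_avg (eq_bigr _ (fun c _ => e c)) sumrB sumr_const card_ord.
rewrite (@sum_ad_clifford2 a b (fun X c => X * J c)); last first.
  by move=> c k X Y; rewrite mulrDl -scalerAl.
rewrite -[_ *+ 9]scaler_nat /=; move: (J a * J b) (J b * J a) => p q.
by apply/matrixP => i k; rewrite !mxE; ring.
Qed.

(** Equivariance of averaging: Σ_c J_c ⊗ J_c is invariant under spin(9). *)
Lemma clifford_avg_ad X a b :
  clifford_avg (ad X (J a * J b)) = ad (clifford_avg X) (J a * J b).
Proof.
set D := J a * J b; apply/eqP; rewrite -subr_eq0 /clifford_avg ad_suml -sumrB.
rewrite (eq_bigr (fun c => J c * X * ad D (J c) + ad D (J c) * X * J c)); last first.
  move=> c _; rewrite /ad !mulrBr !mulrBl !mulrA.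
  move: (J c * X * D * J c) (J c * D * X * J c) (J c * X * J c * D) (D * J c * X * J c).
  by move=> p q r s; apply/matrixP => i k; rewrite !mxE; ring.
rewrite big_split /= (@sum_ad_clifford2 a b (fun Y c => J c * X * Y)); last first.
  by move=> c k Y Z; rewrite mulrDr -scalerAr.
rewrite (@sum_ad_clifford2 a b (fun Y c => Y * X * J c)); last first.
  by move=> c k Y Z; rewrite !mulrDl -!scalerAl.
apply/eqP; rewrite addrC -!scalerBr.
move: (J a * X * J b) (J b * X * J a) => p q.
by rewrite -scalerDr -opprB addNr scaler0.
Qed.

Lemma clifford_avgD X Y : clifford_avg (X + Y) = clifford_avg X + clifford_avg Y.
Proof. by rewrite -big_split; apply: eq_bigr => c _; rewrite mulrDr mulrDl. Qed.

Lemma clifford_avgZ k X : clifford_avg (k *: X) = k *: clifford_avg X.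
Proof. by rewrite scaler_sumr; apply: eq_bigr => c _; rewrite -scalerAr -scalerAl. Qed.

Lemma clifford_avg_sum (I : Type) (r : seq I) (P : pred I) (F : I -> 'M[R]_16) :
  clifford_avg (\sum_(i <- r | P i) F i) = \sum_(i <- r | P i) clifford_avg (F i).
Proof.
apply: (big_morph _ clifford_avgD).
by rewrite /clifford_avg big1 // => c _; rewrite mulr0 mul0r.
Qed.

(* On a product of generators the averaging operator acts by an integer m, and
   88 + 16 m is not 0 since 11 + 2 m is odd. *)
Lemma clifford_avg_eigen0 X : 88 *: X + 16 *: clifford_avg X = 0 -> X = 0.
Proof.
move=> h; apply: (clifford_expand_eq0 hJ) => S _; set P := clifford_prod J (enum S).
pose m : int := \sum_(c < 9) (-1) ^+ (size (enum S) + (c \in enum S)).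
have e : \tr (P^T * clifford_avg X) = m%:~R * \tr (P^T * X).
  rewrite /clifford_avg mulr_sumr raddf_sum /m rmorph_sum mulr_suml; apply: eq_bigr => c _ /=.
  rewrite !mulrA mxtr_mulC !mulrA rmorphXn /= rmorphN1.
  have -> : J c * P^T = (-1) ^+ (size (enum S) + (c \in enum S)) *: (P^T * J c).
    by rewrite (clifford_prod_tr_comm hJ) ?enum_uniq // scalerA -expr2 sqrr_sign scale1r.
  by rewrite -!scalerAl mxtraceZ -(mulrA P^T) (cliffordJJ hJ) mulr1.
have := congr1 (fun Y => \tr (P^T * Y)) h.
rewrite mulrDr -!scalerAr mxtraceD !mxtraceZ e mulr0 mxtrace0 mulrA -mulrDl => /eqP.
rewrite mulf_eq0 => /orP[|/eqP //].
rewrite (_ : 88 + 16 * m%:~R = (88 + 16 * m)%:~R); last by rewrite rmorphD rmorphM.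
by rewrite intr_eq0 => /eqP; lia.
Qed.

Section BianchiIdentity.
Context (K : 'I_16 -> 'I_16 -> 'M[R]_16).
Hypothesis K_alt : forall i j, K i j = - K j i.
Hypothesis K_norm : forall i j, clifford_normalizing J (K i j).
Hypothesis K_cyclic : forall i j k l, K i j l k + K j k l i + K k i l j = 0.

(** The curvature is ψ_ij 1 + Σ ρ_ab,ij J_a J_b. Writing the 2-forms ψ and ρ_ab as matrices in the
    indices i, j turns contractions of form indices with endomorphism indices into matrix
    products. *)
Let psi : 'M[R]_16 := \matrix_(i, j) (\tr (K i j) / 16).
Let rho a b : 'M[R]_16 := \matrix_(i, j) spin9_coef J (K i j) a b.

Lemma curvatureE i j l k : K i j l k = psi i j * (1 : 'M[R]_16) l k +
  \sum_a \sum_b rho a b i j * (J a * J b) l k.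
Proof.
rewrite {1}(normalizingE hJ (K_norm i j)) !mxE summxE; congr (_ + _).
by apply: eq_bigr => a _; rewrite summxE; apply: eq_bigr => b _; rewrite !mxE.
Qed.

Lemma rhoC a b : rho a b = - rho b a.
Proof. by apply/matrixP => i j; rewrite !mxE spin9_coefC. Qed.

Lemma sum_rho_anti (F : 'I_9 -> 'I_9 -> 'M[R]_16 -> 'M[R]_16) :
  (forall a b X, F a b (- X) = - F a b X) ->
  \sum_a \sum_b F b a (rho a b) = - \sum_a \sum_b F a b (rho a b).
Proof.
move=> hF; rewrite exchange_big -sumrN; apply: eq_bigr => a _; rewrite -sumrN.
by apply: eq_bigr => b _; rewrite rhoC hF.
Qed.

(** The cyclic identity is multiplied by M_li and summed over l and i. In two of its terms a form
    index meets an endomorphism index, giving matrix products; in the third both endomorphism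
    indices are contracted, giving a trace. *)
Lemma bianchi_contract M :
  M * psi + psi * M^T + \sum_a \sum_b (rho a b * M^T * (J a * J b) - J a * J b * M * rho a b)
  + \matrix_(k, j) \tr (M^T * K j k) = 0.
Proof.
have -> : \sum_a \sum_b (rho a b * M^T * (J a * J b) - J a * J b * M * rho a b) =
    \sum_a \sum_b (rho a b * M^T * (J a * J b) + (J a * J b)^T * M * rho a b).
  under eq_bigr do rewrite sumrB; under [RHS]eq_bigr do rewrite big_split /=.
  rewrite sumrB big_split /=; congr (_ + _).
  rewrite -(@sum_rho_anti (fun a b X => J a * J b * M * X)); last by move=> *; rewrite mulrN.
  by apply: eq_bigr => a _; apply: eq_bigr => b _; rewrite trmx_mulr !(cliffordT hJ).
apply/matrixP => k j; rewrite [RHS]mxE.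
have cD (F G : 'I_16 -> 'I_16 -> R) : \sum_l \sum_i M l i * (F l i + G l i) =
    \sum_l \sum_i M l i * F l i + \sum_l \sum_i M l i * G l i.
  by rewrite -big_split; apply: eq_bigr => l _; rewrite -big_split; apply: eq_bigr => i _; rewrite mulrDr.
have cS (F : 'I_9 -> 'I_9 -> 'I_16 -> 'I_16 -> R) :
    \sum_l \sum_i M l i * (\sum_a \sum_b F a b l i) =
    \sum_a \sum_b \sum_l \sum_i M l i * F a b l i.
  under eq_bigr do under eq_bigr do rewrite mulr_sumr.
  under eq_bigr do rewrite exchange_big.
  rewrite exchange_big; apply: eq_bigr => a _ /=.
  under eq_bigr do under eq_bigr do rewrite mulr_sumr.
  under eq_bigr do rewrite exchange_big.
  by rewrite exchange_big.
have c1 X Y : \sum_l \sum_i M l i * (Y i j * X l k) = (X^T * M * Y) k j.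
  rewrite mxE exchange_big; apply: eq_bigr => i _; rewrite mxE mulr_suml.
  by apply: eq_bigr => l _; rewrite mxE; ring.
have c3 X Y : \sum_l \sum_i M l i * (Y k i * X l j) = (Y * M^T * X) k j.
  rewrite mxE; apply: eq_bigr => l _; rewrite mxE mulr_suml.
  by apply: eq_bigr => i _; rewrite mxE; ring.
have s1 : \sum_l \sum_i M l i * K i j l k =
    (M * psi) k j + \sum_a \sum_b ((J a * J b)^T * M * rho a b) k j.
  under eq_bigr do under eq_bigr do rewrite curvatureE.
  rewrite cD cS; congr (_ + _).
    by rewrite c1 trmx1 mul1r.
  by apply: eq_bigr => a _; apply: eq_bigr => b _; rewrite c1.
have s3 : \sum_l \sum_i M l i * K k i l j =
    (psi * M^T) k j + \sum_a \sum_b (rho a b * M^T * (J a * J b)) k j.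
  under eq_bigr do under eq_bigr do rewrite curvatureE.
  rewrite cD cS; congr (_ + _).
    by rewrite c3 mulr1.
  by apply: eq_bigr => a _; apply: eq_bigr => b _; rewrite c3.
have s2 : \sum_l \sum_i M l i * K j k l i = \tr (M^T * K j k) by rewrite mxtr_tr_mul.
have : \sum_l \sum_i M l i * (K i j l k + K j k l i + K k i l j) = 0.
  by rewrite big1 // => l _; rewrite big1 // => i _; rewrite K_cyclic mulr0.
rewrite !cD s1 s2 s3 => <-.
have aE (A B : 'M[R]_16) : (A + B) k j = A k j + B k j by rewrite mxE.
rewrite !aE summxE (eq_bigr (fun a => \sum_b (rho a b * M^T * (J a * J b)) k j +
   \sum_b ((J a * J b)^T * M * rho a b) k j)); last first.
  by move=> a _; rewrite summxE -big_split; apply: eq_bigr => b _; rewrite aE.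
rewrite big_split /= [X in _ + X = _]mxE; ring.
Qed.

Lemma psi_trace_matrix : \matrix_(k, j) \tr (1^T * K j k) = - 16 *: psi.
Proof.
by apply/matrixP => k j; rewrite trmx1 !mxE mul1r K_alt raddfN /=; field.
Qed.

Lemma sum_rho_sub (F G : 'I_9 -> 'I_9 -> 'M[R]_16) :
  \sum_a \sum_b (F a b - G a b) = \sum_a \sum_b F a b - \sum_a \sum_b G a b.
Proof. by rewrite -sumrB; apply: eq_bigr => a _; rewrite sumrB. Qed.

(** Contraction with 1: the two ψ terms contribute 2, the trace term -16. *)
Lemma bianchi_first : \sum_a \sum_b ad (rho a b) (J a * J b) = 14 *: psi.
Proof.
have := bianchi_contract 1; rewrite psi_trace_matrix trmx1 mul1r mulr1.
rewrite (_ : \sum_a \sum_b _ = \sum_a \sum_b ad (rho a b) (J a * J b)); last first.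
  by apply: eq_bigr => a _; apply: eq_bigr => b _; rewrite !mulr1.
move: (\sum_a _) => L h; apply/matrixP => i j; have /matrixP/(_ i j) := h.
rewrite !mxE; lra.
Qed.

(** [J c] is traceless and symmetric, whereas the curvature consists of a scalar and a skew part;
    the trace term thus drops out for M = J_c. *)
Lemma psi_trace_gen c : \matrix_(k, j) \tr ((J c)^T * K j k) = 0.
Proof.
apply/matrixP => k j; rewrite !mxE (normalizingE hJ (K_norm j k)) mulrDr mxtraceD.
rewrite -scalerAr mulr1 mxtraceZ (cliffordT hJ).
have -> : \tr (J c) = 0.
  have [//|b hb] := @avoid9 [:: c]; apply: (@mxtr_anticomm _ _ hJ b).
  by rewrite (cliffordC hJ) //; move: hb; rewrite inE eq_sym.
rewrite mulr0 add0r mxtr_mulr_sum big1 // => a _; rewrite mxtr_mulr_sum big1 // => b _.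
rewrite -scalerAr mxtraceZ; case: (eqVneq a b) => [->|ab].
  by rewrite spin9_coefC; have := spin9_coefC J (K j k) b b => h; rewrite (_ : spin9_coef _ _ _ _ = 0); lra.
rewrite -(cliffordT hJ c) mxtr_sym_skew ?mulr0 ?(cliffordT hJ) //.
by rewrite trmx_mulr !(cliffordT hJ) (cliffordC hJ) // eq_sym.
Qed.

(** The contraction with J_c is multiplied by J_c on the left and summed over c, which averages ρ in
    one product and J_a J_b in the other; multiplication on the right exchanges these roles. *)
Lemma bianchi_left : 9 *: psi + clifford_avg psi +
  \sum_a \sum_b (clifford_avg (rho a b) * (J a * J b) - clifford_avg (J a * J b) * rho a b) = 0.
Proof.
have h c : psi + J c * psi * J c + \sum_a \sum_b (J c * rho a b * J c * (J a * J b)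
    - J c * (J a * J b) * J c * rho a b) = 0.
  have := bianchi_contract (J c); rewrite psi_trace_gen addr0 (cliffordT hJ) => /(congr1 ( *%R (J c))).
  rewrite mulr0 !mulrDr !mulrA (cliffordJJ hJ) mul1r => e; rewrite -[RHS]e; congr (_ + _).
  rewrite mulr_sumr; apply: eq_bigr => a _; rewrite mulr_sumr; apply: eq_bigr => b _.
  by rewrite mulrBr !mulrA.
have : \sum_c (psi + J c * psi * J c + \sum_a \sum_b (J c * rho a b * J c * (J a * J b)
    - J c * (J a * J b) * J c * rho a b)) = 0 by rewrite big1.
rewrite !big_split /= sumr_const card_ord -[_ *+ 9]scaler_nat => e; rewrite -[RHS]e; congr (_ + _).
rewrite [RHS]exchange_big. apply: eq_bigr => a _; rewrite [RHS]exchange_big; apply: eq_bigr => b _.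
by rewrite sumrB /clifford_avg !mulr_suml.
Qed.

Lemma bianchi_right : 9 *: psi + clifford_avg psi +
  \sum_a \sum_b (rho a b * clifford_avg (J a * J b) - J a * J b * clifford_avg (rho a b)) = 0.
Proof.
have h c : psi + J c * psi * J c + \sum_a \sum_b (rho a b * (J c * (J a * J b) * J c)
    - J a * J b * (J c * rho a b * J c)) = 0.
  have := bianchi_contract (J c); rewrite psi_trace_gen addr0 (cliffordT hJ).
  move=> /(congr1 ( *%R^~ (J c))) /=.
  rewrite mul0r !mulrDl -[psi * _ * _]mulrA (cliffordJJ hJ) mulr1 => e; rewrite -[RHS]e.
  rewrite [X in _ = X + _]addrC; congr (_ + _).
  rewrite mulr_suml; apply: eq_bigr => a _; rewrite mulr_suml; apply: eq_bigr => b _.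
  by rewrite mulrBl !mulrA.
have : \sum_c (psi + J c * psi * J c + \sum_a \sum_b (rho a b * (J c * (J a * J b) * J c)
    - J a * J b * (J c * rho a b * J c))) = 0 by rewrite big1.
rewrite !big_split /= sumr_const card_ord -[_ *+ 9]scaler_nat => e; rewrite -[RHS]e; congr (_ + _).
rewrite [RHS]exchange_big; apply: eq_bigr => a _; rewrite [RHS]exchange_big; apply: eq_bigr => b _.
by rewrite sumrB /clifford_avg !mulr_sumr.
Qed.

(** The left and right identities are added. Antisymmetry of ρ makes the average of J_a J_b act as
    5, and 5 (SL - SR) = 70 ψ; by equivariance the averaged ρ contribute 14 times the average of ψ.
    The totals are 9 + 9 + 70 = 88 and 1 + 1 + 14 = 16. *)
Lemma bianchi_trace i j : \tr (K i j) = 0.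
Proof.
suff /matrixP/(_ i j) : psi = 0.
  by rewrite !mxE => /eqP; rewrite mulf_eq0 invr_eq0 pnatr_eq0 orbF => /eqP.
apply: clifford_avg_eigen0.
set SL := \sum_a \sum_b (rho a b * (J a * J b)).
set SR := \sum_a \sum_b (J a * J b * rho a b).
have hS : SL - SR = 14 *: psi by rewrite -bianchi_first -sum_rho_sub.
have eR : \sum_a \sum_b clifford_avg (J a * J b) * rho a b = 5 *: SR.
  have : \sum_a \sum_b J b * J a * rho a b = - SR.
    by rewrite -(@sum_rho_anti (fun a b X => J a * J b * X)) // => *; rewrite mulrN.
  move=> e; rewrite (_ : 5 *: SR = 7 *: SR + 2 *: (- SR)); last first.
    by apply/matrixP => k l; rewrite !mxE; ring.
  rewrite -e /SR !scaler_sumr -big_split; apply: eq_bigr => a _.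
  rewrite !scaler_sumr -big_split; apply: eq_bigr => b _ /=.
  by rewrite clifford_avg_clifford2 mulrDl -!scalerAl.
have eL : \sum_a \sum_b rho a b * clifford_avg (J a * J b) = 5 *: SL.
  have : \sum_a \sum_b rho a b * (J b * J a) = - SL.
    by rewrite -(@sum_rho_anti (fun a b X => X * (J a * J b))) // => *; rewrite mulNr.
  move=> e; rewrite (_ : 5 *: SL = 7 *: SL + 2 *: (- SL)); last first.
    by apply/matrixP => k l; rewrite !mxE; ring.
  rewrite -e /SL !scaler_sumr -big_split; apply: eq_bigr => a _.
  rewrite !scaler_sumr -big_split; apply: eq_bigr => b _ /=.
  by rewrite clifford_avg_clifford2 mulrDr -!scalerAr.
have hA : \sum_a \sum_b clifford_avg (rho a b) * (J a * J b) -
    \sum_a \sum_b J a * J b * clifford_avg (rho a b) = 14 *: clifford_avg psi.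
  rewrite -clifford_avgZ -bianchi_first clifford_avg_sum -sum_rho_sub.
  apply: eq_bigr => a _; rewrite clifford_avg_sum; apply: eq_bigr => b _.
  by rewrite clifford_avg_ad.
have h1 := bianchi_left; have h2 := bianchi_right; move: h1 h2 hS hA.
rewrite !sum_rho_sub eL eR {eL eR}; move: (clifford_avg psi) SL SR => ap SL SR.
move: (\sum_a _) (\sum_a _) psi => p q ps h1 h2 h3 h4.
apply/matrixP => k l; move/matrixP/(_ k l): h1; move/matrixP/(_ k l): h2.
move/matrixP/(_ k l): h3; move/matrixP/(_ k l): h4; rewrite !mxE; lra.
Qed.

End BianchiIdentity.
End Bianchi.

(** * Calculus on R^n *)

Section MatrixDerivative.
Context {R : realType} {V : normedModType R}.
Implicit Types (x v : V).

Lemma is_derive_add (f g : V -> R) x v df dg : is_derive x v f df -> is_derive x v g dg ->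
  is_derive x v (fun y => f y + g y) (df + dg).
Proof. by move=> hf hg; exact: (is_deriveD hf hg). Qed.

Lemma is_derive_opp (f : V -> R) x v df : is_derive x v f df ->
  is_derive x v (fun y => - f y) (- df).
Proof. by move=> hf; exact: (is_deriveN hf). Qed.

Lemma is_derive_mul (f g : V -> R) x v df dg : is_derive x v f df -> is_derive x v g dg ->
  is_derive x v (fun y => f y * g y) (df * g x + f x * dg).
Proof.
move=> hf hg; apply: (is_derive_eq (is_deriveM hf hg)).
by rewrite addrC; congr (_ + _); rewrite mulrC.
Qed.

Lemma is_derive_const (c : R) x v : is_derive x v (fun=> c) 0.
Proof. exact: is_derive_cst. Qed.

Lemma is_derive_bigsum (I : Type) (r : seq I) (P : pred I) (f : I -> V -> R) x v df :
  (forall i, P i -> is_derive x v (f i) (df i)) ->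
  is_derive x v (fun y => \sum_(i <- r | P i) f i y) (\sum_(i <- r | P i) df i).
Proof.
move=> h; elim: r => [|i r IH].
  rewrite big_nil (_ : (fun y => _) = fun=> 0); first exact: is_derive_const.
  by apply/funext => y; rewrite big_nil.
rewrite big_cons (_ : (fun y => _) = fun y => if P i then f i y + \sum_(j <- r | P j) f j y
    else \sum_(j <- r | P j) f j y); last by apply/funext => y; rewrite big_cons.
by case: (boolP (P i)) => // Pi; apply: is_derive_add (h _ Pi) IH.
Qed.

(** Entrywise, to match [deriv_mx], and relational, so that derivability and value travel together
    through the product rule, including products of rectangular matrices. *)
Definition is_dmx p q (F : V -> 'M[R]_(p, q)) x v (dF : 'M[R]_(p, q)) :=
  forall a b, is_derive x v (fun y => F y a b) (dF a b).

Lemma is_dmx_eq p q (F : V -> 'M[R]_(p, q)) x v dF dF' :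
  is_dmx F x v dF -> dF = dF' -> is_dmx F x v dF'.
Proof. by move=> h <-. Qed.

Lemma is_dmx_cst p q (C : 'M[R]_(p, q)) x v : is_dmx (fun=> C) x v 0.
Proof. by move=> a b; rewrite mxE; exact: is_derive_const. Qed.

Lemma is_dmxD p q (F G : V -> 'M[R]_(p, q)) x v dF dG :
  is_dmx F x v dF -> is_dmx G x v dG -> is_dmx (fun y => F y + G y) x v (dF + dG).
Proof.
move=> hF hG a b; rewrite mxE; under eq_fun do rewrite mxE.
exact: is_derive_add.
Qed.

Lemma is_dmxN p q (F : V -> 'M[R]_(p, q)) x v dF :
  is_dmx F x v dF -> is_dmx (fun y => - F y) x v (- dF).
Proof.
move=> hF a b; rewrite mxE; under eq_fun do rewrite mxE.
exact: is_derive_opp.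
Qed.

Lemma is_dmxB p q (F G : V -> 'M[R]_(p, q)) x v dF dG :
  is_dmx F x v dF -> is_dmx G x v dG -> is_dmx (fun y => F y - G y) x v (dF - dG).
Proof. by move=> hF hG; apply: is_dmxD => //; exact: is_dmxN. Qed.

Lemma is_dmxM p q r (F : V -> 'M[R]_(p, q)) (G : V -> 'M[R]_(q, r)) x v dF dG :
  is_dmx F x v dF -> is_dmx G x v dG ->
  is_dmx (fun y => F y *m G y) x v (dF *m G x + F x *m dG).
Proof.
move=> hF hG a b; rewrite !mxE -big_split; under eq_fun do rewrite mxE.
by apply: is_derive_bigsum => c _; exact: is_derive_mul.
Qed.

Lemma is_dmxZ p q (f : V -> R) (F : V -> 'M[R]_(p, q)) x v df dF :
  is_derive x v f df -> is_dmx F x v dF ->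
  is_dmx (fun y => f y *: F y) x v (df *: F x + f x *: dF).
Proof.
move=> hf hF a b; rewrite !mxE; under eq_fun do rewrite mxE.
exact: is_derive_mul.
Qed.

Lemma is_dmx_tr p q (F : V -> 'M[R]_(p, q)) x v dF :
  is_dmx F x v dF -> is_dmx (fun y => (F y)^T) x v dF^T.
Proof. by move=> hF a b; rewrite mxE; under eq_fun do rewrite mxE. Qed.

Lemma is_derive_mxtrace p (F : V -> 'M[R]_p) x v dF :
  is_dmx F x v dF -> is_derive x v (fun y => \tr (F y)) (\tr dF).
Proof. by move=> hF; apply: is_derive_bigsum => a _. Qed.

Lemma is_dmx_sum p q (I : Type) (r : seq I) (P : pred I) (F : I -> V -> 'M[R]_(p, q)) x v dF :
  (forall i, P i -> is_dmx (F i) x v (dF i)) ->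
  is_dmx (fun y => \sum_(i <- r | P i) F i y) x v (\sum_(i <- r | P i) dF i).
Proof.
move=> h a b; rewrite summxE; under eq_fun do rewrite summxE.
by apply: is_derive_bigsum => i Pi; exact: h.
Qed.

Lemma is_dmx_unique p q (F : V -> 'M[R]_(p, q)) x v dF dF' :
  is_dmx F x v dF -> is_dmx F x v dF' -> dF = dF'.
Proof.
move=> h h'; apply/matrixP => a b.
have <- := @derive_val _ _ _ _ _ _ _ (h a b).
by have <- := @derive_val _ _ _ _ _ _ _ (h' a b).
Qed.

Lemma near_eq_is_dmx p q (F G : V -> 'M[R]_(p, q)) x v dF :
  (\near x, F x = G x) -> is_dmx F x v dF -> is_dmx G x v dF.
Proof.
move=> h hF a b; apply: near_eq_is_derive (hF a b).
by near=> y; rewrite (near h y).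
Unshelve. all: by end_near.
Qed.

End MatrixDerivative.

(** * First-order estimates and the chain rule *)

Section LocalEstimates.
Context {R : realType}.

Lemma mvt_symmetric (f df : R -> R) (h : R) :
  (forall s : R, `|s| <= `|h| -> is_derive s (1 : R) f (df s)) ->
  exists2 c, `|c| <= `|h| & f h - f 0 = df c * h.
Proof.
move=> hf.
have key a b : a <= b -> (forall s, a <= s <= b -> `|s| <= `|h|) ->
    exists2 c, `|c| <= `|h| & f b - f a = df c * (b - a).
  move=> ab hs; have [s||c hc e] := @MVT_segment R f df a b ab.
  - by rewrite in_itv /= => /andP[/ltW s1 /ltW s2]; apply/hf/hs/andP.
  - apply: derivable_within_continuous => s; rewrite in_itv /= => hss.
    by have [] := hf s (hs _ hss).
  - by exists c => //; apply: hs; move: hc; rewrite in_itv.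
have [h0|h0] := leP 0 h.
  have [s /andP[s0 sh]|c hc e] := key _ _ h0; first by rewrite !ger0_norm.
  by exists c => //; rewrite e subr0.
have [s /andP[s0 sh]|c hc e] := key _ _ (ltW h0).
  by rewrite !ler0_norm ?lerN2 // ltW.
by exists c => //; rewrite -opprB e sub0r mulrN opprK.
Qed.

Lemma is_derive_line (V : normedModType R) (f : V -> R) (x v : V) df :
  is_derive x v f df <-> is_derive (0 : R) (1 : R) (fun s : R => f (s *: v + x)) df.
Proof.
have e : (fun h : R => h^-1 *: ((f \o shift x) (h *: v) - f x)) =
   (fun h : R => h^-1 *: (((fun s => f (s *: v + x)) \o shift 0) (h *: 1) - f (0 *: v + x))).
  apply/funext => h /=; rewrite scale0r add0r addr0.
  by rewrite (_ : h *: (1 : R) = h) // /GRing.scale /= mulr1.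
split=> -[h1 h2]; split.
- by move: h1; rewrite /derivable e.
- by move: h2; rewrite /derive e.
- by move: h1; rewrite /derivable e.
- by move: h2; rewrite /derive e.
Qed.

Lemma is_derive_line_shift (V : normedModType R) (f : V -> R) (x v : V) (s : R) df :
  is_derive (s *: v + x) v f df -> is_derive s (1 : R) (fun t : R => f (t *: v + x)) df.
Proof.
move=> /is_derive_line h; apply/is_derive_line; move: h.
congr (is_derive _ _ _ _); apply/funext => t /=; rewrite addrA -scalerDl.
by congr (f ((_ + _) *: _ + _)); rewrite /GRing.scale /= mulr1.
Qed.

End LocalEstimates.

Section ChainRule.
Local Open Scope classical_set_scope.
Context {R : realType} {n : nat}.
Local Notation E := 'cV[R]_n.
Implicit Types (x y v : E) (f : E -> R) (D : set E).

Lemma ball_cV x r y : 0 < r -> ball x r y <-> forall i, `|x i 0 - y i 0| < r.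
Proof.
move=> r0; split=> [[_ h] i|h]; first exact: h.
by split=> // i j; rewrite ord1; exact: h.
Qed.

Lemma c1_continuous_partial D f a x : Ck 1 D f -> D x -> {for x, continuous ('D_(basis_vec a) f)}.
Proof. by case=> _ h Dx; have [_ [hc _]] := h a; exact: hc. Qed.

Lemma c1_derivable_partial D f a x : Ck 1 D f -> D x -> derivable f x (basis_vec a).
Proof. by case=> _ h Dx; have [hd _] := h a; exact: hd. Qed.

(** [Ck] speaks of coordinate directions only. The coordinates of [x] are replaced by those of [y]
    one at a time, [z k] having the first k from [y], and the mean value theorem is applied on each
    edge of this path. *)
Lemma partials_estimate D f x : open D -> D x ->
  (forall a y, D y -> derivable f y (basis_vec a)) ->
  (forall a, {for x, continuous ('D_(basis_vec a) f)}) -> forall e, 0 < e ->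
  exists2 r, 0 < r & forall y, ball x r y ->
    `|f y - f x - \sum_a (y a 0 - x a 0) * 'D_(basis_vec a) f x|
      <= e * \sum_a `|y a 0 - x a 0|.
Proof.
move=> oD Dx fd fc e e0.
have : \forall y \near x, D y /\ forall a : 'I_n,
    `|'D_(basis_vec a) f x - 'D_(basis_vec a) f y| <= e.
  near=> y; split; first by near: y; exact: open_nbhs_nbhs.
  near: y; apply: filter_forall => a.
  have /cvgrPdist_le := fc a.
  exact.
move=> /nbhs_ballP[r /= r0 hr]; exists r => // y /(ball_cV _ _ r0) hy.
pose z (k : nat) : E := \col_a (if (a < k)%N then y a 0 else x a 0).
have z0 : z 0 = x by apply/colP => a; rewrite mxE.
have zn : z n = y by apply/colP => a; rewrite mxE ltn_ord.
have step (k : 'I_n) : exists2 c, `|'D_(basis_vec k) f x - c| <= e &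
    f (z k.+1) - f (z k) = c * (y k 0 - x k 0).
  pose phi (s : R) := f (s *: basis_vec k + z k).
  have zb s : `|s| <= `|y k 0 - x k 0| -> ball x r (s *: basis_vec k + z k).
    move=> hs; apply/ball_cV => // i; rewrite !mxE !eqxx andbT.
    case: (eqVneq i k) => [->|ik] /=.
      rewrite ltnn mulr1 opprD addrCA subrr addr0 normrN.
      by apply: le_lt_trans hs _; rewrite distrC; exact: hy.
    rewrite mulr0 add0r; case: ifP => _; first exact: hy.
    by rewrite subrr normr0.
  have [s hs|c hc e1] := @mvt_symmetric R phi
      (fun s => 'D_(basis_vec k) f (s *: basis_vec k + z k)) (y k 0 - x k 0).
    apply: is_derive_line_shift; apply: derivableP.
    by apply: fd; have [] := hr _ (zb _ hs).
  exists ('D_(basis_vec k) f (c *: basis_vec k + z k)).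
    by have [_] := hr _ (zb _ hc); exact.
  rewrite -e1 /phi scale0r add0r; congr (f _ - _); apply/colP => i; rewrite !mxE ltnS.
  rewrite !eqxx andbT; case: (eqVneq i k) => [->|ik] /=.
    by rewrite leqnn ltnn mulr1 subrK.
  by rewrite mulr0 add0r leq_eqVlt -(inj_eq val_inj) in ik *; rewrite (negbTE ik).
have -> : f y - f x = \sum_(k < n) (f (z k.+1) - f (z k)).
  by rewrite -(big_mkord xpredT (fun k => f (z k.+1) - f (z k))) telescope_sumr // z0 zn.
rewrite -sumrB mulr_sumr; apply: le_trans (ler_norm_sum _ _ _) _.
apply: ler_sum => k _; have [c hc ->] := step k.
by rewrite mulrC -mulrBr normrM mulrC ler_wpM2r // distrC.
Unshelve. all: by end_near.
Qed.

(** Serves for the potential in the Poincaré lemma, whose partial derivatives are known before its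
    continuity. *)
Lemma partials_continuous D f x : open D -> D x ->
  (forall a y, D y -> derivable f y (basis_vec a)) ->
  (forall a, {for x, continuous ('D_(basis_vec a) f)}) -> {for x, continuous f}.
Proof.
move=> oD Dx fd fc; have [r r0 hr] := partials_estimate oD Dx fd fc ltr01.
pose C := \sum_a (`|'D_(basis_vec a) f x| + 1) + 1.
have C0 : 0 < C by rewrite ltr_wpDl // sumr_ge0 // => a _; rewrite addr_ge0.
apply/(@cvgrPdist_le _ _ _ (nbhs x)) => e e0; have d0 : 0 < Num.min r (e / C) by rewrite lt_min r0 divr_gt0.
apply: filterS (nbhsx_ballx x _ d0) => y hy.
have hyr : ball x r y by apply: le_ball hy; rewrite ge_min lexx.
have hd a : `|y a 0 - x a 0| <= e / C.
  have /(_ a)/ltW := (ball_cV _ _ d0).1 hy; rewrite distrC => h; apply: le_trans h _.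
  by rewrite ge_min lexx orbT.
have h1 := hr _ hyr; rewrite distrC.
rewrite -(subrK (\sum_a (y a 0 - x a 0) * 'D_(basis_vec a) f x) (f y - f x)).
apply: le_trans (ler_normD _ _) _; apply: le_trans (lerD h1 (ler_norm_sum _ _ _)) _.
rewrite mul1r -big_split /=; apply: (@le_trans _ _ (\sum_a (e / C) * (`|'D_(basis_vec a) f x| + 1))).
  apply: ler_sum => a _; rewrite normrM mulrDr mulr1 addrC.
  by apply: lerD => //; apply: ler_wpM2r.
rewrite -mulr_sumr -{2}[e](divfK (lt0r_neq0 C0)); apply: ler_wpM2l; first by rewrite ltW // divr_gt0.
by rewrite lerDl.
Qed.

Lemma c1_estimate D f x : open D -> D x -> Ck 1 D f -> forall e, 0 < e ->
  exists2 r, 0 < r & forall y, ball x r y ->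
    `|f y - f x - \sum_a (y a 0 - x a 0) * 'D_(basis_vec a) f x|
      <= e * \sum_a `|y a 0 - x a 0|.
Proof.
move=> oD Dx fC; apply: (partials_estimate oD Dx) => [a y Dy|a].
  exact: c1_derivable_partial fC Dy.
exact: c1_continuous_partial fC Dx.
Qed.

Lemma is_derive_of_cvg (f : R -> R) (l : R) :
  (fun h : R => h^-1 *: (f h - f 0)) @ 0^' --> l -> is_derive (0 : R) (1 : R) f l.
Proof.
move=> h.
have e : (fun h : R => h^-1 *: ((f \o shift 0) (h *: 1) - f 0)) = (fun h : R => h^-1 *: (f h - f 0)).
  by apply/funext => t /=; rewrite addr0 /GRing.scale /= mulr1.
split; first by rewrite /derivable e; apply/cvg_ex; exists l.
by rewrite /derive e; exact/cvg_lim.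
Qed.

Lemma cvg_of_is_derive (f : R -> R) (l : R) :
  is_derive (0 : R) (1 : R) f l -> (fun h : R => h^-1 *: (f h - f 0)) @ 0^' --> l.
Proof.
have e : (fun h : R => h^-1 *: ((f \o shift 0) (h *: 1) - f 0)) = (fun h : R => h^-1 *: (f h - f 0)).
  by apply/funext => t /=; rewrite addr0 /GRing.scale /= mulr1.
case; rewrite /derivable /derive e => /cvg_ex[l' hl'] h2.
by have := cvg_lim (@Rhausdorff R) hl'; rewrite h2 => ->.
Qed.

Lemma is_derive1_continuous (f : R -> R) (x l : R) : is_derive x (1 : R) f l -> {for x, continuous f}.
Proof. by case=> /derivable1_diffP/differentiable_continuous. Qed.

Lemma is_derive_chain (V : normedModType R) (c : V -> E) (t w : V) dc f D :
  open D -> D (c t) -> Ck 1 D f -> is_dmx c t w dc ->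
  is_derive t w (fun s => f (c s)) (\sum_a dc a 0 * 'D_(basis_vec a) f (c t)).
Proof.
move=> oD Dc fC hc; apply/is_derive_line; apply: is_derive_of_cvg.
pose c' (s : R) := c (s *: w + t).
have c0 : c' 0 = c t by rewrite /c' scale0r add0r.
have hc' a : is_derive (0 : R) (1 : R) (fun s => c' s a 0) (dc a 0).
  by apply/(is_derive_line (fun s => c s a 0)).
have hq a := cvg_of_is_derive (hc' a).
set d := fun a => 'D_(basis_vec a) f (c t).
(* Bounds the sum of the difference quotients of the entries of [c] once each is within 1 of its
   limit. *)
pose C := \sum_a (`|dc a 0| + 1) + 1.
have C0 : 0 < C.
  by rewrite ltr_wpDl // sumr_ge0 // => a _; rewrite addr_ge0.
apply/cvgrPdist_le => e e0.
have e20 : 0 < e / 2 by rewrite divr_gt0.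
have [r r0 hr] := c1_estimate oD Dc fC (divr_gt0 e20 C0).
have h1 : \forall h \near 0^', forall a, `|(c t) a 0 - c' h a 0| < r.
  apply: filter_forall => a; apply: nbhs_dnbhs.
  have /cvgrPdist_lt/(_ r r0) := is_derive1_continuous (hc' a).
  by rewrite c0.
have h2 : \forall h \near 0^', forall a, `|dc a 0 - h^-1 *: (c' h a 0 - c' 0 a 0)| <= 1.
  by apply: filter_forall => a; have /cvgrPdist_le/(_ 1 ltr01) := hq a.
have h3 : \forall h \near 0^', `|\sum_a dc a 0 * d a -
     \sum_a (h^-1 *: (c' h a 0 - c' 0 a 0)) * d a| <= e / 2.
  have : (fun h : R => \sum_a (h^-1 *: (c' h a 0 - c' 0 a 0)) * d a) @ 0^' -->
     \sum_a dc a 0 * d a.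
    apply: cvg_big => [|a _]; first exact: add_continuous.
    by apply: cvgM; [exact: hq|exact: cvg_cst].
  by move/cvgrPdist_le/(_ _ e20).
near=> h.
have hn0 : h != 0 by near: h; exact: nbhs_dnbhs_neq.
rewrite -/(c' h) scale0r add0r.
have B1 : ball (c t) r (c' h) by apply/ball_cV => //; near: h.
have B2 a : `|dc a 0 - h^-1 *: (c' h a 0 - c' 0 a 0)| <= 1.
  by move: a; near: h.
have B3 : `|\sum_a dc a 0 * d a - \sum_a (h^-1 *: (c' h a 0 - c' 0 a 0)) * d a| <= e / 2.
  by near: h.
have B4 := hr _ B1.
rewrite -[X in `|X - _|](subrK (\sum_a (h^-1 *: (c' h a 0 - c' 0 a 0)) * d a)) -addrA.
apply: le_trans (ler_normD _ _) _; rewrite [leRHS]splitr; apply: lerD => //.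
have -> : \sum_a (h^-1 *: (c' h a 0 - c' 0 a 0)) * d a =
    h^-1 * \sum_a (c' h a 0 - c t a 0) * d a.
  by rewrite mulr_sumr; apply: eq_bigr => a _; rewrite c0 -scalerAl.
rewrite -[h^-1 *: _]/(h^-1 * _) -mulrBr normrM distrC.
apply: le_trans (ler_wpM2l (normr_ge0 _) B4) _.
rewrite mulrCA -[leRHS](divfK (lt0r_neq0 C0)).
apply: ler_wpM2l; first by rewrite ltW // divr_gt0.
rewrite mulr_sumr; apply: (@le_trans _ _ (\sum_a (`|dc a 0| + 1))); last by rewrite lerDl.
apply: ler_sum => a _; rewrite -normrM -{1}[c t]c0 -[_ * _]/(h^-1 *: _).
rewrite -(subrK (dc a 0) (h^-1 *: _)) addrC; apply: le_trans (ler_normD _ _) _.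
by rewrite lerD2l distrC.
Unshelve. all: by end_near.
Qed.

End ChainRule.

(** * Operations on C^k functions and symmetry of second derivatives *)

Section SmoothFunctions.
Local Open Scope classical_set_scope.
Context {R : realType} {n : nat}.
Local Notation E := 'cV[R]_n.
Implicit Types (x y v : E) (f g : E -> R) (D : set E).

Lemma Ck_continuous k D f x : Ck k D f -> D x -> {for x, continuous f}.
Proof. by case: k => [|k] [h _]; exact: h. Qed.

Lemma CkS k D f : Ck k.+1 D f <->
  (forall x, D x -> {for x, continuous f}) /\
  forall a : 'I_n, (forall x, D x -> derivable f x (basis_vec a)) /\ Ck k D ('D_(basis_vec a) f).
Proof. by []. Qed.

Lemma CkW k D f : Ck k.+1 D f -> Ck k D f.
Proof.
elim: k f => [|k IH] f /CkS[h1 h2]; first by split.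
apply/CkS; split=> // a; have [h3 h4] := h2 a; split=> //; exact: IH.
Qed.

Lemma Ck_sub k D D' f : D' `<=` D -> Ck k D f -> Ck k D' f.
Proof.
move=> s; elim: k f => [|k IH] f; first by case=> h _; split=> // x /s; exact: h.
move=> /CkS[h1 h2]; apply/CkS; split=> [x /s|a]; first exact: h1.
by have [h3 h4] := h2 a; split=> [x /s|]; [exact: h3|exact: IH].
Qed.

Lemma open_near D x : open D -> D x -> \near x, D x.
Proof. by move=> oD Dx; exact: open_nbhs_nbhs. Qed.

Lemma near_eq_continuous f g x : (\near x, f x = g x) -> {for x, continuous f} -> {for x, continuous g}.
Proof.
move=> h c; rewrite /prop_for /continuous_at -(nbhs_singleton h).
exact: cvg_trans (near_eq_cvg h) c.
Qed.

Lemma Ck_congr k D f g : open D -> (forall x, D x -> f x = g x) -> Ck k D f -> Ck k D g.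
Proof.
move=> oD; elim: k f g => [|k IH] f g e.
  case=> h _; split=> // x Dx; apply: near_eq_continuous (h _ Dx).
  by near=> y; apply: e; near: y; exact: open_near.
move=> /CkS[h1 h2]; apply/CkS; split=> [x Dx|a].
  apply: near_eq_continuous (h1 _ Dx).
  by near=> y; apply: e; near: y; exact: open_near.
have [h3 h4] := h2 a; split=> [x Dx|].
  apply: near_eq_derivable (h3 _ Dx).
  by near=> y; apply: e; near: y; exact: open_near.
apply: IH h4 => x Dx; apply: near_eq_derive.
by near=> y; apply: e; near: y; exact: open_near.
Unshelve. all: by end_near.
Qed.

Lemma Ck_cst k D (c : R) : Ck k D (fun=> c).
Proof.
elim: k c => [|k IH] c; first by split=> // x _; exact: cst_continuous.
apply/CkS; split=> [x _|a]; first exact: cst_continuous.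
split=> [x _|]; first exact: derivable_cst.
have -> : 'D_(basis_vec a) (fun=> c : R) = fun=> 0 by apply/funext => x; exact: derive_cst.
exact: IH.
Qed.

Lemma Ck_derive k D f (df : 'I_n -> E -> R) : open D ->
  (forall x, D x -> {for x, continuous f}) ->
  (forall a x, D x -> is_derive x (basis_vec a) f (df a x)) ->
  (forall a, Ck k D (df a)) -> Ck k.+1 D f.
Proof.
move=> oD cf hd hC; apply/CkS; split=> // a; split=> [x Dx|].
  by have [] := hd a x Dx.
by apply: Ck_congr (hC a) => // x Dx; have [_] := hd a x Dx.
Qed.

Lemma Ck_is_derive k D f a x : Ck k.+1 D f -> D x ->
  is_derive x (basis_vec a) f ('D_(basis_vec a) f x).
Proof. by move=> /CkS[_ h] Dx; have [hd _] := h a; apply/derivableP/hd. Qed.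

Lemma Ck_partial k D f a : Ck k.+1 D f -> Ck k D ('D_(basis_vec a) f).
Proof. by move=> /CkS[_ h]; have [] := h a. Qed.

Lemma Ck_add k D f g : open D -> Ck k D f -> Ck k D g -> Ck k D (fun x => f x + g x).
Proof.
move=> oD; elim: k f g => [|k IH] f g hf hg.
  by split=> // x Dx; exact: (continuousD (Ck_continuous hf Dx) (Ck_continuous hg Dx)).
apply: (Ck_derive (df := fun a x => 'D_(basis_vec a) f x + 'D_(basis_vec a) g x)) => //.
- by move=> x Dx; exact: (continuousD (Ck_continuous hf Dx) (Ck_continuous hg Dx)).
- by move=> a x Dx; apply: is_derive_add; [exact: Ck_is_derive hf Dx|exact: Ck_is_derive hg Dx].
- by move=> a; apply: IH; exact: Ck_partial.
Qed.

Lemma Ck_mul k D f g : open D -> Ck k D f -> Ck k D g -> Ck k D (fun x => f x * g x).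
Proof.
move=> oD; elim: k f g => [|k IH] f g hf hg.
  by split=> // x Dx; exact: (continuousM (Ck_continuous hf Dx) (Ck_continuous hg Dx)).
apply: (Ck_derive (df := fun a x => 'D_(basis_vec a) f x * g x + f x * 'D_(basis_vec a) g x)) => //.
- by move=> x Dx; exact: (continuousM (Ck_continuous hf Dx) (Ck_continuous hg Dx)).
- by move=> a x Dx; apply: is_derive_mul; [exact: Ck_is_derive hf Dx|exact: Ck_is_derive hg Dx].
- move=> a; apply: Ck_add => //; apply: IH; do ?[exact: CkW]; exact: Ck_partial.
Qed.

Lemma Ck_sum (I : Type) (r : seq I) (P : pred I) k D (f : I -> E -> R) : open D ->
  (forall i, P i -> Ck k D (f i)) -> Ck k D (fun x => \sum_(i <- r | P i) f i x).
Proof.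
move=> oD h; elim: r => [|i r IH].
  rewrite (_ : (fun x => _) = fun=> 0); first exact: Ck_cst.
  by apply/funext => y; rewrite big_nil.
rewrite (_ : (fun x => _) = fun x => if P i then f i x + \sum_(j <- r | P j) f j x
    else \sum_(j <- r | P j) f j x); last by apply/funext => y; rewrite big_cons.
by case: (boolP (P i)) => // Pi; apply: Ck_add => //; exact: h.
Qed.

Lemma is_derive_exp (V : normedModType R) (f : V -> R) (x v : V) df : is_derive x v f df ->
  is_derive x v (fun y : V => expR (f y)) (expR (f x) * df).
Proof.
move=> /is_derive_line h; apply/is_derive_line.
have := is_derive1_comp (is_derive_expR (f (0 *: v + x))) h.
by rewrite scale0r add0r.
Qed.

Lemma Ck_exp k D f : open D -> Ck k D f -> Ck k D (fun x => expR (f x)).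
Proof.
have cE (f' : E -> R) x : {for x, continuous f'} -> {for x, continuous (fun y => expR (f' y))}.
  by move=> h; apply: continuous_comp => //; exact: continuous_expR.
move=> oD; elim: k f => [|k IH] f hf.
  by split=> // x Dx; apply: cE; exact: Ck_continuous hf Dx.
apply: (Ck_derive (df := fun a x => expR (f x) * 'D_(basis_vec a) f x)) => //.
- by move=> x Dx; apply: cE; exact: Ck_continuous hf Dx.
- by move=> a x Dx; apply: is_derive_exp; exact: Ck_is_derive hf Dx.
- by move=> a; apply: Ck_mul; [|apply: IH; exact: CkW|exact: Ck_partial].
Qed.

Lemma continuous_entries (T : topologicalType) (tau : T -> E) (x : T) :
  (forall a, {for x, continuous (fun y : T => tau y a 0)}) -> {for x, continuous tau}.
Proof.
move=> h; apply/cvg_ballP => e e0; near=> y; apply/ball_cV => //; near: y.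
apply: filter_forall => a; have /cvgrPdist_lt := h a.
exact.
Unshelve. all: by end_near.
Qed.

Lemma Ck_comp k D D' f (tau : E -> E) : open D -> open D' -> (forall x, D' x -> D (tau x)) ->
  Ck k D f -> (forall a, Ck k D' (fun x => tau x a 0)) -> Ck k D' (fun x => f (tau x)).
Proof.
move=> oD oD' hD; elim: k f => [|k IH] f hf ht.
  split=> // x Dx; apply: continuous_comp; last exact: Ck_continuous hf (hD _ Dx).
  by apply: continuous_entries => a; exact: Ck_continuous (ht a) Dx.
apply: (Ck_derive (df := fun a x => \sum_b 'D_(basis_vec a) (fun y => tau y b 0) x *
    'D_(basis_vec b) f (tau x))) => //.
- move=> x Dx; apply: continuous_comp; last exact: Ck_continuous hf (hD _ Dx).
  by apply: continuous_entries => a; exact: Ck_continuous (ht a) Dx.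
- move=> a x Dx; have f1 : Ck 1 D f by elim: (k) hf => // m IHm /CkW.
  have := @is_derive_chain R n E tau x (basis_vec a)
    (\col_b 'D_(basis_vec a) (fun y => tau y b 0) x) f D oD (hD _ Dx) f1.
  have -> : \sum_b 'D_(basis_vec a) (fun y => tau y b 0) x * 'D_(basis_vec b) f (tau x) =
    \sum_b (\col_b 'D_(basis_vec a) (fun y => tau y b 0) x) b 0 * 'D_(basis_vec b) f (tau x).
    by apply: eq_bigr => b _; rewrite mxE.
  move=> h; apply: h => b j; rewrite ord1 mxE; exact: Ck_is_derive (ht b) Dx.
- move=> a; apply: Ck_sum => // b _; apply: Ck_mul => //.
    exact: Ck_partial (ht b).
  exact: (IH _ (Ck_partial b hf) (fun c => CkW (ht c))).
Qed.

(** The second difference over a square of side h: the mean value theorem in direction a for f(. + h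
    e_b) - f, then in direction b for the partial derivative in direction a. *)
Lemma schwarz_box D f a b x r h : (forall y, ball x r y -> D y) -> Ck 2 D f ->
  0 < h -> h + h < r ->
  exists2 p, ball x r p &
    f (h *: basis_vec a + (h *: basis_vec b + x)) - f (h *: basis_vec a + x)
    - (f (h *: basis_vec b + x) - f x) = 'D_(basis_vec b) ('D_(basis_vec a) f) p * h * h.
Proof.
move=> hr fC h0 hhr; have r0 : 0 < r by apply: lt_trans hhr; rewrite addr_gt0.
have fC1 : Ck 1 D f by exact: CkW.
have inb c d (s t : R) : `|s| <= h -> `|t| <= h -> ball x r (s *: basis_vec c + (t *: basis_vec d + x)).
  move=> hs ht; apply/ball_cV => // i; rewrite !addrA mxE opprD addrCA subrr addr0 normrN.
  apply: le_lt_trans hhr; rewrite !mxE !eqxx !andbT; apply: le_trans (ler_normD _ _) _.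
  by apply: lerD; rewrite normrM; case: (_ == _); rewrite ?normr1 ?normr0 ?mulr1 ?mulr0 // ltW.
have inb1 c (s : R) : `|s| <= h -> ball x r (s *: basis_vec c + x).
  by move=> hs; have := inb c c s 0 hs; rewrite scale0r add0r normr0; apply; exact: ltW.
have hh : `|h| = h by rewrite ger0_norm // ltW.
pose phi (s : R) := f (s *: basis_vec a + (h *: basis_vec b + x)) - f (s *: basis_vec a + x).
have [s hs|c hc e1] := @mvt_symmetric R phi (fun s =>
   'D_(basis_vec a) f (s *: basis_vec a + (h *: basis_vec b + x)) -
   'D_(basis_vec a) f (s *: basis_vec a + x)) h.
  rewrite hh in hs.
  have D1 : is_derive s (1 : R) (fun t : R => f (t *: basis_vec a + (h *: basis_vec b + x)))
      ('D_(basis_vec a) f (s *: basis_vec a + (h *: basis_vec b + x))).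
    apply: is_derive_line_shift; apply: (Ck_is_derive a fC1); apply: hr.
    by apply: inb; rewrite ?hh.
  have D2 : is_derive s (1 : R) (fun t : R => f (t *: basis_vec a + x))
      ('D_(basis_vec a) f (s *: basis_vec a + x)).
    by apply: is_derive_line_shift; apply: (Ck_is_derive a fC1); apply: hr; exact: inb1.
  exact: is_derive_add D1 (is_derive_opp D2).
rewrite hh in hc.
have [t ht|d hd e2] := @mvt_symmetric R
    (fun t => 'D_(basis_vec a) f (t *: basis_vec b + (c *: basis_vec a + x)))
    (fun t => 'D_(basis_vec b) ('D_(basis_vec a) f) (t *: basis_vec b + (c *: basis_vec a + x))) h.
  rewrite hh in ht; apply: (is_derive_line_shift (f := 'D_(basis_vec a) f)); apply: (Ck_is_derive b (Ck_partial a fC)); apply: hr.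
  exact: inb.
rewrite hh in hd.
exists (d *: basis_vec b + (c *: basis_vec a + x)); first exact: inb.
rewrite -e2 scale0r add0r (addrCA (h *: basis_vec b)) -e1 /phi !scale0r !add0r.
by [].
Qed.

Lemma dist_half (A B C e : R) : `|A - C| <= e / 2 -> `|B - C| <= e / 2 -> `|A - B| <= e.
Proof.
by rewrite !ler_norml => /andP[? ?] /andP[? ?]; apply/andP; split; lra.
Qed.

(** The second difference is symmetric in a and b, so the two mixed derivatives agree at two points
    arbitrarily close to [x]; continuity concludes. *)
Lemma schwarz D f a b x : open D -> D x -> Ck 2 D f ->
  'D_(basis_vec a) ('D_(basis_vec b) f) x = 'D_(basis_vec b) ('D_(basis_vec a) f) x.
Proof.
move=> oD Dx fC; apply/eqP; rewrite -subr_eq0 -normr_le0; apply/ler_addgt0Pl => e e0.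
rewrite addr0; have e20 : 0 < e / 2 by rewrite divr_gt0.
have hc c d : \forall y \near x,
    `|'D_(basis_vec c) ('D_(basis_vec d) f) x - 'D_(basis_vec c) ('D_(basis_vec d) f) y| <= e / 2.
  by have /cvgrPdist_le/(_ _ e20) := Ck_continuous (Ck_partial c (Ck_partial d fC)) Dx.
have : \forall y \near x, [/\ D y,
    `|'D_(basis_vec a) ('D_(basis_vec b) f) x - 'D_(basis_vec a) ('D_(basis_vec b) f) y| <= e / 2 &
    `|'D_(basis_vec b) ('D_(basis_vec a) f) x - 'D_(basis_vec b) ('D_(basis_vec a) f) y| <= e / 2].
  by apply: filterS3 (open_near oD Dx) (hc a b) (hc b a) => y.
move=> /nbhs_ballP[r /= r0 hr].
have hrD y : ball x r y -> D y by move=> /hr[].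
pose h := r / 3.
have h0 : 0 < h by rewrite divr_gt0.
have hhr : h + h < r by rewrite /h; lra.
have [p /hr[_ _ hq] e1] := schwarz_box a b hrD fC h0 hhr.
have [q /hr[_ hp _] e2] := schwarz_box b a hrD fC h0 hhr.
have e3 : 'D_(basis_vec b) ('D_(basis_vec a) f) p = 'D_(basis_vec a) ('D_(basis_vec b) f) q.
  have m (P Q : R) : P * h * h = Q * h * h -> P = Q.
    by move=> /(mulIf (lt0r_neq0 h0))/(mulIf (lt0r_neq0 h0)).
  apply: m; apply: etrans (esym e1) (etrans _ e2).
  rewrite (addrCA (h *: basis_vec b)) {e1 e2}.
  move: (f (h *: basis_vec a + (h *: basis_vec b + x))) (f (h *: basis_vec a + x)).
  by move: (f (h *: basis_vec b + x)) (f x) => p1 p2 p3 p4; clear; lra.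
by rewrite e3 in hq; exact: dist_half hp hq.
Unshelve. all: by end_near.
Qed.

End SmoothFunctions.

(** * The Poincaré lemma for 1-forms on a ball *)

Section PoincareLemma.
Local Open Scope classical_set_scope.
Context {R : realType} {n : nat}.
Local Notation E := 'cV[R]_n.
Implicit Types (x y v : E) (f g : E -> R) (D : set E).

Lemma is_dmx_id m (x v : 'cV[R]_m) : is_dmx (fun y : 'cV[R]_m => y) x v v.
Proof.
move=> a b; apply/is_derive_line.
have := is_derive_add (is_derive_mul (is_derive_id (0 : R) (1 : R))
  (is_derive_const (v a b) (0 : R) (1 : R))) (is_derive_const (x a b) (0 : R) (1 : R)).
rewrite mul1r mulr0 !addr0; congr (is_derive _ _ _ _).
by apply/funext => s; rewrite !mxE.
Qed.

Lemma integral01_derive (F f : R -> R) :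
  (forall t : R, 0 <= t <= 1 -> is_derive t (1 : R) F (f t)) ->
  (forall t : R, 0 <= t <= 1 -> {for t, continuous f}) ->
  (\int[lebesgue_measure]_(t in `[0%R, 1%R]) f t = F 1 - F 0)%R.
Proof.
move=> hF cf.
have cF (t : R) : 0 <= t <= 1 -> {for t, continuous F}.
  by move=> ht; exact: is_derive1_continuous (hF t ht).
rewrite /Rintegral (@continuous_FTC2 R f F 0 1) ?ltr01 //.
- by apply: continuous_in_subspaceT => t; rewrite inE /= in_itv /=; exact: cf.
- split.
  + move=> t; rewrite in_itv /= => /andP[/ltW t0 /ltW t1].
    by have [|] := hF t; rewrite ?t0.
  + by apply: cvg_at_right_filter; apply: cF; rewrite lexx ler01.
  + by apply: cvg_at_left_filter; apply: cF; rewrite lexx ler01.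
- move=> t; rewrite in_itv /= => /andP[/ltW t0 /ltW t1].
  have ht : 0 <= t <= 1 by rewrite t0.
  by rewrite derive1E; have [_ ->] := hF t ht.
Qed.

Lemma integrable01 (f : R -> R) : (forall t : R, 0 <= t <= 1 -> {for t, continuous f}) ->
  lebesgue_measure.-integrable `[0%R, 1%R] (EFin \o f).
Proof.
move=> cf; apply: continuous_compact_integrable; first exact: segment_compact.
by apply: continuous_in_subspaceT => t; rewrite inE /= in_itv /=; exact: cf.
Qed.

Lemma derive_integral01 (f df : R -> R -> R) (d K : R) : 0 < d ->
  (forall s t : R, `|s| < d -> 0 <= t <= 1 -> is_derive s (1 : R) (f^~ t) (df s t)) ->
  (forall s t : R, `|s| < d -> 0 <= t <= 1 -> {for t, continuous (f s)}) ->
  (forall s t : R, `|s| < d -> 0 <= t <= 1 -> `|df s t| <= K) ->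
  is_derive (0 : R) (1 : R) (fun s => \int[lebesgue_measure]_(t in `[0%R, 1%R]) f s t)%R
    (\int[lebesgue_measure]_(t in `[0%R, 1%R]) df 0 t)%R.
Proof.
move=> d0 hd hc hK.
have mB : measurable (`[0%R, 1%R]%classic : set (measurableTypeR R)) by exact: measurable_itv.
have Ia : `]- d, d[ (0 : R) by rewrite /= in_itv /= oppr_lt0 d0.
have I1 (s : R) : `]- d, d[ s -> `|s| < d by rewrite /= in_itv /= ltr_norml.
have B1 (t : R) : `[0%R, 1%R] t -> 0 <= t <= 1 by rewrite /= in_itv.
have h1 s : `]- d, d[ s -> lebesgue_measure.-integrable `[0%R, 1%R] (EFin \o f s).
  by move=> /I1 hs; apply: integrable01 => t; exact: hc.
have h2 s t : `]- d, d[ s -> `[0%R, 1%R] t -> derivable (f^~ t) s 1.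
  by move=> /I1 hs /B1 ht; have [] := hd s t hs ht.
have p1 s t : `|s| < d -> 0 <= t <= 1 -> partial1of2 f s t = df s t.
  by move=> hs ht; rewrite partial1of2E; have [_ ->] := hd s t hs ht.
have h3 : lebesgue_measure.-integrable `[0%R, 1%R] (EFin \o (fun=> `|K|) : R -> \bar R).
  by apply: integrable01 => t _; exact: cst_continuous.
have h4 s t : `]- d, d[ s -> `[0%R, 1%R] t -> `|partial1of2 f s t| <= `|K|.
  move=> /I1 hs /B1 ht; rewrite p1 //; apply: le_trans (hK s t hs ht) _; exact: ler_norm.
have a1 := derivable_under_integral mB Ia h1 h2 (fun=> normr_ge0 K) h3 h4.
have a2 := differentiation_under_integral mB Ia h1 h2 (fun=> normr_ge0 K) h3 h4.
split; first exact: a1.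
rewrite -derive1E a2; apply: eq_Rintegral => t; rewrite inE => /B1 ht.
by rewrite p1 // normr0.
Qed.

(** The potential is the integral of η along the segment from x0 to x, which stays in the ball. Its
    partial derivatives are computed under the integral sign. *)
Lemma poincare D (eta : 'I_n -> E -> R) x0 : open D -> D x0 ->
  (forall a, smooth D (eta a)) ->
  (forall a b x, D x -> 'D_(basis_vec b) (eta a) x = 'D_(basis_vec a) (eta b) x) ->
  exists2 r, 0 < r & (ball x0 r `<=` D /\ exists2 phi, smooth (ball x0 r) phi &
    forall a x, ball x0 r x -> is_derive x (basis_vec a) phi (eta a x)).
Proof.
move=> oD Dx0 sm closed.
have near1 (f : E -> R) : {for x0, continuous f} -> \forall y \near x0, `|f y| <= `|f x0| + 1.
  move=> /(@cvgrPdist_le _ _ _ (nbhs x0))/(_ 1 ltr01) h; apply: filterS h => y hy.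
  rewrite -[f y](subrK (f x0)) addrC; apply: le_trans (ler_normD _ _) _.
  by rewrite lerD2l distrC.
(* The ball is shrunk until η and its first partial derivatives are bounded on it; the bounds
   dominate the differentiated integrand. *)
have n1 : \forall y \near x0, forall a, `|eta a y| <= `|eta a x0| + 1.
  apply: (filter_forall (F := nbhs x0) (f := fun a y => `|eta a y| <= `|eta a x0| + 1)) => a.
  exact: near1 (Ck_continuous (sm a 0) Dx0).
have n2 : \forall y \near x0, forall a b,
    `|'D_(basis_vec b) (eta a) y| <= `|'D_(basis_vec b) (eta a) x0| + 1.
  apply: (filter_forall (F := nbhs x0) (f := fun a y => forall b,
    `|'D_(basis_vec b) (eta a) y| <= `|'D_(basis_vec b) (eta a) x0| + 1)) => a.
  apply: (filter_forall (F := nbhs x0) (f := fun b y =>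
    `|'D_(basis_vec b) (eta a) y| <= `|'D_(basis_vec b) (eta a) x0| + 1)) => b.
  apply: (near1 ('D_(basis_vec b) (eta a))).
  exact: Ck_continuous (Ck_partial b (sm a 1)) Dx0.
have : \forall y \near x0, D y /\ ((forall a, `|eta a y| <= `|eta a x0| + 1) /\
   forall a b, `|'D_(basis_vec b) (eta a) y| <= `|'D_(basis_vec b) (eta a) x0| + 1).
  by apply: filterS3 (open_near oD Dx0) n1 n2 => y.
move=> /nbhs_ballP[r /= r0 hr]; exists r => //.
have hD y : ball x0 r y -> D y by move=> /hr[].
split=> //.
pose p x t : E := t *: (x - x0) + x0.
pose h x t := \sum_a (x a 0 - x0 a 0) * eta a (p x t).
pose phi x := (\int[lebesgue_measure]_(t in `[0%R, 1%R]) h x t)%R.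
have pb x (t : R) : ball x0 r x -> 0 <= t <= 1 -> ball x0 r (p x t).
  move=> /(ball_cV _ _ r0) hx /andP[t0 t1]; apply/ball_cV => // i; rewrite !mxE opprD addrCA.
  rewrite subrr addr0 normrN normrM ger0_norm //; apply: le_lt_trans (hx i).
  by rewrite -[leRHS]mul1r distrC; apply: ler_wpM2r.
have eC1 a : Ck 1 D (eta a) by exact: sm.
have dpt x (t : R) : is_dmx (p x) t (1 : R) (x - x0).
  apply: (is_dmx_eq (dF := (1 : R) *: (x - x0) + t *: 0 + 0)).
    apply: is_dmxD; last exact: is_dmx_cst.
    exact: (is_dmxZ (is_derive_id t (1 : R)) (is_dmx_cst (x - x0) t (1 : R))).
  by rewrite scale1r scaler0 !addr0.
have dpx b x (t : R) : is_dmx (fun y => p y t) x (basis_vec b) (t *: basis_vec b).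
  apply: (is_dmx_eq (dF := 0 *: (x - x0) + t *: (basis_vec b - 0) + 0)); last first.
    by rewrite scale0r subr0 add0r addr0.
  apply: is_dmxD; last exact: is_dmx_cst.
  apply: (is_dmxZ (is_derive_const t x (basis_vec b))).
  exact: (is_dmxB (is_dmx_id x (basis_vec b)) (is_dmx_cst x0 x (basis_vec b))).
have deta x (t : R) a : ball x0 r x -> 0 <= t <= 1 -> is_derive t (1 : R) (fun t => eta a (p x t))
    (\sum_c (x - x0) c 0 * 'D_(basis_vec c) (eta a) (p x t)).
  move=> hx ht; exact: (@is_derive_chain R n R (p x) t 1 _ (eta a) D oD
    (hD _ (pb _ _ hx ht)) (eC1 a) (dpt x t)).
have detax b x (t : R) a : ball x0 r x -> 0 <= t <= 1 -> is_derive x (basis_vec b) (fun y => eta a (p y t))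
    (t * 'D_(basis_vec b) (eta a) (p x t)).
  move=> hx ht; have := @is_derive_chain R n E (p^~ t) x (basis_vec b) _ (eta a) D oD
    (hD _ (pb _ _ hx ht)) (eC1 a) (dpx b x t).
  congr (is_derive _ _ _ _); rewrite (bigD1 b) //= big1 => [|c cb].
    by rewrite !mxE !eqxx mulr1 addr0.
  by rewrite !mxE (negbTE cb) mulr0 mul0r.
pose dh b x t := eta b (p x t) + \sum_a (x a 0 - x0 a 0) * (t * 'D_(basis_vec b) (eta a) (p x t)).
have hdh b x (t : R) : ball x0 r x -> 0 <= t <= 1 -> is_derive x (basis_vec b) (h^~ t) (dh b x t).
  move=> hx ht; have := is_derive_bigsum (index_enum 'I_n) (P := xpredT) (fun a _ =>
    is_derive_mul (is_derive_add (is_dmx_id x (basis_vec b) a 0)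
      (is_derive_opp (is_derive_const (x0 a 0) x (basis_vec b)))) (detax b x t a hx ht)).
  congr (is_derive _ _ _ _); rewrite /dh big_split /=; congr (_ + _).
  rewrite (bigD1 b) //= big1 => [|c cb]; first by rewrite !mxE !eqxx subr0 mul1r addr0.
  by rewrite !mxE (negbTE cb) subr0 mul0r.
have cdh b x (t : R) : ball x0 r x -> 0 <= t <= 1 -> {for t, continuous (dh b x)}.
  move=> hx ht; have hDp := hD _ (pb _ _ hx ht).
  have cD a : is_derive t (1 : R) (fun t => 'D_(basis_vec b) (eta a) (p x t))
      (\sum_c (x - x0) c 0 * 'D_(basis_vec c) ('D_(basis_vec b) (eta a)) (p x t)).
    exact: (@is_derive_chain R n R (p x) t 1 _ _ D oD hDp (Ck_partial b (sm a 2)) (dpt x t)).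
  have e a := is_derive_mul (is_derive_const (x a 0 - x0 a 0) t (1 : R))
    (is_derive_mul (is_derive_id t (1 : R)) (cD a)).
  have e' := is_derive_bigsum (index_enum 'I_n) (P := xpredT) (fun a _ => e a).
  exact: is_derive1_continuous (is_derive_add (deta x t b hx ht) e').
have ch x (t : R) : ball x0 r x -> 0 <= t <= 1 -> {for t, continuous (h x)}.
  move=> hx ht; have e a := is_derive_mul (is_derive_const (x a 0 - x0 a 0) t (1 : R)) (deta x t a hx ht).
  exact: is_derive1_continuous (is_derive_bigsum (index_enum 'I_n) (P := xpredT) (fun a _ => e a)).
have idh b x : ball x0 r x -> (\int[lebesgue_measure]_(t in `[0%R, 1%R]) dh b x t)%R = eta b x.
  move=> hx.
  (* Here closedness enters: it turns the derivative of the integrand in direction b into the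
     t-derivative of t η_b along the segment, whose integral is η_b(x). *)
  have i1 (t : R) : 0 <= t <= 1 -> is_derive t (1 : R) (fun t => t * eta b (p x t)) (dh b x t).
    move=> ht; have := is_derive_mul (is_derive_id t (1 : R)) (deta x t b hx ht).
    congr (is_derive _ _ _ _); rewrite /dh mul1r; congr (_ + _).
    rewrite mulr_sumr; apply: eq_bigr => c _; rewrite mulrCA; congr (_ * (_ * _)).
      by rewrite !mxE.
    exact: (closed b c _ (hD _ (pb _ _ hx ht))).
  rewrite (integral01_derive i1 (fun t ht => cdh b x t hx ht)).
  by rewrite mul1r mul0r subr0 /p scale1r subrK.
pose K b := `|eta b x0| + 1 + \sum_a r * (`|'D_(basis_vec b) (eta a) x0| + 1).
have bdh b x (t : R) : ball x0 r x -> 0 <= t <= 1 -> `|dh b x t| <= K b.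
  move=> hx ht; have [_ [k1 k2]] := hr _ (pb _ _ hx ht).
  apply: le_trans (ler_normD _ _) _; apply: lerD => //.
  apply: le_trans (ler_norm_sum _ _ _) _; apply: ler_sum => a _; rewrite normrM.
  apply: ler_pM => //.
    by have /(_ a)/ltW := (ball_cV _ _ r0).1 hx; rewrite distrC.
  rewrite normrM; have /andP[t0 t1] := ht; rewrite ger0_norm //.
  by apply: le_trans (k2 a b); rewrite -[leRHS]mul1r; apply: ler_wpM2r.
have dphi b x : ball x0 r x -> is_derive x (basis_vec b) phi (eta b x).
  move=> hx; apply/is_derive_line.
  pose d := r - `|x0 b 0 - x b 0|.
  have d0 : 0 < d by rewrite subr_gt0; exact: (ball_cV _ _ r0).1.
  have xb (s : R) : `|s| < d -> ball x0 r (s *: basis_vec b + x).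
    move=> hs; apply/ball_cV => // i; rewrite !mxE eqxx andbT.
    case: (eqVneq i b) => [->|ib] /=; last by rewrite mulr0 add0r; exact: (ball_cV _ _ r0).1.
    rewrite mulr1 opprD addrCA addrC; apply: le_lt_trans (ler_normB _ _) _.
    by rewrite -ltrBrDl.
  rewrite -(idh b x hx).
  have := @derive_integral01 (fun s t => h (s *: basis_vec b + x) t)
    (fun s t => dh b (s *: basis_vec b + x) t) d (K b) d0.
  rewrite scale0r add0r; apply.
  - move=> s t hs ht; apply: (is_derive_line_shift (f := h^~ t)); exact: hdh (xb _ hs) ht.
  - by move=> s t hs ht; exact: ch (xb _ hs) ht.
  - by move=> s t hs ht; exact: bdh (xb _ hs) ht.
have oB : open (ball x0 r) by exact: ball_open.
have sB a k : Ck k (ball x0 r) (eta a) by apply: Ck_sub (sm a k) => y; exact: hD.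
have cphi x : ball x0 r x -> {for x, continuous phi}.
  move=> hx; apply: (partials_continuous oB hx) => [a y hy|a].
    by have [] := dphi a y hy.
  apply: near_eq_continuous (Ck_continuous (sB a 0) hx).
  apply: filterS (open_near oB hx) => y hy.
  by have [_ ->] := dphi a y hy.
exists phi => // -[|k]; first by split.
exact: Ck_derive oB cphi dphi (fun a => sB a k).
Qed.

End PoincareLemma.

(** * Smooth matrix-valued maps *)

Section SmoothMatrices.
Local Open Scope classical_set_scope.
Context {R : realType} {n : nat}.
Local Notation E := 'cV[R]_n.
Implicit Types (x v : E) (f : E -> R) (D : set E).

Lemma smooth_is_derive D f x v : open D -> D x -> smooth D f ->
  is_derive x v f (\sum_a v a 0 * 'D_(basis_vec a) f x).
Proof.
by move=> oD Dx sf; exact: (@is_derive_chain R n E (fun y => y) x v v f D oD Dx (sf 1) (is_dmx_id x v)).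
Qed.

Lemma smoothN D f : open D -> smooth D f -> smooth D (fun x => - f x).
Proof.
move=> oD sf k; apply: Ck_congr (Ck_mul oD (Ck_cst k D (-1)) (sf k)) => // x _.
by rewrite mulN1r.
Qed.

Lemma smooth_exp D f : open D -> smooth D f -> smooth D (fun x => expR (f x)).
Proof. by move=> oD sf k; exact: Ck_exp. Qed.

Lemma smooth_mx_is_dmx p q D (F : E -> 'M[R]_(p, q)) x v : open D -> D x -> smooth_mx D F ->
  is_dmx F x v (deriv_mx F x v).
Proof.
move=> oD Dx sF a b; rewrite mxE.
by have [h _] := smooth_is_derive v oD Dx (sF a b); exact/derivableP.
Qed.

Lemma is_dmx_deriv_mx p q (F : E -> 'M[R]_(p, q)) x v dF : is_dmx F x v dF -> deriv_mx F x v = dF.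
Proof. by move=> h; apply/matrixP => a b; rewrite mxE; have [_ ->] := h a b. Qed.

Lemma deriv_mx_sum p q D (F : E -> 'M[R]_(p, q)) x v : open D -> D x -> smooth_mx D F ->
  deriv_mx F x v = \sum_a v a 0 *: deriv_mx F x (basis_vec a).
Proof.
move=> oD Dx sF; apply/matrixP => i j; rewrite mxE summxE.
have [_ ->] := smooth_is_derive v oD Dx (sF i j).
by apply: eq_bigr => a _; rewrite !mxE.
Qed.

Lemma deriv_mx_linear p q D (F : E -> 'M[R]_(p, q)) x : open D -> D x -> smooth_mx D F ->
  linear (deriv_mx F x).
Proof.
move=> oD Dx sF k u v; rewrite !(deriv_mx_sum _ oD Dx sF) scaler_sumr -big_split.
by apply: eq_bigr => a _; rewrite !mxE scalerDl scalerA.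
Qed.

Lemma smooth_mx_sub p q D D' (F : E -> 'M[R]_(p, q)) : D' `<=` D -> smooth_mx D F -> smooth_mx D' F.
Proof. by move=> s sF a b k; exact: Ck_sub (sF a b k). Qed.

Lemma smooth_mx_congr p q D (F G : E -> 'M[R]_(p, q)) : open D -> (forall x, D x -> F x = G x) ->
  smooth_mx D F -> smooth_mx D G.
Proof. by move=> oD e sF a b k; apply: Ck_congr (sF a b k) => // x Dx; rewrite e. Qed.

Lemma smooth_mx_cst p q D (C : 'M[R]_(p, q)) : smooth_mx D (fun=> C).
Proof. by move=> a b k; exact: Ck_cst. Qed.

Lemma smooth_mxD p q D (F G : E -> 'M[R]_(p, q)) : open D -> smooth_mx D F -> smooth_mx D G ->
  smooth_mx D (fun x => F x + G x).
Proof.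
move=> oD sF sG a b k; under [X in Ck _ _ X]eq_fun do rewrite mxE; exact: (Ck_add oD (sF a b k) (sG a b k)).
Qed.

Lemma smooth_mxM p q r D (F : E -> 'M[R]_(p, q)) (G : E -> 'M[R]_(q, r)) : open D ->
  smooth_mx D F -> smooth_mx D G -> smooth_mx D (fun x => F x *m G x).
Proof.
move=> oD sF sG a b k; under [X in Ck _ _ X]eq_fun do rewrite mxE.
by apply: Ck_sum => // c _; exact: (Ck_mul oD (sF a c k) (sG c b k)).
Qed.

Lemma smooth_mxZ p q D f (F : E -> 'M[R]_(p, q)) : open D ->
  smooth D f -> smooth_mx D F -> smooth_mx D (fun x => f x *: F x).
Proof.
move=> oD sf sF a b k; under [X in Ck _ _ X]eq_fun do rewrite mxE; exact: (Ck_mul oD (sf k) (sF a b k)).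
Qed.

Lemma smooth_mx_tr p q D (F : E -> 'M[R]_(p, q)) : smooth_mx D F -> smooth_mx D (fun x => (F x)^T).
Proof. by move=> sF a b k; under [X in Ck _ _ X]eq_fun do rewrite mxE; exact: (sF b a k). Qed.

Lemma smooth_mx_sum p q (I : Type) (r : seq I) (P : pred I) D (F : I -> E -> 'M[R]_(p, q)) :
  open D -> (forall i, P i -> smooth_mx D (F i)) -> smooth_mx D (fun x => \sum_(i <- r | P i) F i x).
Proof.
move=> oD h a b k; under [X in Ck _ _ X]eq_fun do rewrite summxE.
by apply: Ck_sum => // i Pi; exact: (h i Pi a b k).
Qed.

Lemma smooth_partial D f a : smooth D f -> smooth D ('D_(basis_vec a) f).
Proof. by move=> sf k; exact: Ck_partial (sf k.+1). Qed.

Lemma smooth_mx_deriv p q D (F : E -> 'M[R]_(p, q)) a : smooth_mx D F ->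
  smooth_mx D (fun x => deriv_mx F x (basis_vec a)).
Proof.
by move=> sF i j k; under [X in Ck _ _ X]eq_fun do rewrite mxE; exact: (smooth_partial a (sF i j) k).
Qed.

Lemma deriv_mx_schwarz p q D (F : E -> 'M[R]_(p, q)) a b x : open D -> D x -> smooth_mx D F ->
  deriv_mx (fun y => deriv_mx F y (basis_vec a)) x (basis_vec b) =
  deriv_mx (fun y => deriv_mx F y (basis_vec b)) x (basis_vec a).
Proof.
move=> oD Dx sF.
have e c i j : (fun y => (deriv_mx F y (basis_vec c)) i j) = 'D_(basis_vec c) (fun y => F y i j).
  by apply/funext => y; rewrite mxE.
have h c d i j : (deriv_mx (fun y => deriv_mx F y (basis_vec c)) x (basis_vec d)) i j =
    'D_(basis_vec d) ('D_(basis_vec c) (fun y => F y i j)) x.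
  by rewrite mxE; exact: (congr1 (fun f => 'D_(basis_vec d) f x) (e c i j)).
apply/matrixP => i j.
exact: (etrans (h a b i j) (etrans (schwarz b a oD Dx (sF i j 2)) (esym (h b a i j)))).
Qed.

End SmoothMatrices.

(** * The Levi-Civita connection and conformal changes *)

Section LeviCivita.
Local Open Scope classical_set_scope.
Context {R : realType} {n : nat}.
Local Notation E := 'cV[R]_n.
Implicit Types (x u v w : E) (D : set E) (g : E -> 'M[R]_n).

Lemma levi_civita_linear g x : linear (levi_civita g x).
Proof.
move=> k u v; apply/matrixP => i j; rewrite !mxE mulr_sumr -big_split /=.
by apply: eq_bigr => a _; rewrite !mxE; ring.
Qed.

Lemma christoffel_sym D g x k a b : open D -> D x -> (forall y, D y -> (g y)^T = g y) ->
  christoffel g x k a b = christoffel g x k b a.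
Proof.
move=> oD Dx gT; rewrite /christoffel; congr (_ * _); apply: eq_bigr => l _; congr (_ * _).
have e : 'D_(basis_vec l) (fun y => g y a b) x = 'D_(basis_vec l) (fun y => g y b a) x.
  apply: near_eq_derive; apply: filterS (open_near oD Dx) => y Dy.
  by rewrite -{1}(gT y Dy) mxE.
by rewrite e; congr (_ - _); rewrite addrC.
Qed.

Lemma levi_civita_torsion_free D g x u v : open D -> D x -> (forall y, D y -> (g y)^T = g y) ->
  levi_civita g x v *m u = levi_civita g x u *m v.
Proof.
move=> oD Dx gT; apply/colP => k; rewrite !mxE.
under eq_bigr do rewrite mxE mulr_suml; rewrite exchange_big.
apply: eq_bigr => a _; rewrite mxE mulr_suml; apply: eq_bigr => b _.
by rewrite (christoffel_sym k a b oD Dx gT); ring.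
Qed.

Lemma levi_civita_metric D g x v : open D -> D x -> (forall y, D y -> (g y)^T = g y) ->
  smooth_mx D g -> g x \in unitmx ->
  deriv_mx g x v = (levi_civita g x v)^T *m g x + g x *m levi_civita g x v.
Proof.
move=> oD Dx gT sg gU.
pose d a b l := 'D_(basis_vec a) (fun y => g y b l) x.
have dC a b l : d a b l = d a l b.
  apply: near_eq_derive; apply: filterS (open_near oD Dx) => y Dy.
  by rewrite -{1}(gT y Dy) mxE.
(* The Christoffel symbols of the first kind contracted with [v]; adding the transpose cancels two
   of the three terms and leaves the derivative of the metric. *)
pose L : 'M[R]_n := \matrix_(l, b) \sum_a v a 0 * (2^-1 * (d a b l + d b a l - d l a b)).
have e : levi_civita g x v = invmx (g x) *m L.
  apply/matrixP => k b; rewrite !mxE; under [RHS]eq_bigr do rewrite mxE mulr_sumr.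
  rewrite exchange_big; apply: eq_bigr => a _; rewrite /christoffel !mulr_sumr.
  by apply: eq_bigr => l _; rewrite -/(d _ _ _) -/(d _ _ _) -/(d _ _ _); ring.
have eG : g x *m levi_civita g x v = L by rewrite e mulmxA mulmxV // mul1mx.
have -> : (levi_civita g x v)^T *m g x = L^T by rewrite -eG trmx_mul gT.
rewrite eG (deriv_mx_sum _ oD Dx sg); apply/matrixP => b l; rewrite summxE !mxE -big_split /=.
apply: eq_bigr => a _; rewrite !mxE -/(d a b l) (dC a l b).
by rewrite /=; field.
Qed.

(* A trilinear form that is symmetric in its first two arguments and skew in its
   last two vanishes. *)
Lemma metric_connection_unique (G : 'M[R]_n) (S : E -> 'M[R]_n) : G \in unitmx -> G^T = G ->
  (forall u v, S v *m u = S u *m v) ->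
  (forall v, (S v)^T *m G + G *m S v = 0) -> forall v, S v = 0.
Proof.
move=> gU GT hs hm v.
pose b v u w := (w^T *m (G *m (S v *m u))) 0 0.
have b1 p q r : b p q r = b q p r by rewrite /b hs.
have b2 p q r : b p q r = - b p r q.
  rewrite /b; have -> : (r^T *m (G *m (S p *m q))) 0 0 = (r^T *m (G *m (S p *m q)))^T 0 0.
    by rewrite [RHS]mxE.
  have /eqP := hm p; rewrite addr_eq0 => /eqP h.
  rewrite !trmx_mul trmxK GT -!mulmxA (mulmxA (S p)^T) h mulNmx mulmxN -mulmxA.
  by rewrite [LHS]mxE.
have b0 p q r : b p q r = 0.
  have := b1 p q r; have := b2 q p r; have := b1 q r p; have := b2 r q p.
  have := b1 r p q; have := b2 p r q; lra.
have GS : G *m S v = 0.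
  apply/matrixP => i j; rewrite mxE.
  have := b0 v (delta_mx j 0) (delta_mx i 0).
  by rewrite /b (mulmxA G) -colE trmx_delta -rowE !mxE.
by rewrite -[S v]mul1mx -(mulVmx gU) -mulmxA GS mulmx0.
Qed.

(** Pointwise uniqueness of the torsion-free metric connection. Both the conformal change and the
    change of charts are obtained from it, without computing with Christoffel symbols. *)
Lemma levi_civita_unique D g x (Gam : E -> 'M[R]_n) : open D -> D x ->
  (forall y, D y -> (g y)^T = g y) -> smooth_mx D g -> g x \in unitmx ->
  (forall u v, Gam v *m u = Gam u *m v) ->
  (forall v, deriv_mx g x v = (Gam v)^T *m g x + g x *m Gam v) ->
  forall v, levi_civita g x v = Gam v.
Proof.
move=> oD Dx gT sg gU hs hm v; apply/eqP; rewrite -subr_eq0; apply/eqP.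
pose S v := levi_civita g x v - Gam v.
apply: (metric_connection_unique (S := S) gU (gT x Dx)) => [u w|w].
  by rewrite !mulmxBl hs (levi_civita_torsion_free u w oD Dx gT).
rewrite linearB /= mulmxBl mulmxBr addrACA -opprD -hm.
by rewrite -(levi_civita_metric w oD Dx gT sg gU) subrr.
Qed.

(* The endomorphism-valued 1-form by which a conformal change g = e^f g' with
   df = eta modifies the Levi-Civita connection. *)
Definition conformal_term (G : 'M[R]_n) (eta : 'rV[R]_n) (v : E) : 'M[R]_n :=
  2^-1 *: ((eta *m v) 0 0 *: 1%:M + v *m eta - invmx G *m eta^T *m (v^T *m G)).

Lemma mul_mx_scalar1 p (u : 'cV[R]_p) (A : 'M[R]_1) : u *m A = A 0 0 *: u.
Proof. by rewrite {1}(mx11_scalar A) mul_mx_scalar. Qed.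

Lemma trmx11 (A : 'M[R]_1) : A^T 0 0 = A 0 0. Proof. by rewrite mxE. Qed.

Lemma conformal_term_sym G eta u v : G^T = G ->
  conformal_term G eta v *m u = conformal_term G eta u *m v.
Proof.
move=> GT; rewrite /conformal_term -!scalemxAl; congr (_ *: _).
rewrite !mulmxBl !mulmxDl -!scalemxAl !mul1mx -!mulmxA.
have -> : v^T *m (G *m u) = u^T *m (G *m v).
  by apply/matrixP => i j; rewrite !ord1 -trmx11 !trmx_mul trmxK GT mulmxA.
by rewrite !(mul_mx_scalar1 _ (eta *m _)) [_ *: u + _]addrC.
Qed.

Lemma conformal_term_metric G eta v : G \in unitmx -> G^T = G ->
  (conformal_term G eta v)^T *m G + G *m conformal_term G eta v = (eta *m v) 0 0 *: G.
Proof.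
move=> gU GT; rewrite /conformal_term linearZ /= -scalemxAl -scalemxAr -scalerDr.
rewrite linearB /= [(_ + _)^T]linearD /= [(_ *: _)^T]linearZ /= trmx1 !trmx_mul !trmxK trmx_inv GT.
rewrite mulmxBl !mulmxDl mulmxBr !mulmxDr -!scalemxAl -!scalemxAr mul1mx mulmx1.
rewrite -!mulmxA (mulmxA G (invmx G)) mulmxV // mulVmx // mul1mx mulmx1.
by apply/matrixP => i j; rewrite !mxE; field.
Qed.

End LeviCivita.

Lemma is_dmx_congr (R : realType) n p q (D : set 'cV[R]_n) (F G : 'cV[R]_n -> 'M[R]_(p, q)) x v dF :
  open D -> D x -> (forall y, D y -> F y = G y) -> is_dmx F x v dF -> is_dmx G x v dF.
Proof.
move=> oD Dx e; apply: near_eq_is_dmx.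
by apply: filterS (open_near oD Dx) => y; exact: e.
Qed.

Lemma unitmx_expRZ (R : realType) n (k : R) (A : 'M[R]_n) : (expR k *: A \in unitmx) = (A \in unitmx).
Proof. by rewrite unitmxZ // unitfE gt_eqF // expR_gt0. Qed.

(** * Connection forms in orthonormal frames *)

Section OrthonormalFrames.
Local Open Scope classical_set_scope.
Context {R : realType}.
Local Notation E := 'cV[R]_16.
Implicit Types (x u v : E) (D : set E) (g F : E -> 'M[R]_16) (A B G : 'M[R]_16).

(** Inverses of frames and metrics become polynomial in the frame and the metric, so their
    smoothness comes for free. *)
Lemma orthonormal_inv G A : A^T *m G *m A = 1%:M ->
  [/\ A \in unitmx, invmx A = A^T *m G, G \in unitmx & invmx G = A *m A^T].
Proof.
move=> h; have [_ uA] := mulmx1_unit h.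
have iA : invmx A = A^T *m G by rewrite -[LHS]mul1mx -h -(mulmxA _ A) mulmxV // mulmx1.
have h2 : A *m (A^T *m G) = 1%:M by rewrite -iA mulmxV.
have h3 : G *m (A *m A^T) = 1%:M by apply: mulmx1C; rewrite -mulmxA.
have [uG _] := mulmx1_unit h3.
by split=> //; rewrite -[LHS]mulmx1 -h3 (mulmxA (invmx G)) mulVmx // mul1mx.
Qed.

(** Differentiate F^T g F = 1 and insert the compatibility of the connection with the metric. *)
Lemma connection_form_skew D g F x v : open D -> D x ->
  (forall y, D y -> (g y)^T = g y) -> smooth_mx D g -> smooth_mx D F ->
  (forall y, D y -> (F y)^T *m g y *m F y = 1%:M) ->
  (connection_form g F x v)^T = - connection_form g F x v.
Proof.
move=> oD Dx gT sg sF hF; have [uF iF uG _] := orthonormal_inv (hF x Dx).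
have dF := smooth_mx_is_dmx v oD Dx sF; have dg := smooth_mx_is_dmx v oD Dx sg.
have := is_dmxM (is_dmxM (is_dmx_tr dF) dg) dF.
move=> /(is_dmx_congr oD Dx hF) h; have {h} h0 := is_dmx_unique h (is_dmx_cst 1%:M x v).
have e : connection_form g F x v = (F x)^T *m g x *m deriv_mx F x v +
    (F x)^T *m g x *m levi_civita g x v *m F x.
  by rewrite /connection_form iF mulmxDr !mulmxA.
have eT : (connection_form g F x v)^T = (deriv_mx F x v)^T *m g x *m F x +
    (F x)^T *m (levi_civita g x v)^T *m g x *m F x.
  by rewrite e [LHS]linearD /= !trmx_mul !trmxK (gT x Dx) !mulmxA.
apply/eqP; rewrite -addr_eq0 eT e -[X in _ == X]h0 (levi_civita_metric v oD Dx gT sg uG).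
rewrite !mulmxDl mulmxDr !mulmxDl !mulmxA; apply/eqP.
move: (_ *m deriv_mx F x v) (_ *m levi_civita g x v *m F x) => p q.
move: (_ *m g x *m F x) (_ *m g x *m F x) => r s.
by apply/matrixP => i j; rewrite !mxE; ring.
Qed.

Lemma conformal_levi_civita D g g' (f : E -> R) x v : open D -> D x ->
  smooth_mx D g -> (forall y, D y -> (g y)^T = g y) ->
  smooth_mx D g' -> (forall y, D y -> (g' y)^T = g' y) -> g' x \in unitmx ->
  smooth D f -> (forall y, D y -> g y = expR (f y) *: g' y) ->
  levi_civita g x v = levi_civita g' x v +
    conformal_term (g x) (\row_a 'D_(basis_vec a) f x) v.
Proof.
move=> oD Dx sg gT sg' gT' uG' sf e.
have uG : g x \in unitmx.
  by rewrite e // unitmx_expRZ.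
have df w : is_derive x w f ((\row_a 'D_(basis_vec a) f x *m w) 0 0).
  rewrite mxE; under eq_bigr do rewrite mxE mulrC.
  exact: (smooth_is_derive w oD Dx sf).
apply: (levi_civita_unique (g := g) (D := D)
  (Gam := fun v => levi_civita g' x v + conformal_term (g x) (\row_a 'D_(basis_vec a) f x) v)) => //.
- move=> u w; rewrite !mulmxDl (levi_civita_torsion_free u w oD Dx gT').
  by rewrite (conformal_term_sym _ u w (gT x Dx)).
- move=> w; rewrite linearD /= mulmxDl mulmxDr addrACA conformal_term_metric ?gT //.
  have h := is_dmxZ (is_derive_exp (df w)) (smooth_mx_is_dmx w oD Dx sg').
  have {}h := is_dmx_congr oD Dx (fun y Dy => esym (e y Dy)) h.
  rewrite (is_dmx_deriv_mx h) (levi_civita_metric w oD Dx gT' sg' uG') (e x Dx).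
  rewrite -!scalemxAr -!scalemxAl scalerDr scalerA [RHS]addrC mulrC.
  by congr (_ *: _ + _); rewrite scalerDr.
Qed.

(** In an orthonormal frame of g the conformal term splits into a multiple of 1 and the wedge with
    the frame components of η, the two pieces that the theorem compares. *)
Lemma conformal_term_frame G A (eta : 'rV[R]_16) u : A^T *m G *m A = 1%:M ->
  invmx A *m conformal_term G eta (A *m u) *m A =
    2^-1 *: ((eta *m (A *m u)) 0 0 *: 1%:M + wedge u (A^T *m eta^T)).
Proof.
move=> h; have [uA iA uG iG] := orthonormal_inv h.
rewrite /conformal_term -scalemxAr -scalemxAl; congr (_ *: _).
rewrite mulmxBr mulmxBl mulmxDr mulmxDl -scalemxAr -scalemxAl mulmx1 mulVmx // -addrA.
congr (_ + (_ - _)).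
  by rewrite !mulmxA mulVmx // mul1mx trmx_mul !trmxK -mulmxA.
rewrite iG trmx_mul -!mulmxA (mulmxA (invmx A) A) mulVmx // mul1mx.
by rewrite (mulmxA A^T G A) h mulmx1.
Qed.

Lemma connection_form_conformal D g g' (f : E -> R) F x u : open D -> D x ->
  smooth_mx D g -> (forall y, D y -> (g y)^T = g y) ->
  smooth_mx D g' -> (forall y, D y -> (g' y)^T = g' y) -> g' x \in unitmx ->
  smooth D f -> (forall y, D y -> g y = expR (f y) *: g' y) ->
  (F x)^T *m g x *m F x = 1%:M ->
  let eta := \row_a 'D_(basis_vec a) f x in
  connection_form g F x (F x *m u) = connection_form g' F x (F x *m u) +
    2^-1 *: ((eta *m (F x *m u)) 0 0 *: 1%:M + wedge u ((F x)^T *m eta^T)).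
Proof.
move=> oD Dx sg gT sg' gT' uG' sf e hF eta.
rewrite -(conformal_term_frame _ _ hF) /connection_form.
rewrite (conformal_levi_civita (F x *m u) oD Dx sg gT sg' gT' uG' sf e) -/eta.
by rewrite mulmxDl addrA mulmxDr mulmxA.
Qed.

End OrthonormalFrames.

Lemma skew_sub (R : pzRingType) n (X Y : 'M[R]_n) : X^T = - X -> Y^T = - Y -> (X - Y)^T = - (X - Y).
Proof. by move=> hX hY; rewrite [LHS]linearB /= hX hY opprB opprK addrC. Qed.

(** The covariant derivative of a section A Y A^-1 of End(TM) is A (dY + [ω, Y]) A^-1, where ω =
    A^-1 (dA + Γ A) is the connection form. *)
Lemma frame_commutator (R : realType) (A N dA dN Gam Y dY : 'M[R]_16) :
  N *m A = 1%:M -> A *m N = 1%:M -> dN = - (N *m dA *m N) ->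
  dA *m Y *m N + A *m dY *m N + A *m Y *m dN + Gam *m (A *m Y *m N) - A *m Y *m N *m Gam
    = A *m (dY + ad (N *m (dA + Gam *m A)) Y) *m N.
Proof.
move=> NA AN ->; have k q (Z : 'M[R]_(16, q)) : A *m (N *m Z) = Z by rewrite mulmxA AN mul1mx.
rewrite /ad -!mulmxE !(mulmxBr, mulmxBl, mulmxDr, mulmxDl, mulmxN, mulNmx).
rewrite -!mulmxA !k AN !mulmx1.
move: (dA *m (Y *m N)) (A *m (dY *m N)) (A *m (Y *m (N *m (dA *m N)))).
move: (Gam *m (A *m (Y *m N))) (A *m (Y *m (N *m Gam))) => p q r s t.
by apply/matrixP => i j; rewrite !mxE; ring.
Qed.

Lemma frame_conjK (R : realType) (F N A : 'M[R]_16) : N *m F = 1%:M -> F *m (N *m A *m F) *m N = A.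
Proof. by move=> /mulmx1C FN; rewrite !mulmxA FN mul1mx -mulmxA FN mulmx1. Qed.

Lemma derive_left_inverse (R : realType) (n : nat) (D : set 'cV[R]_n) (F N : 'cV[R]_n -> 'M[R]_16) x v :
  open D -> D x -> smooth_mx D F -> smooth_mx D N -> (forall y, D y -> N y *m F y = 1%:M) ->
  deriv_mx N x v = - (N x *m deriv_mx F x v *m N x).
Proof.
move=> oD Dx sF sN NF; have FN := mulmx1C (NF x Dx).
have d := is_dmxM (smooth_mx_is_dmx v oD Dx sN) (smooth_mx_is_dmx v oD Dx sF).
have := is_dmx_unique (is_dmx_congr oD Dx NF d) (is_dmx_cst 1%:M x v).
move: (deriv_mx N x v) (deriv_mx F x v) => p q /eqP; rewrite addr_eq0 => /eqP h.
by rewrite -[LHS]mulmx1 -FN mulmxA h mulNmx.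
Qed.

(** * Conformally parallel structures are of vectorial type *)

Section ManifoldCharts.
Local Open Scope classical_set_scope.
Context {R : realType} {n : nat} (M : manifold R n).
Implicit Types (i j : chart_index M) (x : 'cV[R]_n) (U : set M).

Lemma cdomP i U x : cdom i U x <->
  [/\ dom i (param i x), U (param i x) & chart i (param i x) = x].
Proof.
split=> [[p [dp Up] <-]|[d u e]]; first by rewrite chartK.
by exists (param i x).
Qed.

Lemma cdom_sub i U x : cdom i U x -> cdom i setT x.
Proof. by move=> /cdomP[d _ e]; apply/cdomP. Qed.

Lemma cdom_img i U x : cdom i U x -> (chart i @` dom i) x.
Proof. by move=> /cdomP[d _ e]; exists (param i x). Qed.

Lemma cdom_open i U : open U -> open (cdom i U).
Proof.
move=> oU; rewrite openE => x hx; have [d Ux e] := (cdomP _ _ _).1 hx.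
have n1 : nbhs x (chart i @` dom i).
  by apply: open_nbhs_nbhs; split; [exact: img_open|exact: cdom_img hx].
have n2 : nbhs x (param i @^-1` U).
  by apply: (param_continuous (cdom_img hx)); apply: open_nbhs_nbhs.
apply: filterS2 n1 n2 => y [q dq eq] Uy; apply/cdomP.
by rewrite -eq chartK //; split=> //; move: Uy; rewrite /= -eq chartK.
Qed.

End ManifoldCharts.

Section ConformallyParallelIsVectorial.
Local Open Scope classical_set_scope.
Context {R : realType} (J : 'I_9 -> 'M[R]_16) (hJ : clifford_system J).
Context (M : manifold R 16) (g : chart_index M -> 'cV[R]_16 -> 'M[R]_16).
Context (Q : chart_index M -> 'cV[R]_16 -> set 'M[R]_16).
Hypotheses (hg : riemannian_metric setT g) (hQ : reduction (Spin9 J) g Q).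

Lemma metric_sub (U : set M) g' : riemannian_metric U g' -> forall i x, cdom i U x ->
  (g' i x)^T = g' i x.
Proof. by case. Qed.

Lemma reduction_frame i x A : cdom i setT x -> Q i x A -> A^T *m g i x *m A = 1%:M.
Proof. by case: hQ => h _ _ _ hx hA; have [] := h i x A hx hA. Qed.

Lemma reduction_trans i x F0 F1 : cdom i setT x -> Q i x F0 -> Q i x F1 ->
  Spin9 J (invmx F0 *m F1).
Proof.
move=> hx h0 h1; have [_ hG _ _] := hQ; have [B sB ->] := (hG i x F0 F1 hx h0).1 h1.
have [u0 _ _ _] := orthonormal_inv (reduction_frame hx h0).
by rewrite mulmxA mulVmx // mul1mx.
Qed.

(** Adapted frames at one point differ by Spin(9), which preserves the span of the generators;
    membership in V can be tested in any one of them. *)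
Lemma V_bundleP i x F0 A : cdom i setT x -> Q i x F0 ->
  V_bundle J Q i x A <-> in_clifford J (invmx F0 *m A *m F0).
Proof.
move=> hx h0; have [u0 i0 _ _] := orthonormal_inv (reduction_frame hx h0).
split=> [[F1 [w [h1 ->]]]|/(in_cliffordP hJ)[w e]].
  have sB := reduction_trans hx h0 h1; have [hB hB'] := Spin9_orth hJ sB.
  have [u1 i1 _ _] := orthonormal_inv (reduction_frame hx h1).
  have -> : invmx F0 *m (F1 *m clifford_mul J w *m invmx F1) *m F0 =
      (invmx F0 *m F1) * clifford_mul J w * (invmx F0 *m F1)^T.
    have -> : (invmx F0 *m F1)^T = invmx F1 *m F0.
      apply: esym; rewrite -[RHS]mul1mx -[1%:M](mulVmx u1) -(mulmxA (invmx F1)) -[X in _ *m (X *m _)]mul1mx.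
      rewrite -{1}(mulmxV u0) -!mulmxA (mulmxA (invmx F0) F1).
      by rewrite [(invmx F0 *m F1) *m _]hB' mulmx1.
    by rewrite -!mulmxE !mulmxA.
  by apply: Spin9_conj_in => //; exact: in_clifford_mul.
exists F0, w; split=> //; rewrite -e !mulmxA mulmxV // mul1mx -mulmxA mulmxV // mulmx1 //.
Qed.

(* The structure preserved by a connection is read off by differentiating the
   sections F J_a F^-1 of the bundle V. *)
Lemma preserves_V_normalizing U g' i D F x v : preserves_V J Q U g' -> open D -> D x ->
  D `<=` cdom i U -> smooth_mx D F -> (forall y, D y -> Q i y (F y)) ->
  clifford_normalizing J (connection_form (g' i) F x v).
Proof.
move=> hV oD Dx DU sF QF a.
have cD y : D y -> cdom i setT y by move=> /DU/cdom_sub.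
have NF y : D y -> (F y)^T *m g i y *m F y = 1%:M.
  by move=> Dy; exact: (reduction_frame (cD y Dy) (QF y Dy)).
have iF y : D y -> invmx (F y) = (F y)^T *m g i y by move=> Dy; have [] := orthonormal_inv (NF y Dy).
have sg : smooth_mx D (g i) by case: hg => h _ _ _; apply: smooth_mx_sub (h i) => y /cD.
have sN : smooth_mx D (fun y => (F y)^T *m g i y).
  by apply: smooth_mxM => //; exact: smooth_mx_tr.
have sA : smooth_mx D (fun y => F y *m J a *m ((F y)^T *m g i y)).
  by apply: smooth_mxM => //; apply: smooth_mxM => //; exact: smooth_mx_cst.
have VA y : D y -> V_bundle J Q i y (F y *m J a *m ((F y)^T *m g i y)).
  by move=> Dy; exists (F y), (delta_mx a 0); split; [exact: QF|rewrite clifford_mul_delta iF].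
have dA := is_dmxM (is_dmxM (smooth_mx_is_dmx v oD Dx sF) (is_dmx_cst (J a) x v))
  (smooth_mx_is_dmx v oD Dx sN).
have := hV i D _ oD DU sA VA x v Dx; rewrite (is_dmx_deriv_mx dA) mulmxDl.
rewrite (frame_commutator _ _ _ (NF x Dx) (mulmx1C (NF x Dx)) (derive_left_inverse v oD Dx sF sN NF)).
move=> /(V_bundleP _ (cD x Dx) (QF x Dx)).
by rewrite /connection_form !iF // (frame_conjK _ (mulmx1C (NF x Dx))) add0r.
Qed.

Theorem conformally_parallel_vectorial : locally_conformally_parallel J g Q -> vectorial_type J g Q.
Proof.
move=> [C [cov hC]] i W F oW Ws sF QF x Wx.
have : (\bigcup_(U in C) U) (param i x) by rewrite cov.
move=> [U CU Ux]; have [oU [f [g' [sf hg' e _ hV]]]] := hC U CU.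
pose D := W `&` cdom i U.
have oD : open D by apply: openI => //; exact: cdom_open.
have Dx : D x.
  by split=> //; have [d _ c] := (cdomP _ _ _).1 (Ws x Wx); apply/cdomP.
have DU : D `<=` cdom i U by move=> y [].
have DW : D `<=` W by move=> y [].
have hF y : D y -> (F y)^T *m g i y *m F y = 1%:M.
  by move=> Dy; apply: reduction_frame (QF y (DW y Dy)); exact/cdom_sub/DU.
have sFD := smooth_mx_sub DW sF.
have QFD y : D y -> Q i y (F y) by move=> /DW; exact: QF.
have sg : smooth_mx D (g i).
  by case: hg => h _ _ _; apply: smooth_mx_sub (h i) => y /DU/cdom_sub.
have gT y : D y -> (g i y)^T = g i y by move=> Dy; apply: (metric_sub hg); exact/cdom_sub/DU.
have sg' : smooth_mx D (g' i) by case: hg' => h _ _ _; exact: smooth_mx_sub DU (h i).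
have gT' y : D y -> (g' i y)^T = g' i y by move=> Dy; apply: (metric_sub hg'); exact: DU.
have sfD : smooth D (f \o param i) by move=> k; exact: Ck_sub DU (sf i k).
have eD y : D y -> g i y = expR ((f \o param i) y) *: g' i y by move=> Dy; apply: e; exact: DU.
have [uF _ uG _] := orthonormal_inv (hF x Dx).
have uG' : g' i x \in unitmx.
  by move: uG; rewrite eD // unitmx_expRZ.
pose eta : 'rV[R]_16 := \row_a 'D_(basis_vec a) (f \o param i) x.
(* The components, in the frame [F], of half the gradient of the logarithmic conformal factor. *)
pose w := 2^-1 *: ((F x)^T *m eta^T).
exists (vectorial_map J w); split.
- by move=> u; apply: m_compl_proj => //; exact: wedgeT.
- move=> u; apply/(spin9_lieP hJ); split.
    apply: skew_sub; first exact: (connection_form_skew _ oD Dx gT sg sFD hF).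
    by have [] : m_compl J (vectorial_map J w u) by apply: m_compl_proj => //; exact: wedgeT.
  rewrite (connection_form_conformal u oD Dx sg gT sg' gT' uG' sfD eD (hF x Dx)) -/eta.
  (* After subtraction of the m-part there remain the connection form of [g'], a scalar and the
     spin(9)-part of the wedge, all in spin(9) ⊕ R; skewness, established just before, excludes a
     scalar part. *)
  set s := (eta *m _) 0 0; rewrite /vectorial_map /m_proj opprB.
  have -> : wedge u w = 2^-1 *: wedge u ((F x)^T *m eta^T) by rewrite wedgeZr.
  set B := 2^-1 *: wedge u _; rewrite scalerDr scalerA -/B -!addrA [B + _]addrCA subrr addr0.
  apply: normalizingD => //; first exact: preserves_V_normalizing hV oD Dx DU sFD QFD.
  apply: normalizingD => //; first by apply: normalizingZ => //; exact: normalizing1.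
  by have /(spin9_lieP hJ)[] := spin9_proj_lie J B.
- exists (vectorial_map J); first exact: vectorial_map_embedding.
  by exists w.
Qed.

End ConformallyParallelIsVectorial.

(** * The Lee form and its local potentials *)

Section CurvatureTrace.
Local Open Scope classical_set_scope.
Context {R : realType} (J : 'I_9 -> 'M[R]_16) (hJ : clifford_system J).
Local Notation E := 'cV[R]_16.
Implicit Types (x u v : E) (D : set E).

Lemma in_clifford_derive (X : E -> 'M[R]_16) D x v dX : open D -> D x ->
  (forall y, D y -> in_clifford J (X y)) -> is_dmx X x v dX -> in_clifford J dX.
Proof.
move=> oD Dx hX dXh; apply: (is_dmx_unique _ dXh).
apply: (is_dmx_congr oD Dx hX); apply: is_dmx_sum => a _.
have h := is_derive_mul (is_derive_mxtrace (is_dmxM (is_dmx_cst (J a) x v) dXh))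
  (is_derive_const (16^-1 : R) x v).
have := is_dmxZ h (is_dmx_cst (J a) x v).
by move=> h'; apply: (is_dmx_eq h'); rewrite mul0mx add0r mulr0 addr0 scaler0 addr0.
Qed.

Lemma normalizing_derive (X : E -> 'M[R]_16) D x v dX : open D -> D x ->
  (forall y, D y -> clifford_normalizing J (X y)) -> is_dmx X x v dX -> clifford_normalizing J dX.
Proof.
move=> oD Dx hX dXh c; apply: (in_clifford_derive oD Dx (fun y Dy => hX y Dy c) (v := v)).
have := is_dmxB (is_dmxM dXh (is_dmx_cst (J c) x v)) (is_dmxM (is_dmx_cst (J c) x v) dXh).
by move=> h'; apply: (is_dmx_eq h'); rewrite mulmx0 mul0mx addr0 add0r.
Qed.

(** The value at (u, v) of a matrix-valued bilinear form with coordinate components [X a b]; it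
    converts form indices from coordinates to a frame. *)
Definition bilin_sum (u v : E) (X : 'I_16 -> 'I_16 -> 'M[R]_16) : 'M[R]_16 :=
  \sum_a \sum_b (u a 0 * v b 0) *: X a b.

Lemma bilin_sum_mul u v (w : E) X : bilin_sum u v X *m w =
  \sum_a \sum_b \sum_c (u a 0 * v b 0 * w c 0) *: (X a b *m delta_mx c 0).
Proof.
rewrite /bilin_sum mulmx_suml; apply: eq_bigr => a _.
rewrite mulmx_suml; apply: eq_bigr => b _; rewrite {1}[w]col_sum_delta mulmx_sumr.
by apply: eq_bigr => c _; rewrite -scalemxAl -scalemxAr scalerA.
Qed.

Lemma bilin_sum_cyclic u v (w : E) (X : 'I_16 -> 'I_16 -> 'M[R]_16) :
  (forall a b c, X a b *m (delta_mx c 0 : E) + X b c *m delta_mx a 0 + X c a *m delta_mx b 0 = 0) ->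
  bilin_sum u v X *m w + bilin_sum v w X *m u + bilin_sum w u X *m v = 0.
Proof.
move=> h; rewrite !bilin_sum_mul.
have -> : \sum_a \sum_b \sum_c (v a 0 * w b 0 * u c 0) *: (X a b *m (delta_mx c 0 : E)) =
    \sum_a \sum_b \sum_c (u a 0 * v b 0 * w c 0) *: (X b c *m (delta_mx a 0 : E)).
  under eq_bigr do rewrite exchange_big; rewrite exchange_big; apply: eq_bigr => a _ /=.
  by apply: eq_bigr => b _; apply: eq_bigr => c _; congr (_ *: _); ring.
have -> : \sum_a \sum_b \sum_c (w a 0 * u b 0 * v c 0) *: (X a b *m (delta_mx c 0 : E)) =
    \sum_a \sum_b \sum_c (u a 0 * v b 0 * w c 0) *: (X c a *m (delta_mx b 0 : E)).
  rewrite exchange_big; apply: eq_bigr => a _ /=; rewrite exchange_big.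
  by apply: eq_bigr => b _; apply: eq_bigr => c _; congr (_ *: _); ring.
rewrite -!big_split big1 // => a _ /=; rewrite -!big_split big1 // => b _ /=.
by rewrite -!big_split big1 // => c _ /=; rewrite -!scalerDr h scaler0.
Qed.

Lemma mxtrace_bilin_sum u v X :
  \tr (bilin_sum u v X) = \sum_a \sum_b u a 0 * v b 0 * \tr (X a b).
Proof.
rewrite /bilin_sum (raddf_sum (@mxtrace R 16)); apply: eq_bigr => a _.
by rewrite (raddf_sum (@mxtrace R 16)); apply: eq_bigr => b _; exact: mxtraceZ.
Qed.

Lemma bilin_sum_conj u v X (A B : 'M[R]_16) : A *m bilin_sum u v X *m B = bilin_sum u v (fun a b => A *m X a b *m B).
Proof.
rewrite mulmx_sumr mulmx_suml; apply: eq_bigr => a _.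
rewrite mulmx_sumr mulmx_suml; apply: eq_bigr => b _.
by rewrite -scalemxAr -scalemxAl.
Qed.

Lemma curv_skew (X Y U V : 'M[R]_16) : X - Y + ad U V = - (Y - X + ad V U).
Proof. by rewrite opprD opprB -adC. Qed.

Lemma mxtrace_sub_ad (X Y U V : 'M[R]_16) : \tr (X - Y + ad U V) = \tr X - \tr Y.
Proof. by rewrite mxtraceD raddfB /ad raddfB /= mxtr_mulC subrr addr0. Qed.

(** Algebraic core of the structure equation. [Aa], [wa], [Ga] stand for a derivative of the frame,
    the connection form and the Christoffel matrix; [H] is the mixed second derivative of the frame,
    which cancels by symmetry. *)
Lemma curvature_algebra (A Aa Ab wa wb Ga Gb wab wba Gab Gba H : 'M[R]_16) :
  A *m wa = Aa + Ga *m A -> A *m wb = Ab + Gb *m A ->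
  Aa *m wb + A *m wba = H + (Gba *m A + Gb *m Aa) ->
  Ab *m wa + A *m wab = H + (Gab *m A + Ga *m Ab) ->
  A *m (wba - wab + ad wa wb) = (Gba - Gab + (Ga *m Gb - Gb *m Ga)) *m A.
Proof.
move=> /eqP ha /eqP hb; move: ha hb; rewrite -subr_eq -[_ == Ab + _]subr_eq => /eqP <- /eqP <-.
rewrite /ad -!mulmxE !(mulmxDl, mulmxDr, mulNmx, mulmxN) !mulmxA.
move: (A *m wa *m wb) (A *m wb *m wa) (Ga *m A *m wb) (Gb *m A *m wa) => p1 p2 p3 p4.
move: (A *m wba) (A *m wab) (Gba *m A) (Gab *m A) (Ga *m Gb *m A) (Gb *m Ga *m A).
move=> p5 p6 p7 p8 p9 p10 e1 e2.
apply/matrixP => i k; move/matrixP/(_ i k): e1; move/matrixP/(_ i k): e2.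
by rewrite !mxE => h1 h2; lra.
Qed.

Section Connection.
Context (D : set E) (F N : E -> 'M[R]_16) (Gam : 'I_16 -> E -> 'M[R]_16).
Hypotheses (oD : open D) (sF : smooth_mx D F) (sN : smooth_mx D N).
Hypothesis NF : forall y, D y -> N y *m F y = 1%:M.
Hypothesis sGam : forall a, smooth_mx D (Gam a).
Hypothesis Gam_sym : forall a b y, D y ->
  Gam a y *m (delta_mx b 0 : E) = Gam b y *m (delta_mx a 0 : E).

(** [om] is the connection form of the torsion-free connection [Gam] in the frame [F]; [curv] and
    [curvF] are its curvature as endomorphism in coordinates and in the frame, with form indices in
    coordinates. *)
Let om a y := N y *m (deriv_mx F y (basis_vec a) + Gam a y *m F y).
Let dom a b x := deriv_mx (om a) x (basis_vec b).
Let dGam a b x := deriv_mx (Gam a) x (basis_vec b).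
Let curv a b x := dGam b a x - dGam a b x + (Gam a x *m Gam b x - Gam b x *m Gam a x).
Let curvF a b x := dom b a x - dom a b x + ad (om a x) (om b x).

Lemma om_smooth a : smooth_mx D (om a).
Proof.
apply: smooth_mxM => //; apply: smooth_mxD => //; first exact: smooth_mx_deriv.
exact: smooth_mxM.
Qed.

Lemma frame_derive a y : D y -> F y *m om a y = deriv_mx F y (basis_vec a) + Gam a y *m F y.
Proof. by move=> Dy; rewrite /om mulmxA (mulmx1C (NF Dy)) mul1mx. Qed.

Lemma frame_derive2 a b x : D x ->
  deriv_mx F x (basis_vec b) *m om a x + F x *m dom a b x =
  deriv_mx (fun y => deriv_mx F y (basis_vec a)) x (basis_vec b)
  + (dGam a b x *m F x + Gam a x *m deriv_mx F x (basis_vec b)).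
Proof.
move=> Dx; have dF c := smooth_mx_is_dmx (basis_vec c) oD Dx sF.
have d1 := is_dmxM (dF b) (smooth_mx_is_dmx (basis_vec b) oD Dx (om_smooth a)).
have d2 := is_dmxD (smooth_mx_is_dmx (basis_vec b) oD Dx (smooth_mx_deriv a sF))
  (is_dmxM (smooth_mx_is_dmx (basis_vec b) oD Dx (sGam a)) (dF b)).
exact: is_dmx_unique (is_dmx_congr oD Dx (frame_derive a) d1) d2.
Qed.

Lemma curvature_frame a b x : D x -> F x *m curvF a b x = curv a b x *m F x.
Proof.
move=> Dx; have e1 := frame_derive2 b a Dx; have e2 := frame_derive2 a b Dx.
rewrite (deriv_mx_schwarz b a oD Dx sF) in e1.
exact: (curvature_algebra (frame_derive a Dx) (frame_derive b Dx) e1 e2).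
Qed.

Lemma curvature_bianchi a b c x : D x ->
  curv a b x *m (delta_mx c 0 : E) + curv b c x *m delta_mx a 0 + curv c a x *m delta_mx b 0 = 0.
Proof.
move=> Dx.
have dG p q r : dGam p r x *m (delta_mx q 0 : E) = dGam q r x *m (delta_mx p 0 : E).
  have d1 := is_dmxM (smooth_mx_is_dmx (basis_vec r) oD Dx (sGam p))
    (is_dmx_cst (delta_mx q 0 : E) x (basis_vec r)).
  have d2 := is_dmxM (smooth_mx_is_dmx (basis_vec r) oD Dx (sGam q))
    (is_dmx_cst (delta_mx p 0 : E) x (basis_vec r)).
  have := is_dmx_unique (is_dmx_congr oD Dx (fun y Dy => Gam_sym p q Dy) d1) d2.
  by rewrite !mulmx0 !addr0.
have gG p q r : Gam r x *m Gam p x *m (delta_mx q 0 : E) = Gam r x *m Gam q x *m (delta_mx p 0 : E).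
  by rewrite -!mulmxA Gam_sym.
rewrite /curv !(mulmxDl, mulNmx) (dG b c a) (dG a c b) (dG b a c) (gG b c a) (gG a c b) (gG b a c).
move: (dGam c a x *m _) (dGam c b x *m _) (dGam a c x *m _) => p q r.
move: (Gam a x *m _ *m _) (Gam b x *m _ *m _) (Gam c x *m _ *m _) => s t k.
by apply/matrixP => i l; rewrite !mxE; ring.
Qed.

Lemma curvF_normalizing a b x : D x -> (forall c y, D y -> clifford_normalizing J (om c y)) ->
  clifford_normalizing J (curvF a b x).
Proof.
move=> Dx h.
have hd c d : clifford_normalizing J (dom c d x).
  exact: (normalizing_derive oD Dx (h c) (smooth_mx_is_dmx (basis_vec d) oD Dx (om_smooth c))).
apply: normalizingD => //; last by apply: normalizing_ad => //; exact: h.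
by apply: normalizingD => //; exact: normalizingN.
Qed.

Lemma curvF_trace a b x : \tr (curvF a b x) = \tr (dom b a x) - \tr (dom a b x).
Proof. exact: mxtrace_sub_ad. Qed.

(** Commutators have trace zero, so the trace of the curvature is the exterior derivative of the
    trace of [om]. For the algebraic identity all indices must refer to one frame: [K] evaluates the
    curvature on the columns of [F], and invertibility of [F] carries the vanishing back to
    coordinates. *)
Lemma curvature_trace a b x : D x -> (forall c y, D y -> clifford_normalizing J (om c y)) ->
  \tr (dom b a x) = \tr (dom a b x).
Proof.
move=> Dx h; pose K i j := bilin_sum (F x *m (delta_mx i 0 : E)) (F x *m delta_mx j 0)
  (fun p q => curvF p q x).
have curvFC p q : curvF p q x = - curvF q p x by exact: curv_skew.
have K_alt i j : K i j = - K j i.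
  rewrite /K /bilin_sum exchange_big -sumrN; apply: eq_bigr => p _; rewrite -sumrN.
  by apply: eq_bigr => q _; rewrite curvFC scalerN mulrC.
have K_norm i j : clifford_normalizing J (K i j).
  apply: normalizing_sum => // p _; apply: normalizing_sum => // q _; apply: normalizingZ => //.
  exact: curvF_normalizing.
have FN : F x *m N x = 1%:M := mulmx1C (NF Dx).
have KE i j : K i j = N x *m bilin_sum (F x *m (delta_mx i 0 : E)) (F x *m delta_mx j 0)
    (fun p q => curv p q x) *m F x.
  rewrite bilin_sum_conj; apply: eq_bigr => p _; apply: eq_bigr => q _; congr (_ *: _).
  by rewrite -mulmxA -curvature_frame // mulmxA NF // mul1mx.
have K_cyc i j k l : K i j l k + K j k l i + K k i l j = 0.
  have e p q r : K p q *m (delta_mx r 0 : E) = N x *m (bilin_sum (F x *m (delta_mx p 0 : E))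
      (F x *m delta_mx q 0) (fun p q => curv p q x) *m (F x *m delta_mx r 0)).
    by rewrite KE -!mulmxA.
  have : K i j *m (delta_mx k 0 : E) + K j k *m delta_mx i 0 + K k i *m delta_mx j 0 = 0.
    by rewrite !e -!mulmxDr bilin_sum_cyclic ?mulmx0 // => *; exact: curvature_bianchi.
  by rewrite -!colE => /matrixP/(_ l 0); rewrite !mxE.
have tK i j := bianchi_trace hJ K_alt K_norm K_cyc i j.
pose t : 'M[R]_16 := \matrix_(p, q) \tr (curvF p q x).
have Ft : (F x)^T *m t *m F x = 0.
  apply/matrixP => i j; rewrite [RHS]mxE.
  have -> : ((F x)^T *m t *m F x) i j = \sum_p \sum_q F x p i * F x q j * t p q.
    rewrite mxE; under eq_bigr do rewrite mxE mulr_suml.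
    rewrite exchange_big; apply: eq_bigr => p _; apply: eq_bigr => q _.
    by rewrite [(F x)^T _ _]mxE; ring.
  apply: etrans (tK i j); rewrite /K mxtrace_bilin_sum; apply: eq_bigr => p _; apply: eq_bigr => q _.
  by rewrite -!colE [t p q]mxE [col i _ _ _]mxE [col j _ _ _]mxE.
have t0 : t = 0.
  have : (N x)^T *m ((F x)^T *m t *m F x) *m N x = t.
    by rewrite !mulmxA -trmx_mul FN trmx1 mul1mx -mulmxA FN mulmx1.
  by rewrite Ft mulmx0 mul0mx => <-.
have : t a b = 0 by rewrite t0 mxE.
by rewrite mxE curvF_trace => /eqP; rewrite subr_eq0 => /eqP.
Qed.

End Connection.
End CurvatureTrace.

(** * The closed 1-form of a structure of vectorial type *)

Section LeeForm.
Local Open Scope classical_set_scope.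
Context {R : realType} (J : 'I_9 -> 'M[R]_16) (hJ : clifford_system J).
Local Notation E := 'cV[R]_16.
Implicit Types (x y u v : E).
Context (D : set E) (G F : E -> 'M[R]_16).
Hypotheses (oD : open D) (sG : smooth_mx D G) (sF : smooth_mx D F).
Hypothesis GT : forall y, D y -> (G y)^T = G y.
Hypothesis FGF : forall y, D y -> (F y)^T *m G y *m F y = 1%:M.
Hypothesis conn_vectorial : forall y, D y -> exists w, forall u,
  spin9_lie J (connection_form G F y (F y *m u) - wedge u w).

Lemma connection_form_sum y v : D y ->
  connection_form G F y v = \sum_a v a 0 *: connection_form G F y (basis_vec a).
Proof.
move=> Dy; rewrite /connection_form [in LHS](linear_cV (deriv_mx_linear oD Dy sF)).
rewrite [in LHS](linear_cV (levi_civita_linear G y)) mulmx_suml -big_split mulmx_sumr.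
by apply: eq_bigr => a _ /=; rewrite -scalemxAl -scalerDr -scalemxAr.
Qed.

Lemma smooth_levi_civita a : smooth_mx D (fun y => levi_civita G y (basis_vec a)).
Proof.
have sH : smooth_mx D (fun y => F y *m (F y)^T) by apply: smooth_mxM => //; exact: smooth_mx_tr.
have sI : smooth_mx D (fun y => invmx (G y)).
  apply: smooth_mx_congr sH => // y Dy.
  by have [_ _ _ ->] := orthonormal_inv (FGF Dy).
move=> k b m; under [X in Ck _ _ X]eq_fun do rewrite mxE.
apply: Ck_sum => // c _; apply: Ck_mul => //; first exact: Ck_cst.
apply: Ck_mul => //; first exact: Ck_cst.
apply: Ck_sum => // l _; apply: Ck_mul => //; first exact: (sI k l m).
have sP p q r : Ck m D ('D_(basis_vec p) (fun y => G y q r)) by exact: (smooth_partial p (sG q r) m).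
have sN : Ck m D (fun y => (-1) * 'D_(basis_vec l) (fun y => G y c b) y).
  by apply: Ck_mul => //; exact: Ck_cst.
apply: Ck_congr (Ck_add oD (Ck_add oD (sP c b l) (sP b c l)) sN) => // y _.
by rewrite mulN1r.
Qed.

Lemma smooth_coframe : smooth_mx D (fun y => (F y)^T *m G y).
Proof. by apply: smooth_mxM => //; exact: smooth_mx_tr. Qed.

Lemma smooth_connection_form a : smooth_mx D (fun y => connection_form G F y (basis_vec a)).
Proof.
have s : smooth_mx D (fun y => (F y)^T *m G y *m (deriv_mx F y (basis_vec a)
     + levi_civita G y (basis_vec a) *m F y)).
  apply: smooth_mxM => //; first exact: smooth_coframe.
  apply: smooth_mxD => //; first exact: smooth_mx_deriv.
  by apply: smooth_mxM => //; exact: smooth_levi_civita.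
apply: smooth_mx_congr s => // y Dy.
by have [_ h _ _] := orthonormal_inv (FGF Dy); rewrite /connection_form h.
Qed.

Let Jt := J 0 * J 1 * J 2.

(** Solves tr (Jt^T ω(F u)) = 2 u^T Jt w for w, [Jt] being orthogonal. The hypothesis gives w only
    point by point; this expression in the connection form is smooth. *)
Definition lee_vec y : E := Jt^T *m \col_b (2^-1 *
  \tr (Jt^T *m connection_form G F y (F y *m delta_mx b 0))).

(** Twice the metric dual of w, since a conformal change contributes the wedge with half the
    gradient. *)
Definition lee_form y : 'rV[R]_16 := 2 *: ((lee_vec y)^T *m ((F y)^T *m G y)).

(* The vector w is recovered by pairing the connection form with a single element of m. *)
Lemma lee_vecP y : D y -> forall u, spin9_lie J (connection_form G F y (F y *m u) - wedge u (lee_vec y)).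
Proof.
move=> Dy; have [w hw] := conn_vectorial Dy; suff -> : lee_vec y = w by [].
have JtT : Jt^T = - Jt := clifford3T hJ (@uniq012).
have [_ oJ] := clifford3_m hJ (@uniq012).
have e u : \tr (Jt^T *m connection_form G F y (F y *m u)) = 2 * (u^T *m (Jt *m w)) 0 0.
  have := oJ _ (hw u); rewrite -mxtrace_tr trmx_mul trmxK mulmxBr raddfB /= mxtr_wedge //.
  by move=> /eqP; rewrite subr_eq0 => /eqP.
have -> : lee_vec y = Jt^T *m (Jt *m w).
  congr (_ *m _); apply/colP => b; rewrite mxE e mulrA mulVf ?pnatr_eq0 // mul1r.
  by rewrite trmx_delta -rowE mxE.
by rewrite mulmxA -[Jt^T *m Jt]/(Jt^T * Jt) clifford3_orth // mul1mx.
Qed.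

Lemma smooth_lee_vec : smooth_mx D lee_vec.
Proof.
apply: smooth_mxM => //; first exact: smooth_mx_cst.
move=> b j k; under [X in Ck _ _ X]eq_fun do rewrite mxE.
apply: Ck_mul => //; first exact: Ck_cst.
have s : smooth_mx D (fun y => Jt^T *m \sum_a F y a b *: connection_form G F y (basis_vec a)).
  apply: smooth_mxM => //; first exact: smooth_mx_cst.
  apply: smooth_mx_sum => // a _.
  exact: (smooth_mxZ oD (sF a b) (smooth_connection_form a)).
apply: (Ck_congr (f := fun y => \tr (Jt^T *m \sum_a F y a b *: connection_form G F y (basis_vec a)))) => //.
  move=> y Dy; rewrite [in RHS]connection_form_sum //; congr (\tr (_ *m _)).
  by apply: eq_bigr => a _; rewrite -colE mxE.
by apply: Ck_sum => // i _; exact: (s i i k).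
Qed.

Lemma smooth_lee_form : smooth_mx D lee_form.
Proof.
apply: smooth_mxZ => //; first by move=> k; exact: Ck_cst.
apply: smooth_mxM => //; last exact: smooth_coframe.
by apply: smooth_mx_tr; exact: smooth_lee_vec.
Qed.

Lemma lee_form_frame y : D y -> (F y)^T *m (lee_form y)^T = 2 *: lee_vec y.
Proof.
move=> Dy; rewrite linearZ /= -scalemxAr; congr (_ *: _).
by rewrite trmx_mul trmxK trmx_mul trmxK (GT Dy) !mulmxA FGF // mul1mx.
Qed.

(** Christoffel matrices of the Weyl connection, the torsion-free connection with ∇g = η ⊗ g. *)
Let Gam a y := levi_civita G y (basis_vec a) - conformal_term (G y) (lee_form y) (basis_vec a).

Lemma smooth_Gam a : smooth_mx D (Gam a).
Proof.
have sE : smooth_mx D (fun y => lee_form y *m (basis_vec a : E)).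
  exact: (smooth_mxM oD smooth_lee_form (smooth_mx_cst D _)).
have s : smooth_mx D (fun y => 2^-1 *: ((lee_form y *m (basis_vec a : E)) 0 0 *: (1%:M : 'M[R]_16)
    + (basis_vec a : E) *m lee_form y
    + (-1) *: (F y *m (F y)^T *m (lee_form y)^T *m ((basis_vec a)^T *m G y)))).
  apply: smooth_mxZ => //; first by move=> k; exact: Ck_cst.
  apply: smooth_mxD => //; first apply: smooth_mxD => //.
  - exact: (smooth_mxZ oD (sE 0 0) (smooth_mx_cst D 1%:M)).
  - exact: (smooth_mxM oD (smooth_mx_cst D _) smooth_lee_form).
  - apply: smooth_mxZ => //; first by move=> k; exact: Ck_cst.
    exact: (smooth_mxM oD (smooth_mxM oD (smooth_mxM oD sF (smooth_mx_tr sF))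
      (smooth_mx_tr smooth_lee_form)) (smooth_mxM oD (smooth_mx_cst D _) sG)).
have sC := smooth_mxZ oD (fun k => Ck_cst k D (-1)) s.
apply: smooth_mx_congr (smooth_mxD oD (smooth_levi_civita a) sC) => // y Dy.
have [_ _ _ iG] := orthonormal_inv (FGF Dy).
by rewrite /Gam /conformal_term iG !scaleN1r.
Qed.

Lemma weyl_form y v : D y ->
  (F y)^T *m G y *m (deriv_mx F y v + (levi_civita G y v - conformal_term (G y) (lee_form y) v) *m F y)
  = connection_form G F y v - wedge ((F y)^T *m G y *m v) (lee_vec y)
    - (2^-1 * (lee_form y *m v) 0 0) *: 1.
Proof.
move=> Dy; have [uF iF _ _] := orthonormal_inv (FGF Dy).
pose u := (F y)^T *m G y *m v; have eu : F y *m u = v by rewrite /u -iF mulmxA mulmxV // mul1mx.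
have := conformal_term_frame (lee_form y) u (FGF Dy); rewrite eu lee_form_frame // -/u => e.
rewrite wedgeZr scalerDr !scalerA mulVf ?pnatr_eq0 // scale1r in e.
rewrite -iF mulmxBl addrA mulmxBr mulmxA e -/(connection_form _ _ _ _).
by rewrite opprD [- _ - _]addrC addrA.
Qed.

Lemma weyl_normalizing y v : D y -> clifford_normalizing J
  ((F y)^T *m G y *m (deriv_mx F y v + (levi_civita G y v - conformal_term (G y) (lee_form y) v) *m F y)).
Proof.
move=> Dy; have [uF iF _ _] := orthonormal_inv (FGF Dy); rewrite weyl_form //.
have := lee_vecP Dy ((F y)^T *m G y *m v); rewrite -iF mulmxA mulmxV // mul1mx.
move=> /(spin9_lieP hJ)[_ h]; apply: normalizingD => //; apply: normalizingN => //.
by apply: normalizingZ => //; exact: normalizing1.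
Qed.

(** The part in spin(9) is traceless, and the scalar part -η/2 counts 16 times. *)
Lemma weyl_trace y a : D y -> \tr ((F y)^T *m G y *m (deriv_mx F y (basis_vec a) + Gam a y *m F y))
  = (- 8) * lee_form y 0 a.
Proof.
move=> Dy; have [uF iF _ _] := orthonormal_inv (FGF Dy); rewrite weyl_form //.
have := lee_vecP Dy ((F y)^T *m G y *m basis_vec a); rewrite -iF mulmxA mulmxV // mul1mx.
move=> /(spin9_lieP hJ)[h _]; rewrite raddfB /= mxtraceZ mxtrace1.
have := congr1 (@mxtrace _ _) h; rewrite mxtrace_tr raddfN /= => h'.
have -> : \tr (connection_form G F y (basis_vec a) - wedge (invmx (F y) *m basis_vec a) (lee_vec y)) = 0.
  lra.
rewrite [lee_form y *m _](_ : _ = col a (lee_form y)); last by rewrite colE.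
by rewrite [col _ _ _ _]mxE; field.
Qed.

(** The trace of the Weyl connection form is -8 η, and its exterior derivative is the trace of a
    torsion-free curvature with values in spin(9) ⊕ R. *)
Lemma lee_form_closed a b x : D x ->
  'D_(basis_vec b) (fun y => lee_form y 0 a) x = 'D_(basis_vec a) (fun y => lee_form y 0 b) x.
Proof.
move=> Dx; pose om c y := (F y)^T *m G y *m (deriv_mx F y (basis_vec c) + Gam c y *m F y).
have NF y : D y -> (F y)^T *m G y *m F y = 1%:M by exact: FGF.
have GamS p q y : D y -> Gam p y *m (delta_mx q 0 : E) = Gam q y *m (delta_mx p 0 : E).
  move=> Dy; rewrite !mulmxBl (levi_civita_torsion_free _ _ oD Dy GT).
  by rewrite (conformal_term_sym _ _ _ (GT Dy)).
have nom c y : D y -> clifford_normalizing J (om c y) by move=> Dy; exact: weyl_normalizing.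
have som c : smooth_mx D (om c).
  apply: smooth_mxM => //; first exact: smooth_coframe.
  apply: smooth_mxD => //; first exact: smooth_mx_deriv.
  by apply: smooth_mxM => //; exact: smooth_Gam.
have tr c d : \tr (deriv_mx (om c) x (basis_vec d)) = (- 8) * 'D_(basis_vec d) (fun y => lee_form y 0 c) x.
  have [_ <-] := is_derive_mxtrace (smooth_mx_is_dmx (basis_vec d) oD Dx (som c)).
  have hl : is_derive x (basis_vec d) (fun y => lee_form y 0 c)
      ('D_(basis_vec d) (fun y => lee_form y 0 c) x).
    exact: Ck_is_derive (smooth_lee_form 0 c 1) Dx.
  have h := is_derive_mul (is_derive_const (- 8 : R) x (basis_vec d)) hl.
  rewrite mul0r add0r in h.
  have h2 : \near x, (-8) * lee_form x 0 c = \tr (om c x).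
    by apply: filterS (open_near oD Dx) => y Dy; rewrite weyl_trace.
  by have [_ ->] := near_eq_is_derive h2 h.
have k : \tr (deriv_mx (om a) x (basis_vec b)) = \tr (deriv_mx (om b) x (basis_vec a)) :=
  @curvature_trace R J hJ D F (fun y => (F y)^T *m G y) Gam oD sF smooth_coframe NF
    smooth_Gam GamS b a x Dx nom.
have n8 : (- 8 : R) != 0 by rewrite oppr_eq0 pnatr_eq0.
exact: (mulfI n8 (etrans (esym (tr a b)) (etrans k (tr b a)))).
Qed.

(** The frame stays orthonormal for [G] and not for the rescaled metric, so the new connection form
    lies in spin(9) only after the multiple of 1 has been added back. *)
Lemma local_potential x0 : D x0 -> exists2 r, 0 < r & ball x0 r `<=` D /\
  exists2 phi : E -> R, smooth (ball x0 r) phi &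
    forall y v, ball x0 r y ->
      spin9_lie J (connection_form (fun z => expR (- phi z) *: G z) F y v
        + (2^-1 * (lee_form y *m v) 0 0) *: 1).
Proof.
move=> Dx0.
have [r r0 [rD [phi sphi hphi]]] := poincare oD Dx0 (fun a => smooth_lee_form 0 a)
  (fun a b x Dx => lee_form_closed a b Dx).
exists r => //; split=> //; exists phi => // y v hy.
have oB : open (ball x0 r) by exact: ball_open.
have Dy := rD y hy; have [uF iF uG _] := orthonormal_inv (FGF Dy).
have sg' : smooth_mx (ball x0 r) (fun z => expR (- phi z) *: G z).
  apply: smooth_mxZ => //; last exact: smooth_mx_sub rD sG.
  by apply: smooth_exp => //; exact: smoothN.
have gT' z : ball x0 r z -> (expR (- phi z) *: G z)^T = expR (- phi z) *: G z.
  by move=> /rD Dz; rewrite linearZ /= GT.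
have e z : ball x0 r z -> G z = expR (phi z) *: (expR (- phi z) *: G z).
  by move=> _; rewrite scalerA -expRD subrr expR0 scale1r.
have uG' : expR (- phi y) *: G y \in unitmx.
  by rewrite unitmx_expRZ.
have eta : \row_a 'D_(basis_vec a) phi y = lee_form y.
  by apply/rowP => a; rewrite mxE; have [_ ->] := hphi a y hy.
have := connection_form_conformal (invmx (F y) *m v) oB hy (smooth_mx_sub rD sG)
  (fun z hz => GT (rD z hz)) sg' gT' uG' sphi e (FGF Dy).
rewrite /= eta lee_form_frame // mulmxA mulmxV // mul1mx => h.
have := lee_vecP Dy (invmx (F y) *m v); rewrite mulmxA mulmxV // mul1mx h.
by rewrite wedgeZr scalerDr !scalerA mulVf ?pnatr_eq0 // scale1r addrA addrK.
Qed.

End LeeForm.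

(** * Change of charts, parallel sections and holonomy *)

Section ChartChange.
Local Open Scope classical_set_scope.
Context {R : realType} {n : nat}.
Local Notation E := 'cV[R]_n.
Implicit Types (x y u v : E) (D : set E).

Lemma is_dmx_chain (V : normedModType R) p q D (H : E -> 'M[R]_(p, q)) (c : V -> E) (t w : V) dc :
  open D -> D (c t) -> smooth_mx D H -> is_dmx c t w dc ->
  is_dmx (fun s => H (c s)) t w (deriv_mx H (c t) dc).
Proof.
move=> oD Dc sH hc a b; rewrite mxE.
have [_ ->] := smooth_is_derive dc oD Dc (sH a b).
exact: (is_derive_chain oD Dc (sH a b 1) hc).
Qed.

Lemma smooth_mx_comp p q D D' (H : E -> 'M[R]_(p, q)) (tau : E -> E) : open D -> open D' ->
  (forall x, D' x -> D (tau x)) -> smooth_mx D H -> smooth_mx D' tau ->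
  smooth_mx D' (fun x => H (tau x)).
Proof.
by move=> oD oD' h sH st a b k; exact: (Ck_comp oD oD' h (sH a b k) (fun c => st c 0 k)).
Qed.

Lemma bilin_sum_sym u v (X : 'I_n -> 'I_n -> E) : (forall a b, X a b = X b a) ->
  \sum_a \sum_b (u a 0 * v b 0) *: X a b = \sum_a \sum_b (v a 0 * u b 0) *: X a b.
Proof.
move=> h; rewrite exchange_big; apply: eq_bigr => a _; apply: eq_bigr => b _.
by rewrite h mulrC.
Qed.

Lemma torsion_frame (S T Lu Lw Du Dw : 'M[R]_n) u v : Lu *m (T *m v) = Lw *m (T *m u) ->
  Du *m v = Dw *m u -> S *m (Lu *m T + Du) *m v = S *m (Lw *m T + Dw) *m u.
Proof. by move=> h1 h2; rewrite -!mulmxA !mulmxDl -!mulmxA h1 h2. Qed.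

Lemma metric_frame (T G H L dH dT : 'M[R]_n) : T \in unitmx -> dH = L^T *m H + H *m L ->
  G = T^T *m H *m T ->
  (dT^T *m H + T^T *m dH) *m T + T^T *m H *m dT =
    (invmx T *m (L *m T + dT))^T *m G + G *m (invmx T *m (L *m T + dT)).
Proof.
move=> uT -> ->; rewrite !trmx_mul [(L *m T + dT)^T]linearD /= trmx_mul trmx_inv.
have uTT : T^T \in unitmx by rewrite unitmx_tr.
rewrite -!mulmxA (mulmxA (invmx T^T)) mulVmx // mul1mx (mulmxA T (invmx T)) mulmxV // mul1mx.
rewrite !(mulmxDl, mulmxDr) !mulmxA.
move: (dT^T *m H *m T) (T^T *m L^T *m H *m T) (T^T *m H *m L *m T) (T^T *m H *m dT) => p q r s.
by apply/matrixP => a b; rewrite !mxE; ring.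
Qed.

Context (D D' : set E) (tau : E -> E) (g h : E -> 'M[R]_n).
Hypotheses (oD : open D) (oD' : open D') (tauD : forall y, D y -> D' (tau y)).
Hypotheses (stau : smooth_mx D tau) (sg : smooth_mx D g) (sh : smooth_mx D' h).
Hypotheses (gT : forall y, D y -> (g y)^T = g y) (hT : forall y, D' y -> (h y)^T = h y).
Hypotheses (gU : forall y, D y -> g y \in unitmx) (hU : forall y, D' y -> h y \in unitmx).
Hypothesis isom : forall y, D y -> g y = (jac tau y)^T *m h (tau y) *m jac tau y.

Lemma smooth_jac : smooth_mx D (jac tau).
Proof.
by move=> a b k; under [X in Ck _ _ X]eq_fun do rewrite mxE; exact: (smooth_partial b (stau a 0) k).
Qed.

Lemma deriv_mx_jac y v : D y -> deriv_mx tau y v = jac tau y *m v.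
Proof.
move=> Dy; rewrite (deriv_mx_sum v oD Dy stau); apply/colP => a.
by rewrite summxE !mxE; apply: eq_bigr => b _; rewrite !mxE mulrC.
Qed.

Lemma is_dmx_tau y v : D y -> is_dmx tau y v (jac tau y *m v).
Proof. by move=> Dy; rewrite -deriv_mx_jac //; exact: (smooth_mx_is_dmx v oD Dy stau). Qed.

Lemma jac_unit y : D y -> jac tau y \in unitmx.
Proof. by move=> Dy; have := gU Dy; rewrite isom // !unitmx_mul => /andP[]. Qed.

Lemma jac_derive_sym_basis y a b : D y ->
  deriv_mx (jac tau) y (basis_vec a) *m (basis_vec b : E) =
  deriv_mx (jac tau) y (basis_vec b) *m (basis_vec a : E).
Proof.
move=> Dy.
have k p q : deriv_mx (jac tau) y (basis_vec p) *m (basis_vec q : E) =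
    deriv_mx (fun z => deriv_mx tau z (basis_vec q)) y (basis_vec p).
  have d := is_dmxM (smooth_mx_is_dmx (basis_vec p) oD Dy smooth_jac)
    (is_dmx_cst (basis_vec q : E) y (basis_vec p)).
  rewrite mulmx0 addr0 in d; apply: esym; apply: is_dmx_deriv_mx.
  by apply: (is_dmx_congr oD Dy _ d) => z Dz; rewrite deriv_mx_jac.
exact: (etrans (k a b) (etrans (deriv_mx_schwarz b a oD Dy stau) (esym (k b a)))).
Qed.

Lemma jac_derive_sym y u v : D y ->
  deriv_mx (jac tau) y u *m v = deriv_mx (jac tau) y v *m u.
Proof.
move=> Dy; have e p q : deriv_mx (jac tau) y p *m q = \sum_a \sum_b (p a 0 * q b 0) *:
    (deriv_mx (jac tau) y (basis_vec a) *m (basis_vec b : E)).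
  rewrite (deriv_mx_sum p oD Dy smooth_jac) mulmx_suml; apply: eq_bigr => a _.
  rewrite {1}[q]col_sum_delta mulmx_sumr; apply: eq_bigr => b _.
  by rewrite -scalemxAl -scalemxAr scalerA.
exact: (etrans (e u v) (etrans (bilin_sum_sym u v (fun a b => jac_derive_sym_basis a b Dy)) (esym (e v u)))).
Qed.

(** The pulled-back connection is torsion-free because second derivatives of [tau] are symmetric,
    and metric because [tau] is an isometry; uniqueness identifies it. *)
Lemma levi_civita_chart y v : D y ->
  jac tau y *m levi_civita g y v =
  levi_civita h (tau y) (jac tau y *m v) *m jac tau y + deriv_mx (jac tau) y v.
Proof.
move=> Dy; have uJ := jac_unit Dy.
pose Gam v := invmx (jac tau y) *m
  (levi_civita h (tau y) (jac tau y *m v) *m jac tau y + deriv_mx (jac tau) y v).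
suff -> : levi_civita g y v = Gam v by rewrite mulmxA mulmxV // mul1mx.
apply: (levi_civita_unique (Gam := Gam) oD Dy gT sg (gU Dy)) => [u w|w].
  have t := levi_civita_torsion_free (jac tau y *m u) (jac tau y *m w) oD' (tauD Dy) hT.
  exact: (torsion_frame (invmx (jac tau y)) t (jac_derive_sym w u Dy)).
have dJ := smooth_mx_is_dmx w oD Dy smooth_jac.
have dh := is_dmx_chain oD' (tauD Dy) sh (is_dmx_tau w Dy).
have dg := is_dmx_congr oD Dy (fun z Dz => esym (isom Dz)) (is_dmxM (is_dmxM (is_dmx_tr dJ) dh) dJ).
apply: (etrans (is_dmx_deriv_mx dg)).
have m := levi_civita_metric (jac tau y *m w) oD' (tauD Dy) hT sh (hU (tauD Dy)).
exact: (metric_frame (deriv_mx (jac tau) y w) uJ m (isom Dy)).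
Qed.

End ChartChange.

Section FrameChange.
Local Open Scope classical_set_scope.
Context {R : realType}.
Local Notation E := 'cV[R]_16.
Implicit Types (x y u v : E).
Context (D D' : set E) (tau : E -> E) (g h F F' : E -> 'M[R]_16).
Hypotheses (oD : open D) (oD' : open D') (tauD : forall y, D y -> D' (tau y)).
Hypotheses (stau : smooth_mx D tau) (sg : smooth_mx D g) (sh : smooth_mx D' h).
Hypotheses (gT : forall y, D y -> (g y)^T = g y) (hT : forall y, D' y -> (h y)^T = h y).
Hypotheses (gU : forall y, D y -> g y \in unitmx) (hU : forall y, D' y -> h y \in unitmx).
Hypothesis isom : forall y, D y -> g y = (jac tau y)^T *m h (tau y) *m jac tau y.
Hypotheses (sF : smooth_mx D F) (sF' : smooth_mx D' F').
Hypothesis FF' : forall y, D y -> jac tau y *m F y = F' (tau y).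
Hypothesis F'U : forall y, D' y -> F' y \in unitmx.

Lemma invmx_left (A B : 'M[R]_16) : A *m B = 1%:M -> invmx B = A.
Proof.
move=> h1; have [_ uB] := mulmx1_unit h1.
by rewrite -[LHS]mul1mx -h1 -mulmxA mulmxV // mulmx1.
Qed.

(** Carries a condition on the connection form, established in one chart, to the corresponding frame
    in any other chart. *)
Lemma connection_form_chart y v : D y ->
  connection_form g F y v = connection_form h F' (tau y) (jac tau y *m v).
Proof.
move=> Dy; have uF' := F'U (tauD Dy).
have iF : invmx (F y) = invmx (F' (tau y)) *m jac tau y.
  by apply: invmx_left; rewrite -mulmxA FF' // mulVmx.
rewrite /connection_form iF -mulmxA mulmxDr mulmxA.
rewrite (levi_civita_chart oD oD' tauD stau sg sh gT hT gU hU isom v Dy).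
congr (_ *m _); rewrite mulmxDl -mulmxA FF' // addrCA addrC; congr (_ + _).
have d1 := is_dmxM (smooth_mx_is_dmx v oD Dy (smooth_jac stau)) (smooth_mx_is_dmx v oD Dy sF).
have d2 := is_dmx_chain oD' (tauD Dy) sF' (is_dmx_tau oD stau v Dy).
by rewrite (is_dmx_unique d2 (is_dmx_congr oD Dy FF' d1)) addrC.
Qed.

End FrameChange.

(** * Adapted frames and the preservation of V *)

Section ParallelFrames.
Local Open Scope classical_set_scope.
Context {R : realType} (J : 'I_9 -> 'M[R]_16) (hJ : clifford_system J).
Context (M : manifold R 16) (g : chart_index M -> 'cV[R]_16 -> 'M[R]_16).
Context (Q : chart_index M -> 'cV[R]_16 -> set 'M[R]_16).
Hypotheses (hg : riemannian_metric setT g) (hQ : reduction (Spin9 J) g Q).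
Context (U : set M) (g' : chart_index M -> 'cV[R]_16 -> 'M[R]_16).

(** The vectors of the frame need not be parallel: the frame is adapted to [Q], and the connection
    form of [g'] in it takes values in spin(9) ⊕ R. *)
Definition parallel_frame i (D : set 'cV[R]_16) (F : 'cV[R]_16 -> 'M[R]_16) :=
  [/\ open D, D `<=` cdom i U, smooth_mx D F, forall y, D y -> Q i y (F y)
    & forall y v, D y -> clifford_normalizing J (connection_form (g' i) F y v)].

Hypothesis par : forall i x, cdom i U x -> exists D F, D x /\ parallel_frame i D F.

(** A section of V is F a F^-1 with [a] in the span of the generators; both da and [ω, a] remain in
    that span. *)
Lemma parallel_frames_preserve : preserves_V J Q U g'.
Proof.
move=> i W A oW WU sA VA x v Wx.
have [D [F [Dx [oD DU sF QF nF]]]] := par (WU x Wx).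
pose C := W `&` D; have oC : open C by exact: openI.
have Cx : C x by split.
have CW : C `<=` W by move=> y [].
have CD : C `<=` D by move=> y [].
have cC y : C y -> cdom i setT y by move=> /CW/WU/cdom_sub.
have hF y : C y -> (F y)^T *m g i y *m F y = 1%:M.
  by move=> Cy; apply: (reduction_frame hQ (cC y Cy)); exact/QF/CD.
have sg : smooth_mx C (g i) by case: hg => h _ _ _; apply: smooth_mx_sub (h i) => y /cC.
have sFC := smooth_mx_sub CD sF; have sAC := smooth_mx_sub CW sA.
pose N y := (F y)^T *m g i y.
have sN : smooth_mx C N by apply: smooth_mxM => //; exact: smooth_mx_tr.
pose a y := N y *m A y *m F y.
have sa : smooth_mx C a by apply: smooth_mxM => //; exact: smooth_mxM.
have ha y : C y -> in_clifford J (a y).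
  move=> Cy; have [_ iF _ _] := orthonormal_inv (hF y Cy).
  by rewrite /a /N -iF; apply/(V_bundleP hJ hQ _ (cC y Cy) (QF y (CD y Cy))); apply: VA; exact: CW.
have [uF iF _ _] := orthonormal_inv (hF x Cx).
have NF y : C y -> N y *m F y = 1%:M by exact: hF.
have da := in_clifford_derive oC Cx ha (smooth_mx_is_dmx v oC Cx sa).
have eA y : C y -> F y *m a y *m N y = A y.
  by move=> Cy; exact: frame_conjK (NF y Cy).
have dA : deriv_mx A x v = deriv_mx F x v *m a x *m N x + F x *m deriv_mx a x v *m N x
    + F x *m a x *m deriv_mx N x v.
  have d := is_dmxM (is_dmxM (smooth_mx_is_dmx v oC Cx sFC) (smooth_mx_is_dmx v oC Cx sa))
    (smooth_mx_is_dmx v oC Cx sN).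
  by rewrite (is_dmx_deriv_mx (is_dmx_congr oC Cx eA d)) mulmxDl.
have e := frame_commutator (levi_civita (g' i) x v) (a x) (deriv_mx a x v) (NF x Cx)
  (mulmx1C (NF x Cx)) (derive_left_inverse v oC Cx sFC sN NF).
apply/(V_bundleP hJ hQ _ (cC x Cx) (QF x Dx)).
rewrite dA -{1 2}(eA x Cx) e iF (frame_conjK _ (mulmx1C (NF x Cx))); apply: in_cliffordD => //; apply: ad_in_clifford; last exact: ha.
have := nF x v Dx; rewrite /connection_form iF; exact.
Qed.

End ParallelFrames.

(** * Linear differential equations in spin(9) *)

Section Transport.
Local Open Scope classical_set_scope.
Context {R : realType} (J : 'I_9 -> 'M[R]_16) (hJ : clifford_system J).
Implicit Types (X Y Z A B W : 'M[R]_16).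

Lemma constant_of_derive0 (f : R -> R) (a b : R) : a <= b ->
  (forall t : R, a <= t <= b -> is_derive t (1 : R) f 0) -> f b = f a.
Proof.
move=> ab hf; have [s||c hc /eqP] := @MVT_segment R f (fun=> 0) a b ab.
- by rewrite in_itv /= => /andP[/ltW s1 /ltW s2]; apply/hf/andP.
- by apply: derivable_within_continuous => s; rewrite in_itv /= => /hf[].
- by rewrite mul0r subr_eq0 => /eqP.
Qed.

Lemma mxtr_ad A W Z : \tr (A * ad W Z) = - \tr (ad W A * Z).
Proof.
have trB (P K : 'M[R]_16) : \tr (P - K) = \tr P - \tr K :> R by exact: (raddfB (@mxtrace R 16)).
rewrite /ad mulrBr mulrBl !trB opprB; congr (_ - _); first by rewrite mulrA.
by rewrite mulrA (mxtr_mulC _ W) mulrA.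
Qed.

Lemma adBr X Y Z : ad X (Y - Z) = ad X Y - ad X Z. Proof. exact: linearB. Qed.

(** [ad W] is skew for the pairing tr (X Y); preserving the span of the generators, it preserves its
    orthogonal complement too. *)
Lemma clifford_proj_ad W X : clifford_normalizing J W ->
  clifford_proj J (ad W X) = ad W (clifford_proj J X).
Proof.
move=> nW; pose Z := X - clifford_proj J X.
have oZ Y : in_clifford J Y -> \tr (Y * Z) = 0.
  move=> /in_cliffordE->; rewrite mulr_suml (raddf_sum (@mxtrace R 16)) big1 // => a _.
  rewrite -scalerAl [LHS]mxtraceZ /Z mulrBr raddfB /= /clifford_proj mxtr_clifford_sum //.
  by rewrite [16 * _]mulrC mulfVK ?pnatr_eq0 // subrr mulr0.
have Z0 : clifford_proj J (ad W Z) = 0.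
  rewrite /clifford_proj big1 // => a _.
  rewrite mxtr_ad.
  by rewrite (oZ _ (nW a)) oppr0 mul0r scale0r.
have eX : X = clifford_proj J X + Z by rewrite addrC subrK.
rewrite {1}eX (linearD (ad W)) clifford_projD Z0 addr0; apply: ad_in_clifford => //.
by apply/(in_cliffordP hJ); exists (\col_a (\tr (J a * X) / 16)); apply: eq_bigr => a _; rewrite mxE.
Qed.

Lemma mxtr_ad_self W Z : W^T = - W -> \tr ((ad W Z)^T * Z) + \tr (Z^T * ad W Z) = 0.
Proof.
move=> hW; rewrite mxtr_ad; suff -> : (ad W Z)^T = ad W Z^T by rewrite subrr.
by rewrite /ad [LHS]linearB /= !trmx_mulr hW mulrN mulNr opprK addrC.
Qed.

Lemma mxtr_sqr_eq0 Z : \tr (Z^T * Z) = 0 -> Z = 0.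
Proof.
rewrite mxtr_tr_mul => h; apply/matrixP => i j; rewrite mxE.
have h1 := psumr_eq0P (fun k _ => sumr_ge0 _ (fun l _ => sqr_ge0 (Z k l))) h.
have /eqP := @psumr_eq0P _ _ _ _ (fun l _ => sqr_ge0 (Z i l)) (h1 i isT) j isT.
by rewrite sqrf_eq0 => /eqP.
Qed.

Lemma Spin9M A B : Spin9 J A -> Spin9 J B -> Spin9 J (A * B).
Proof.
move=> sA sB; have [hA _] := Spin9_orth hJ sA; have [hB _] := Spin9_orth hJ sB.
apply/(Spin9P hJ); split=> [|a].
  by rewrite trmx_mulr -mulrA (mulrA A^T) hA mul1r.
by rewrite conj_mul_tr; do 2!apply: Spin9_conj_in => //; exact: in_clifford_gen.
Qed.

(* Along a curve with G' = - W G and W skew, G^T G is constant; the component of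
   G J_a G^T orthogonal to the span of the J_b satisfies Z' = - [W, Z], hence has
   constant norm. *)
Lemma spin9_transport (G W : R -> 'M[R]_16) (a b s t : R) :
  (forall r, a <= r <= b -> spin9_lie J (W r)) ->
  (forall r : R, a <= r <= b -> is_dmx G r (1 : R) (- (W r * G r))) ->
  a <= s <= b -> a <= t <= b -> Spin9 J (G s) -> Spin9 J (G t).
Proof.
move=> hW dG hs ht.
have cst (f : R -> R) : (forall r : R, a <= r <= b -> is_derive r (1 : R) f 0) -> f t = f s.
  move=> hf; case/andP: hs ht => as_ sb /andP[at_ tb].
  have [st|ts] := leP s t; [|apply: esym; move/ltW: ts => ts].
    apply: constant_of_derive0 st _ => r /andP[h1 h2]; apply: hf.
    by rewrite (le_trans as_ h1) (le_trans h2 tb).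
  apply: constant_of_derive0 ts _ => r /andP[h1 h2]; apply: hf.
  by rewrite (le_trans at_ h1) (le_trans h2 sb).
have cstM (H : R -> 'M[R]_16) : (forall r : R, a <= r <= b -> is_dmx H r (1 : R) 0) -> H t = H s.
  move=> hH; apply/matrixP => i j; apply: (cst (fun r => H r i j)) => r hr.
  by have := hH r hr i j; rewrite mxE.
have wT r : a <= r <= b -> (W r)^T = - W r.
  by move=> /hW/(spin9_lieP hJ)[].
move=> /(Spin9P hJ)[h1 h2]; apply/(Spin9P hJ); split=> [|c].
  rewrite -h1; apply: (cstM (fun r => (G r)^T * G r)) => r hr.
  apply: (is_dmx_eq (is_dmxM (is_dmx_tr (dG r hr)) (dG r hr))).
  have e := wT r hr; move: (W r) (G r) e => w g e.
  by rewrite !mulmxE [(- _)^T]raddfN /= trmx_mulr e !(mulrN, mulNr, opprK) mulrA subrr.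
pose X r := G r * J c * (G r)^T; pose Z r := X r - clifford_proj J (X r).
have dX r : a <= r <= b -> is_dmx X r (1 : R) (- ad (W r) (X r)).
  move=> hr; have d1 := is_dmxM (dG r hr) (is_dmx_cst (J c) r (1 : R)).
  apply: (is_dmx_eq (is_dmxM d1 (is_dmx_tr (dG r hr)))).
  have e := wT r hr; rewrite /X; move: (W r) (G r) e => w g e.
  rewrite !mulmxE mulr0 addr0 [(- _)^T]raddfN /= trmx_mulr e /ad opprB !(mulrN, mulNr, opprK) !mulrA.
  by rewrite addrC.
have dZ r : a <= r <= b -> is_dmx Z r (1 : R) (- ad (W r) (Z r)).
  move=> hr; have /(spin9_lieP hJ)[_ nW] := hW r hr.
  have dP : is_dmx (fun q => clifford_proj J (X q)) r (1 : R) (- ad (W r) (clifford_proj J (X r))).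
    rewrite -clifford_proj_ad // -scaleN1r -clifford_projZ scaleN1r.
    apply: is_dmx_sum => d _.
    have h := is_derive_mul (is_derive_mxtrace (is_dmxM (is_dmx_cst (J d) r (1 : R)) (dX r hr)))
      (is_derive_const (16^-1 : R) r (1 : R)).
    apply: (is_dmx_eq (is_dmxZ h (is_dmx_cst (J d) r (1 : R)))).
    by rewrite mul0mx add0r mulr0 addr0 scaler0 addr0.
  apply: (is_dmx_eq (is_dmxB (dX r hr) dP)).
  by rewrite adBr [RHS]opprB opprK addrC.
have n : \tr ((Z t)^T * Z t) = \tr ((Z s)^T * Z s).
  apply: (cst (fun r => \tr ((Z r)^T * Z r))) => r hr.
  have := is_derive_mxtrace (is_dmxM (is_dmx_tr (dZ r hr)) (dZ r hr)).
  rewrite !mulmxE mxtraceD [(- ad _ _)^T]raddfN /= mulNr mulrN !(raddfN (@mxtrace R 16)) -opprD.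
  by rewrite mxtr_ad_self ?oppr0 //; exact: wT.
have Zs : Z s = 0 by rewrite /Z (h2 c) subrr.
rewrite Zs mulr0 mxtrace0 in n.
by have /eqP := mxtr_sqr_eq0 n; rewrite subr_eq0 => /eqP/esym.
Qed.

End Transport.

(** The transport equation P' = - Γ P written in a moving frame: [e] is a conformal factor, - [d]
    its logarithmic derivative, [K] a constant initial frame, and the result has the form G' = - W
    G. *)
Lemma transport_frame (R : realType) (F N dF dN Gam P K : 'M[R]_16) (e d : R) :
  N *m F = 1%:M -> dN = - (N *m dF *m N) ->
  (e * - d) *: (N *m P *m K) + e *: ((dN *m P + N *m - (Gam *m P)) *m K + N *m P *m 0) =
    - ((N *m (dF + Gam *m F) + d *: 1) * (e *: (N *m P *m K))).
Proof.
move=> /mulmx1C FN ->; rewrite mulmx0 addr0 -scalerAr mulrDl -scalerAl mul1r -!mulmxE.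
have k q (Z : 'M[R]_(16, q)) : F *m (N *m Z) = Z by rewrite mulmxA FN mul1mx.
rewrite !(mulmxDl, mulmxDr, mulNmx, mulmxN) -!mulmxA k.
move: (N *m (P *m K)) (N *m (dF *m (N *m (P *m K)))) (N *m (Gam *m (P *m K))) => p q r.
by apply/matrixP => a b; rewrite !mxE; ring.
Qed.

Lemma frame_cancel (R : realType) (A F N P K : 'M[R]_16) : N *m F = 1%:M ->
  A *m F *m (N *m P *m K) = A *m P *m K.
Proof. by move=> /mulmx1C FN; rewrite !mulmxA -(mulmxA A) FN mulmx1. Qed.

(** * Holonomy of the locally rescaled metric *)

Section Holonomy.
Local Open Scope classical_set_scope.
Context {R : realType} (J : 'I_9 -> 'M[R]_16) (hJ : clifford_system J).
Context (M : manifold R 16) (g : chart_index M -> 'cV[R]_16 -> 'M[R]_16).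
Context (Q : chart_index M -> 'cV[R]_16 -> set 'M[R]_16).
Hypotheses (hg : riemannian_metric setT g) (hQ : reduction (Spin9 J) g Q).
Context (U : set M) (g' : chart_index M -> 'cV[R]_16 -> 'M[R]_16) (f : M -> R).
Hypotheses (hg' : riemannian_metric U g') (sf : forall i, smooth (cdom i U) (f \o param i)).
Hypothesis conf : forall i x, cdom i U x -> g i x = expR (f (param i x)) *: g' i x.
Hypothesis par : forall i x, cdom i U x -> exists D F, D x /\ parallel_frame J Q U g' i D F.
Local Notation E := 'cV[R]_16.

Let grad i (x : E) : 'rV[R]_16 := \row_a 'D_(basis_vec a) (f \o param i) x.

(** Adding half of df cancels the trace that the connection form of [g'] has because the frame is
    orthonormal for [g]; the sum is skew, hence in spin(9). *)
Lemma parallel_frame_lie i D F x v : parallel_frame J Q U g' i D F -> D x ->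
  spin9_lie J (connection_form (g' i) F x v + (2^-1 * (grad i x *m v) 0 0) *: 1).
Proof.
move=> [oD DU sF QF nF] Dx; apply/(spin9_lieP hJ); split; last first.
  by apply: normalizingD; [exact: nF|apply: normalizingZ; exact: normalizing1].
have cD y : D y -> cdom i setT y by move=> /DU/cdom_sub.
have hF y : D y -> (F y)^T *m g i y *m F y = 1%:M.
  by move=> Dy; exact: (reduction_frame hQ (cD y Dy) (QF y Dy)).
have sg : smooth_mx D (g i) by case: hg => h _ _ _; apply: smooth_mx_sub (h i) => y /cD.
have gT y : D y -> (g i y)^T = g i y by move=> /cD; exact: (metric_sub hg).
have sg' : smooth_mx D (g' i) by case: hg' => h _ _ _; exact: smooth_mx_sub DU (h i).
have gT' y : D y -> (g' i y)^T = g' i y by move=> /DU; exact: (metric_sub hg').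
have sfD : smooth D (f \o param i) by move=> k; exact: Ck_sub DU (sf i k).
have eD y : D y -> g i y = expR ((f \o param i) y) *: g' i y by move=> /DU; exact: conf.
have [uF _ uG _] := orthonormal_inv (hF x Dx).
have uG' : g' i x \in unitmx.
  by move: uG; rewrite eD // unitmx_expRZ.
have := connection_form_conformal (invmx (F x) *m v) oD Dx sg gT sg' gT' uG' sfD eD (hF x Dx).
rewrite /= mulmxA mulmxV // mul1mx -/(grad i x).
have := connection_form_skew v oD Dx gT sg sF hF.
move: (connection_form (g i) F x v) (connection_form (g' i) F x v) (wedge _ _)
  (wedgeT (invmx (F x) *m v) ((F x)^T *m (grad i x)^T)) => A B C hC hA hAB.
suff -> : B + (2^-1 * (grad i x *m v) 0 0) *: 1 = A - 2^-1 *: C.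
  by apply: skew_sub => //; rewrite linearZ /= hC scalerN.
by rewrite hAB scalerDr scalerA addrA addrK.
Qed.

(** Adapted frames exist only locally along the path. Hence the property [S t], that the transport
    up to time t lies in Spin(9) in every adapted frame, is shown to be locally constant in t and is
    carried from 0 to 1. *)
Lemma path_transport i (D : set R) (c : R -> E) (P : R -> 'M[R]_16) F0 F1 :
  open D -> `[0, 1]%classic `<=` D -> (forall t, D t -> cdom i U (c t)) ->
  smooth_curve D c -> smooth_curve D P -> P 0 = 1%:M ->
  (forall t, D t -> deriv_curve P t = - (levi_civita (g' i) (c t) (deriv_curve c t) *m P t)) ->
  Q i (c 0) F0 -> Q i (c 1) F1 ->
  Spin9 J (expR (2^-1 * (f (param i (c 0)) - f (param i (c 1)))) *: (invmx F1 *m P 1 *m F0)).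
Proof.
move=> oD D01 cU sc sP P0 dP Q0.
pose k0 := f (param i (c 0)).
pose S t := forall Ft, Q i (c t) Ft ->
  Spin9 J (expR (2^-1 * (k0 - f (param i (c t)))) *: (invmx Ft *m P t *m F0)).
have cC t : D t -> cdom i setT (c t) by move=> /cU/cdom_sub.
have dc t : D t -> is_dmx c t (1 : R) (deriv_curve c t).
  by move=> Dt a b; rewrite mxE derive1E; apply/derivableP; exact: (sc 0 a b t Dt).
have dP' t : D t -> is_dmx P t (1 : R) (deriv_curve P t).
  by move=> Dt a b; rewrite mxE derive1E; apply/derivableP; exact: (sP 0 a b t Dt).
have loc t : D t -> exists2 r, 0 < r & forall s, `|s - t| <= r -> S s <-> S t.
  move=> Dt; have [D' [F [D't pF]]] := par (cU t Dt); have [oD' D'U sF QF nF] := pF.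
  have ct : {for t, continuous c}.
    by apply: continuous_entries => a; exact: is_derive1_continuous (dc t Dt a 0).
  have n1 : nbhs t (c @^-1` D') by apply: ct; apply: open_nbhs_nbhs; split.
  have n2 : nbhs t D by apply: open_nbhs_nbhs; split.
  have [e /= e0 he] := (nbhs_ballP t _).1 (filterI n1 n2).
  have e20 : 0 < e / 2 by rewrite divr_gt0.
  have hb q : `|q - t| <= e / 2 -> D' (c q) /\ D q.
    move=> hq; apply: (he q); rewrite /ball /= distrC; apply: le_lt_trans hq _; lra.
  pose N y := (F y)^T *m g i y.
  have NF y : D' y -> N y *m F y = 1%:M.
    by move=> D'y; apply: (reduction_frame hQ (cdom_sub (D'U y D'y)) (QF y D'y)).
  have iF y : D' y -> invmx (F y) = N y by move=> /NF/orthonormal_inv[].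
  pose G q := expR (2^-1 * (k0 - (f \o param i) (c q))) *: (N (c q) *m P q *m F0).
  (* Adapted frames at one point differ by Spin(9), so the smooth local frame [F] suffices to test
     [S q]. *)
  have SG q : `|q - t| <= e / 2 -> S q <-> Spin9 J (G q).
    move=> /hb[D'q Dq]; split=> [h|h Ft hFt].
      by have := h _ (QF _ D'q); rewrite iF.
    have := Spin9M hJ (reduction_trans hQ (cC q Dq) hFt (QF _ D'q)) h.
    rewrite /G -scalerAr -mulmxE; congr (Spin9 J (_ *: _)).
    exact: frame_cancel (NF _ D'q).
  pose W q := connection_form (g' i) F (c q) (deriv_curve c q) +
    (2^-1 * (grad i (c q) *m deriv_curve c q) 0 0) *: 1.
  have sg : smooth_mx D' (g i).
    by case: hg => h _ _ _; apply: smooth_mx_sub (h i) => y /D'U/cdom_sub.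
  have sN : smooth_mx D' N by apply: smooth_mxM => //; exact: smooth_mx_tr.
  have sfD : smooth D' (f \o param i) by move=> k; exact: Ck_sub D'U (sf i k).
  have dG q : `|q - t| <= e / 2 -> is_dmx G q (1 : R) (- (W q * G q)).
    move=> /hb[D'q Dq].
    have df : is_derive q (1 : R) (fun s => (f \o param i) (c s)) ((grad i (c q) *m deriv_curve c q) 0 0).
      have -> : (grad i (c q) *m deriv_curve c q) 0 0 =
          \sum_a deriv_curve c q a 0 * 'D_(basis_vec a) (f \o param i) (c q).
        by rewrite mxE; apply: eq_bigr => a _; rewrite [grad _ _ _ _]mxE mulrC.
      exact: (is_derive_chain oD' D'q (sfD 1) (dc q Dq)).
    have d1 := is_derive_exp (is_derive_mul (is_derive_const (2^-1 : R) q (1 : R))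
      (is_derive_add (is_derive_const k0 q (1 : R)) (is_derive_opp df))).
    have d2 := is_dmxM (is_dmxM (is_dmx_chain oD' D'q sN (dc q Dq)) (dP' q Dq))
      (is_dmx_cst F0 q (1 : R)).
    apply: (is_dmx_eq (is_dmxZ d1 d2)); rewrite mul0r !add0r mulrN dP // /W /connection_form iF //.
    exact: (transport_frame _ _ _ _ _ (NF _ D'q) (derive_left_inverse _ oD' D'q sF sN NF)).
  exists (e / 2) => // s hs.
  have tt : t - e / 2 <= t <= t + e / 2 by apply/andP; split; lra.
  have ts : t - e / 2 <= s <= t + e / 2 by rewrite -ler_distl.
  have hW q : t - e / 2 <= q <= t + e / 2 -> spin9_lie J (W q).
    by rewrite -ler_distl => /hb[D'q _]; exact: (parallel_frame_lie _ pF D'q).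
  have {}dG q : t - e / 2 <= q <= t + e / 2 -> is_dmx G q (1 : R) (- (W q * G q)).
    by rewrite -ler_distl; exact: dG.
  apply: (iff_trans (SG s hs)); apply: iff_sym.
  apply: (iff_trans (SG t _)); first by rewrite subrr normr0 ltW.
  by split=> h; [exact: (spin9_transport hJ hW dG tt ts)|exact: (spin9_transport hJ hW dG ts tt)].
have S0 : S 0.
  move=> Ft hFt; rewrite P0 mulmx1 subrr mulr0 expR0 scale1r.
  have D0 : D 0 by apply: D01; rewrite /= in_itv /= lexx ler01.
  exact: (reduction_trans hQ (cC 0 D0) hFt Q0).
suff S1 : S 1 by move=> Q1; exact: S1.
(* Connectedness of [0, 1] in the form of the mean value theorem: the indicator of [S] is locally
   constant, so its derivative vanishes. *)
pose chi t : R := if `[< S t >] then 1 else 0.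
have chi1 : chi 1 = chi 0.
  apply: constant_of_derive0 ler01 _ => t t01.
  have [r r0 hr] := loc t (D01 _ t01).
  apply: near_eq_is_derive (is_derive_const (chi t) t (1 : R)).
  apply/nbhs_ballP; exists r => //= s; rewrite /ball /= distrC => /ltW/hr e.
  by rewrite /chi (asbool_equiv_eq e).
move: chi1; rewrite /chi (asboolT S0); case: asboolP => // _ /eqP.
by rewrite eq_sym oner_eq0.
Qed.

(* The conformal factor accounts for frames of Q being orthonormal for g, not for g'. *)
Lemma ptransport_Spin9 i x j y P : ptransport U g' i x j y P ->
  [/\ cdom i U x, cdom j U y & forall F0 F1, Q i x F0 -> Q j y F1 ->
    Spin9 J (expR (2^-1 * (f (param i x) - f (param j y))) *: (invmx F1 *m P *m F0))].
Proof.
have [_ _ hQc hQs] := hQ.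
elim=> {i x j y P} [i j x|i D c P oD D01 cU sc sP P0 dP|
    i j k x y z P P' _ [cx cy IH] _ [_ cz IH']].
- move=> /cdomP[di [dj Ux] e].
  have ey : param j (transition i j x) = param i x by rewrite /transition /= chartK.
  split; [by apply/cdomP|  by apply/cdomP; rewrite /transition /= chartK | move=> F0 F1 Q0 Q1].
  rewrite ey subrr mulr0 expR0 scale1r -mulmxA.
  apply: (reduction_trans hQ (i := j) (x := transition i j x) _ Q1); first  by apply/cdomP; rewrite /transition /= chartK.
  by apply/(hQc i j x F0) => //; apply/cdomP.
- split=> [||F0 F1]; last exact: (path_transport oD D01 cU sc sP P0 dP).
    by apply: cU; apply: D01; rewrite /= in_itv /= lexx ler01.
  by apply: cU; apply: D01; rewrite /= in_itv /= lexx ler01.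
- split=> // F0 F1 Q0 Q1.
  have [V [F [_ Vy _ _ QF]]] := hQs j y (cdom_sub cy).
  have := Spin9M hJ (IH' _ _ (QF y Vy) Q1) (IH _ _ Q0 (QF y Vy)).
  have [uF _ _ _] := orthonormal_inv (reduction_frame hQ (cdom_sub cy) (QF y Vy)).
  rewrite -scalerAl -scalerAr scalerA -expRD -mulrDr -mulmxE addrC addrA subrK.
  congr (Spin9 J (_ *: _)); rewrite !mulmxA; congr (_ *m _ *m _).
  by rewrite -(mulmxA _ (F y)) mulmxV // mulmx1.
Qed.

Lemma parallel_frames_holonomy : holonomy_in_Spin9 J Q U g'.
Proof.
move=> i x F A hx QF /ptransport_Spin9[_ _ h].
by have := h F F QF QF; rewrite subrr mulr0 expR0 scale1r.
Qed.

End Holonomy.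

(** T^-1 F is written as G^-1 T^T G0 F with G^-1 = H H^T for an orthonormal frame [H], so that the
    pulled-back frame is visibly smooth. *)
Lemma inverse_jacobian_frame (R : realType) (G G0 T H F : 'M[R]_16) :
  H^T *m G *m H = 1%:M -> G = T^T *m G0 *m T ->
  T *m (H *m H^T *m (T^T *m G0 *m F)) = F.
Proof.
move=> /orthonormal_inv[_ _ uG <-] e.
have uT : T \in unitmx by move: uG; rewrite e unitmx_mul => /andP[].
have -> : T^T *m G0 *m F = G *m (invmx T *m F) by rewrite e -!mulmxA (mulmxA T (invmx T)) mulmxV // mul1mx.
by rewrite (mulmxA (invmx G)) mulVmx // mul1mx mulmxA mulmxV // mul1mx.
Qed.

(** * Structures of vectorial type are locally conformally parallel *)

Section VectorialIsConformallyParallel.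
Local Open Scope classical_set_scope.
Context {R : realType} (J : 'I_9 -> 'M[R]_16) (hJ : clifford_system J).
Context (M : manifold R 16) (g : chart_index M -> 'cV[R]_16 -> 'M[R]_16).
Context (Q : chart_index M -> 'cV[R]_16 -> set 'M[R]_16).
Hypotheses (hg : riemannian_metric setT g) (hQ : reduction (Spin9 J) g Q).
Hypothesis hv : vectorial_type J g Q.
Local Notation E := 'cV[R]_16.

Lemma vectorial_wedge i (W : set E) F y : open W -> W `<=` cdom i setT -> smooth_mx W F ->
  (forall y, W y -> Q i y (F y)) -> W y ->
  exists w, forall u, spin9_lie J (connection_form (g i) F y (F y *m u) - wedge u w).
Proof.
move=> oW Ws sF QF Wy; have [th [_ h2 [T hT [w0 hw]]]] := hv oW Ws sF QF Wy.
have [mu hmu] := embedding_unique hJ hT; exists (mu *: w0) => u.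
rewrite wedgeZr.
have /(spin9_lieP hJ)[s1 n1] := h2 u; have /(spin9_lieP hJ)[s2 n2] := hmu w0 u.
rewrite hw in s1 n1; move: s1 s2 n1 n2.
move: (connection_form _ _ _ _) (T w0 u) (mu *: _) => A B C s1 s2 n1 n2.
have -> : A - C = (A - B) + (B - C) by rewrite addrA subrK.
by apply/(spin9_lieP hJ); split; [rewrite [LHS]linearD /= s1 s2 -opprD | exact: normalizingD].
Qed.

Definition conformally_parallel_on (U : set M) := open U /\
  exists (f : M -> R) (g' : chart_index M -> E -> 'M[R]_16),
    [/\ forall i, smooth (cdom i U) (f \o param i),
        riemannian_metric U g',
        forall i x, cdom i U x -> g i x = expR (f (param i x)) *: g' i x,
        holonomy_in_Spin9 J Q U g'
      & preserves_V J Q U g'].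

Section Neighbourhood.
Context (i0 : chart_index M) (x0 : E) (r : R) (phi : E -> R) (F : E -> 'M[R]_16).
Local Notation B := (ball x0 r).
Hypotheses (Bs : B `<=` cdom i0 setT) (sphi : smooth B phi) (sF : smooth_mx B F).
Hypothesis QF : forall y, B y -> Q i0 y (F y).
Let h y := expR (- phi y) *: g i0 y.
Hypothesis nF : forall y v, B y -> clifford_normalizing J (connection_form h F y v).

Let U := dom i0 `&` chart i0 @^-1` B.
(** Outside [dom i0] the values of the chart, and so of [f], are arbitrary; only points of [U] are
    considered. *)
Let f p := phi (chart i0 p).
Let g' i x := expR (- f (param i x)) *: g i x.

Lemma chart_ball_open : open U.
Proof.
rewrite openE => p [dp Bp]; apply: filterI.
  by apply: open_nbhs_nbhs; split=> //; exact: dom_open.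
by apply: (chart_continuous dp); apply: open_nbhs_nbhs; split=> //; exact: ball_open.
Qed.

Let oB : open B. Proof. exact: ball_open. Qed.
Let oU i : open (cdom i U). Proof. exact/cdom_open/chart_ball_open. Qed.

Lemma transition_ball i y : cdom i U y -> B (transition i i0 y).
Proof. by move=> /cdomP[_ []]. Qed.

Lemma cdom_chart_ball i y : cdom i U y -> cdom i (dom i0) y.
Proof. by move=> /cdomP[d [d0 _] e]; apply/cdomP. Qed.

Lemma smooth_transition i : smooth_mx (cdom i U) (transition i i0).
Proof. exact: smooth_mx_sub (@cdom_chart_ball i) (transition_smooth i i0). Qed.

Lemma smooth_potential i : smooth (cdom i U) (f \o param i).
Proof.
have st a k : Ck k (cdom i U) (fun y => transition i i0 y a 0) := smooth_transition i a 0 k.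
move=> k; have := Ck_comp oB (@oU i) (@transition_ball i) (sphi k) (st^~ k).
exact.
Qed.

Lemma rescaled_metric : riemannian_metric U g'.
Proof.
have [sg gT gP gJ] := hg; split.
- move=> i; apply: smooth_mxZ => //.
    by apply: smooth_exp => //; apply: smoothN => //; exact: smooth_potential.
  by apply: smooth_mx_sub (sg i) => y /cdom_sub.
- by move=> i y /cdom_sub hy; rewrite linearZ /= gT.
- move=> i y v /cdom_sub hy v0; rewrite /g' -scalemxAr -scalemxAl mxE.
  by rewrite mulr_gt0 ?expR_gt0 //; exact: gP.
- move=> i j y hy; rewrite /g' -scalemxAr -scalemxAl.
  have [d [dj Uy] e] := (cdomP _ _ _).1 hy.
  have -> : param j (transition i j y) = param i y by rewrite /transition /= chartK.
  by congr (_ *: _); apply: gJ; apply/cdomP.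
Qed.

(** [F] lives in the chart [i0] alone, while the conditions on [U] concern every chart. The frame
    [G] is its pull-back by the transition map; the auxiliary frame [H] only expresses the inverse
    metric. *)
Lemma frames_parallel i x : cdom i U x -> exists D G, D x /\ parallel_frame J Q U g' i D G.
Proof.
move=> Ux; have [_ _ hQc hQs] := hQ; have [sg gT _ _] := hg.
have [V [H [oV Vx Vs sH QH]]] := hQs i x (cdom_sub Ux).
pose D := V `&` cdom i U; have oD : open D by exact: openI.
pose tau := transition i i0.
pose G y := H y *m (H y)^T *m ((jac tau y)^T *m g i0 (tau y) *m F (tau y)).
have DU : D `<=` cdom i U by move=> y [].
have DV : D `<=` V by move=> y [].
have tB y : D y -> B (tau y) by move=> /DU/transition_ball.
have stau : smooth_mx D tau by exact: smooth_mx_sub DU (smooth_transition i).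
have sgB : smooth_mx B (g i0) by apply: smooth_mx_sub (sg i0).
have sHD := smooth_mx_sub DV sH.
have sG : smooth_mx D G.
  apply: smooth_mxM => //; first by apply: smooth_mxM => //; exact: smooth_mx_tr.
  apply: smooth_mxM => //; last exact: smooth_mx_comp oB oD tB sF stau.
  apply: smooth_mxM => //; last exact: smooth_mx_comp oB oD tB sgB stau.
  by apply: smooth_mx_tr; exact: smooth_jac.
have orthH y : D y -> (H y)^T *m g i y *m H y = 1%:M.
  by move=> Dy; apply: (reduction_frame hQ (cdom_sub (DU y Dy))); exact/QH/DV.
have orthF y : B y -> (F y)^T *m g i0 y *m F y = 1%:M.
  by move=> By; apply: (reduction_frame hQ (Bs By)); exact: QF.
have TG y : D y -> jac tau y *m G y = F (tau y).
  move=> Dy; apply: inverse_jacobian_frame (orthH y Dy) _.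
  have [_ _ _ gJ] := hg; apply: gJ; apply/cdomP.
  by have /cdomP[] := cdom_chart_ball (DU y Dy).
exists D, G; split; first by split.
split=> //.
  move=> y Dy; apply/(hQc i i0 y (G y) (cdom_chart_ball (DU y Dy))).
  by rewrite /tjac -/tau TG //; apply: QF; exact: tB.
move=> y v Dy.
rewrite (connection_form_chart (D := D) (D' := B) (tau := tau) (h := h) (F' := F)) //.
- by apply: nF; exact: tB.
- by apply: smooth_mx_sub DU _; have [s _ _ _] := rescaled_metric; exact: s.
- by apply: smooth_mxZ => //; apply: smooth_exp => //; exact: smoothN.
- by move=> z /DU hz; have [_ s _ _] := rescaled_metric; exact: s.
- by move=> z Bz; rewrite linearZ /= gT //; exact: Bs.
- by move=> z Dz; rewrite unitmx_expRZ; have [_ _ u _] := orthonormal_inv (orthH z Dz).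
- by move=> z Bz; rewrite unitmx_expRZ; have [_ _ u _] := orthonormal_inv (orthF z Bz).
- move=> z Dz; have [_ _ _ gJ] := hg; rewrite /h -scalemxAr -scalemxAl.
  congr (_ *: _); apply: gJ; apply/cdomP.
  by have /cdomP[] := cdom_chart_ball (DU z Dz).
- by move=> z Bz; have [u _ _ _] := orthonormal_inv (orthF z Bz).
Qed.

Lemma conformally_parallel_ball : conformally_parallel_on U.
Proof.
have conf i x : cdom i U x -> g i x = expR (f (param i x)) *: g' i x.
  by move=> _; rewrite /g' scalerA -expRD subrr expR0 scale1r.
split; first exact: chart_ball_open.
exists f, g'; split=> //.
- exact: smooth_potential.
- exact: rescaled_metric.
- exact: (parallel_frames_holonomy hJ hg hQ rescaled_metric smooth_potential conf frames_parallel).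
- exact: (parallel_frames_preserve hJ hg hQ frames_parallel).
Qed.

End Neighbourhood.

Theorem vectorial_conformally_parallel : locally_conformally_parallel J g Q.
Proof.
exists [set U | conformally_parallel_on U]; split; last by [].
rewrite -subTset => p _.
have : (\bigcup_(i in setT) dom i) p by rewrite dom_cover.
move=> [i0 _ dp]; pose x0 := chart i0 p.
have cx : cdom i0 setT x0 by exists p.
have [_ _ _ hQs] := hQ; have [W [F [oW Wx Ws sF QF]]] := hQs i0 x0 cx.
have [sg gT _ _] := hg.
have sG : smooth_mx W (g i0) by exact: smooth_mx_sub Ws (sg i0).
have GT y : W y -> (g i0 y)^T = g i0 y by move=> /Ws; exact: gT.
have FGF y : W y -> (F y)^T *m g i0 y *m F y = 1%:M.
  by move=> Wy; exact: (reduction_frame hQ (Ws y Wy) (QF y Wy)).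
have [r r0 [rW [phi sphi hphi]]] := local_potential hJ oW sG sF GT FGF
  (fun y Wy => vectorial_wedge oW Ws sF QF Wy) Wx.
exists (dom i0 `&` chart i0 @^-1` ball x0 r); last by split=> //; exact: ballxx.
apply: (conformally_parallel_ball (F := F) _ sphi) => //.
- by move=> y /rW/Ws.
- exact: smooth_mx_sub rW sF.
- by move=> y /rW; exact: QF.
- move=> y v By; have /(spin9_lieP hJ)[_ n] := hphi y v By.
  (* The multiple of 1 added in [local_potential] is subtracted again; scalars do not affect
     normalisation. *)
  have e (A : 'M[R]_16) (k : R) : A = (A + k *: 1) + (- k) *: 1 by rewrite scaleNr addrK.
  rewrite (e (connection_form _ _ _ _) (2^-1 * (lee_form J (g i0) F y *m v) 0 0)).
  by apply: normalizingD => //; apply: normalizingZ; exact: normalizing1.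
Qed.

End VectorialIsConformallyParallel.

Theorem mainTheorem5 (R : realType) (J : 'I_9 -> 'M[R]_16)
    (M : manifold R 16) (g : chart_index M -> 'cV[R]_16 -> 'M[R]_16)
    (Q : chart_index M -> 'cV[R]_16 -> set 'M[R]_16) :
  clifford_system J ->
  oriented_atlas M ->
  riemannian_metric setT g ->
  reduction (Spin9 J) g Q ->
  (vectorial_type J g Q <-> locally_conformally_parallel J g Q).
Proof.
move=> hJ _ hg hQ; split; first exact: vectorial_conformally_parallel.
exact: conformally_parallel_vectorial.
Qed.
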